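(* Work over an algebraically closed field of characteristic different from $2$. Let $\mu\in\mathbb Z[\mathrm i]$ be a Gaussian integer whose argument is incommensurable with $2\pi$ (i.e. $\mu\ne 0$ and $\arg\mu\notin 2\pi\mathbb Q$), and let $f_\mu=g\circ\varphi_\mu\colon\mathbb P^2\dashrightarrow\mathbb P^2$, where $g$ is the birational involution $$g\colon[x_0:x_1:x_2]\mapsto[x_0(x_1+x_2-x_0):x_1(x_2+x_0-x_1):x_2(x_0+x_1-x_2)]$$ and $\varphi_\mu$ is the monomial map associated with the matrix $$A_\mu=\begin{pmatrix}\operatorname{Re}\mu&-\operatorname{Im}\mu\\ \operatorname{Im}\mu&\operatorname{Re}\mu\end{pmatrix}.$$ Then the generating series $\Delta_{1,f_\mu,\mathcal O(1)}(z)=\sum_{n\ge0}\deg_{\mathcal O(1),1}(f_\mu^n)z^n$ is meromorphic in the disk $\{|z|<\lambda_2(f_\mu)^{-1/2}\}$, where it has a simple pole at $\lambda_1(f_\mu)^{-1}$ and no other poles. In addition, it admits the circle $\{|z|=\lambda_2(f_\mu)^{-1/2}\}$ as a natural boundary.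
   Context: For a matrix $A=(a_{ij})\in M_2(\mathbb Z)$ with $\det A\ne0$, the associated monomial self-map of $\mathbb P^2$ is the rational extension of $(z_1,z_2)\mapsto(z_1^{a_{11}}z_2^{a_{21}},z_1^{a_{12}}z_2^{a_{22}})$ on the torus $\mathbb G_m^2\subset\mathbb P^2$ (the complement of the coordinate lines). For a dominant rational self-map $f$ of a normal projective variety $X$ of dimension $d$ and an ample Cartier divisor $D$, $\deg_{D,k}(f)=((f^*D)^k\cdot D^{d-k})$, computed as $((\tilde f^*D)^k\cdot(\pi^*D)^{d-k})$ on any birational model $\pi\colon\tilde X\to X$ on which $\tilde f=f\circ\pi$ is a morphism. Thus, for $X=\mathbb P^2$ and $D=\mathcal O(1)$, $\deg_{D,1}(f)$ is the usual algebraic degree of $f$, and $\deg_{D,2}(f)$ is its topological degree. The dynamical degrees are $\lambda_k(f)=\lim_{n\to\infty}\deg_{D,k}(f^n)^{1/n}$, and $f^0=\mathrm{id}$. The series $\Delta_{1,f_\mu,\mathcal O(1)}$ converges near $0$; ''meromorphic in a disk'' refers to its meromorphic continuation to that disk. The bounding circle is a natural boundary if the function cannot be analytically continued at any point of the circle. *)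

(* Defs.v *)
From HB Require Import structures.
From mathcomp Require Import all_boot all_order all_algebra.
From mathcomp Require Import fraction complex.
From mathcomp Require mpoly all_classical all_reals all_analysis.

Set Implicit Arguments.
Unset Strict Implicit.
Unset Printing Implicit Defensive.

Import Order.TTheory GRing.Theory Num.Theory.
Local Open Scope ring_scope.

(* The notations of mpoly and of MathComp-Analysis cannot be active at the same
   time, so each is imported in its own module. *)
Module RationalMaps.
Import mpoly.

(* A rational self-map of the projective plane is given by a triple of forms of
   the same degree, not all zero, in the homogeneous coordinates 'X_0, 'X_1,
   'X_2; the three forms are allowed to have a common factor, and two triples
   give the same map when they are proportional over the field of fractions.  *)
Notation triple k := (3.-tuple {mpoly k[3]}).

Section Maps.
Variable k : fieldType.
Implicit Types f g h : triple k.

Definition same_map f g :=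
  forall i j : 'I_3, tnth f i * tnth g j = tnth f j * tnth g i.

Definition id_map : triple k := [tuple 'X_i | i < 3].

(* [comp_map f g] is f \o g; for dominant g it is again a nonzero triple. *)
Definition comp_map f g : triple k := [tuple tnth f i \mPo g | i < 3].

Definition iter_map (n : nat) f : triple k := iter n (comp_map f) id_map.

Definition no_common_factor f :=
  forall p : {mpoly k[3]},
    (forall i, exists q : {mpoly k[3]}, tnth f i = p * q) -> p \is a GRing.unit.

Definition has_alg_degree f (d : nat) :=
  exists h, [/\ same_map f h, no_common_factor h &
                forall i, tnth h i \is d.-homog].

Local Notation K := {fraction {mpoly k[3]}}.
Local Notation "p %:F" := (@tofrac {mpoly k[3]} p).

(* The function field of the plane: homogeneous fractions of degree 0. *)
Definition function_field (u : K) :=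
  exists (d : nat) (p q : {mpoly k[3]}),
    [/\ p \is d.-homog, q \is d.-homog, q != 0 & u = p%:F / q%:F].

(* The subfield f^*(function_field), for f dominant. *)
Definition pullback_field f (u : K) :=
  exists (d : nat) (p q : {mpoly k[3]}),
    [/\ p \is d.-homog, q \is d.-homog, q \mPo f != 0 &
        u = (p \mPo f)%:F / (q \mPo f)%:F].

(* [E : L] = n, for subfields L and E of K: E has an n-element L-basis. *)
Definition has_ext_degree (E L : K -> Prop) (n : nat) :=
  exists b : 'I_n -> K,
    (forall i, E (b i)) /\
    (forall x, E x -> exists! c : {ffun 'I_n -> K},
       (forall i, L (c i)) /\ x = \sum_(i < n) c i * b i).

(* The degree of the extension includes its inseparable part, as does the
   intersection number ((f^*D)^2). *)
Definition has_top_degree f (n : nat) :=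
  has_ext_degree function_field (pullback_field f) n.

Definition involution_g : triple k :=
  let x0 : {mpoly k[3]} := 'X_0 in
  let x1 : {mpoly k[3]} := 'X_1 in
  let x2 : {mpoly k[3]} := 'X_2 in
  [tuple x0 * (x1 + x2 - x0); x1 * (x2 + x0 - x1); x2 * (x0 + x1 - x2)].

(* With z_i = x_i / x_0, the j-th coordinate of the monomial map is
   z_1 ^ a_1j * z_2 ^ a_2j: the exponent of x_i in it is a_ij for i > 0 and
   - (a_1j + a_2j) for i = 0.  The coordinate number 0 is the constant 1. *)
Definition monomial_exp (A : 'M[int]_2) (j i : 'I_3) : int :=
  if unlift ord0 j is Some j' then
    if unlift ord0 i is Some i' then A i' j' else - \sum_(l < 2) A l j'
  else 0.

(* Denominators are cleared by subtracting the least exponent of each x_i. *)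
Definition monomial_map (A : 'M[int]_2) : triple k :=
  [tuple \prod_(i < 3)
     'X_i ^+ absz (monomial_exp A j i
                   - \big[Order.min/0%:Z]_(l < 3) monomial_exp A l i) | j < 3].

Lemma monomial_mapE (A : 'M[int]_2) (j : 'I_2) :
  (tnth (monomial_map A) (lift ord0 j))%:F / (tnth (monomial_map A) ord0)%:F
  = \prod_(i < 2) (('X_(lift ord0 i))%:F / ('X_ord0)%:F) ^ (A i j) :> K.
Proof.
pose X (i : 'I_3) : K := ('X_i)%:F.
pose m i := \big[Order.min/0%:Z]_(l < 3) monomial_exp A l i.
have X0 i : X i != 0.
  by rewrite tofrac_eq0 -msupp_eq0 msuppX.
have mE l i : (0 <= monomial_exp A l i - m i)%R.
  by rewrite subr_ge0 /m (bigD1 l) //= ge_min lexx.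
have tE l : (tnth (monomial_map A) l)%:F =
    \prod_(i < 3) X i ^ (monomial_exp A l i - m i).
  rewrite tnth_mktuple rmorph_prod; apply: eq_bigr => i _.
  by rewrite rmorphXn -/(X i) -[in RHS](gez0_abs (mE l i)).
rewrite !tE -prodf_div.
under eq_bigr => i _.
  rewrite invr_expz -expfzDr ?X0 // opprB addrA subrK.
  have -> : monomial_exp A ord0 i = 0 by rewrite /monomial_exp unlift_none.
  rewrite subr0; over.
have E0 : monomial_exp A (lift ord0 j) ord0 = - \sum_(l < 2) A l j.
  by rewrite /monomial_exp liftK unlift_none.
have E1 (i : 'I_2) : monomial_exp A (lift ord0 j) (lift ord0 i) = A i j.
  by rewrite /monomial_exp !liftK.
rewrite [LHS]big_ord_recl E0.
under [X in _ * X = _]eq_bigr => i _ do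
  rewrite [monomial_exp _ _ _]E1.
under [RHS]eq_bigr => i _ do rewrite -/(X _) -/(X ord0) expfzMl exprz_inv.
rewrite big_split /= mulrC; congr (_ * _).
by rewrite !big_ord_recl !big_ord0 !(addr0, mulr1) opprD expfzDr // X0.
Qed.

End Maps.
End RationalMaps.

Definition gauss_mx (mu : int[i]) : 'M[int]_2 :=
  \matrix_(i < 2, j < 2)
    if i == j then complex.Re mu
    else if i == 0 then - complex.Im mu else complex.Im mu.

Definition f_mu (k : fieldType) (mu : int[i]) :=
  RationalMaps.comp_map (RationalMaps.involution_g k)
    (RationalMaps.monomial_map k (gauss_mx mu)).

Import all_classical all_reals all_analysis.
Import numFieldNormedType.Exports.
Local Open Scope classical_set_scope.
Local Open Scope complex_scope.

Section Degrees.
Variables (R : realType) (k : fieldType).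
Local Notation triple := (3.-tuple (mpoly.mpoly 3 k)).

(* Both degrees of a dominant map exist and are unique, so that the default
   value of xget plays no role for such maps. *)
Definition alg_degree (f : triple) : nat :=
  xget 0%N [set d | RationalMaps.has_alg_degree f d].

Definition top_degree (f : triple) : nat :=
  xget 0%N [set d | RationalMaps.has_top_degree f d].

Definition degree_roots (deg : triple -> nat) (f : triple) : R^nat :=
  fun n => (deg (RationalMaps.iter_map n f))%:R `^ (n%:R^-1).

Definition dynamical_degree (deg : triple -> nat) (f : triple) : R :=
  limn (degree_roots deg f).

End Degrees.

(* R[i], presented as a numClosedFieldType so as to carry its topology. *)
Definition cplx (R : realType) : numClosedFieldType := R[i].

Section Complex.
Variable R : realType.
Local Notation C := (cplx R).

Definition gauss_cplx (mu : int[i]) : C :=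
  (complex.Re mu)%:~R +i* (complex.Im mu)%:~R.

(* theta is determined by z modulo 2 * pi only, which does not affect
   membership in the rational multiples of 2 * pi. *)
Definition is_arg (z : C) (theta : R) :=
  z = `|z| * ((cos theta +i* sin theta) : C).

Definition arg_incommensurable (z : C) :=
  forall theta, is_arg z theta -> forall q : rat, theta <> ratr q * (2 * pi).

(* F is the sum of \sum_n a_n (z - z0)^n in a neighbourhood of z0. *)
Definition has_power_series (F : C -> C) (z0 : C) (a : nat -> C) :=
  \forall z \near z0, [series a n * (z - z0) ^+ n]_n @ \oo --> F z.

Definition analytic_at (F : C -> C) (z0 : C) :=
  exists a, has_power_series F z0 a.

(* A pole of order exactly m; the value of F at a pole is irrelevant. *)
Definition pole_at (F : C -> C) (m : nat) (z0 : C) :=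
  [/\ (0 < m)%N & exists h : C -> C,
     [/\ analytic_at h z0, h z0 != 0 &
         \forall z \near z0^', F z = h z / (z - z0) ^+ m]].

Definition meromorphic_on (D : set C) (F : C -> C) :=
  forall z, D z -> analytic_at F z \/ exists m, pole_at F m z.

Definition disk (r : R) : set C := [set z | `|z| < (r%:C : C)].
Definition circle (r : R) : set C := [set z | `|z| = (r%:C : C)].

Definition natural_boundary (r : R) (F : C -> C) :=
  forall w, circle r w ->
    ~ exists G : C -> C,
        analytic_at G w /\ (\forall z \near w, disk r z -> G z = F z).

End Complex.

(* Main.v *)
From HB Require Import structures.
Require Import Defs.
From mathcomp Require Import all_boot all_order all_algebra.
From mathcomp Require Import fraction complex ring lra zify.
From mathcomp Require Import perm.
From mathcomp Require mpoly boolp.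

Set Implicit Arguments.
Unset Strict Implicit.
Unset Printing Implicit Defensive.

Import Order.TTheory GRing.Theory Num.Theory.
Local Open Scope ring_scope.

(** Write [f] for [f_mu], [g] for the involution and [h] for the monomial map, so
    that [f] is [g] after [h].  Two facts make everything computable.  On the
    lattice of the torus, [h] acts as the multiplication by the conjugate of
    [mu]; as the argument of [mu] is irrational, no power of it sends a ray of
    the fan of the plane to a ray ([orbit_rays_open]).  And each coordinate of
    [g] is the product of a variable by the equation of a line, which [g]
    contracts to a point.

    Algebraic degree.  Up to a common factor, [f^n] is therefore a triple of
    products of explicit forms [curve j l] ([iter_map_orbit]): [curve j l] is
    created at step [j], and its exponents are the coordinates of the ray [l]
    moved by the [n - j] later applications of [h].  Since the moved rays stay
    inside open cones, these forms are pairwise coprime ([curves_coprime]), so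
    that the triple has no common factor and the degree of [f^n] is known
    ([has_alg_degree_iter]).  In terms of the degree [d n] of the [n]-th iterate
    of [h], it says that the series of the degrees of the iterates of [f] is
    F = D / (2 - D), with D the sum of the [d n z^n] ([degree_series]).

    Topological degree.  The pull-back by [g] is an automorphism of the function
    field, and the function field is free over its image under the pull-back by
    [h], with a basis of monomials representing the classes of Z[i] modulo [mu]
    ([monomial_basis]); the tower of the images of the iterates gives the degree
    N^n, for N the norm of [mu] ([has_top_degree_iter]).

    Analysis.  By homogeneity, [d n] is beta^n T(u^n), where beta is the modulus
    of [mu], [u] is a complex number of modulus 1 which is not a root of unity
    and T is a Lipschitz function ([toric_degree], [orbit_toric_degree]), so D
    converges exactly in the disk of radius 1 / beta.  The coefficients of D are
    positive, D reaches the value 2 at one positive real [p] ([D_eq2]), with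
    nonzero derivative; this is the simple pole of F, and the renewal equation
    satisfied by the degrees shows that they grow like p^-n ([renewal_lower]).

    That D takes the value 2 at [p] only is a form of the Hodge index theorem.
    Restricted to the 8M-th roots of unity, T has nonpositive Fourier
    coefficients except for its mean ([hat_toric_degree_sign]).  Two solutions
    would yield a positive definite Pick matrix of size 2, and the sign of the
    coefficients makes a value of the corresponding quadratic form nonpositive
    ([orbit_degrees_inj2]).

    Finally, the Fourier coefficients of T whose index is divisible by 8 do not
    vanish, which makes D unbounded along the radii ending at the points
    u^-8m / beta ([ps_unbounded]).  These points are dense in the circle, and F
    tends to -1 when D tends to infinity: an analytic continuation of F at a
    point of the circle would have to be the constant -1
    ([F_natural_boundary]). *)

(** * Coprimality in an integral domain *)

Section Coprimality.
Variable D : idomainType.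
Implicit Types a b c w : D.

Definition divides a b := exists c, b = a * c.

(** [b] is a nonzerodivisor modulo [a].  In a factorial domain this says that
    [a] and [b] have no common prime factor, and the closure properties below
    hold in every domain. *)
Definition coprime_to a b := forall w, divides a (b * w) -> divides a w.

Lemma divides_mulr a b c : divides a b -> divides a (b * c).
Proof. by move=> [x ->]; exists (x * c); rewrite mulrA. Qed.

Lemma divides_refl a : divides a a.
Proof. by exists 1; rewrite mulr1. Qed.

Lemma dividesD a b c : divides a b -> divides a c -> divides a (b + c).
Proof. by move=> [x ->] [y ->]; exists (x + y); rewrite mulrDr. Qed.

Lemma dividesN a b : divides a b -> divides a (- b).
Proof. by move=> [x ->]; exists (- x); rewrite mulrN. Qed.

Lemma coprime_to_sym a b : a != 0 -> coprime_to a b -> coprime_to b a.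
Proof.
move=> a0 ab w [v awbv].
have [x vE] : divides a v by apply: ab; exists w.
by exists x; apply: (mulfI a0); rewrite awbv vE mulrCA.
Qed.

Lemma coprime_to1 a : coprime_to a 1.
Proof. by move=> w; rewrite mul1r. Qed.

Lemma coprime_toM a b c : coprime_to a b -> coprime_to a c ->
  coprime_to a (b * c).
Proof. by move=> ab ac w; rewrite -mulrA => /ab /ac. Qed.

Lemma coprime_toX a b n : coprime_to a b -> coprime_to a (b ^+ n).
Proof.
move=> ab; elim: n => [|n IH]; first by rewrite expr0; exact: coprime_to1.
by rewrite exprS; exact: coprime_toM.
Qed.

Lemma coprime_to_prod (I : eqType) (s : seq I) (F : I -> D) a :
  (forall i, i \in s -> coprime_to a (F i)) ->
  coprime_to a (\prod_(i <- s) F i).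
Proof.
elim: s => [|i s IH] H; first by rewrite big_nil; exact: coprime_to1.
rewrite big_cons; apply: coprime_toM; first by apply: H; rewrite inE eqxx.
by apply: IH => j js; apply: H; rewrite inE js orbT.
Qed.

Lemma coprime_toDr a b c : coprime_to a b -> divides a c ->
  coprime_to a (b + c).
Proof.
move=> ab ac w; rewrite mulrDl => h; apply: ab.
rewrite -(addrK (c * w) (b * w)); apply: dividesD h _.
exact/dividesN/divides_mulr.
Qed.

Lemma coprime_toN a b : coprime_to a b -> coprime_to a (- b).
Proof.
by move=> ab w; rewrite mulNr => /dividesN; rewrite opprK; exact: ab.
Qed.

Lemma coprime_to_divr a b c : divides c b -> coprime_to a b -> coprime_to a c.
Proof.
move=> [e ->] ab w h; apply: ab.
by rewrite mulrAC; exact: divides_mulr.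
Qed.

Lemma coprime_to_mul_divides a b w : coprime_to a b ->
  divides a w -> divides b w -> divides (a * b) w.
Proof.
move=> ab aw [v wE]; have [x vE] : divides a v by apply: ab; rewrite -wE.
by exists x; rewrite wE vE; ring.
Qed.

Lemma prod_coprime_divides (I : finType) (s : seq I) (F : I -> D) w :
  uniq s ->
  {in s &, forall i j, i != j -> coprime_to (F i) (F j)} ->
  {in s, forall i, divides (F i) w} -> divides (\prod_(i <- s) F i) w.
Proof.
elim: s => [|i s IH] /=; first by exists w; rewrite big_nil mul1r.
move=> /andP[si us] cop dv; rewrite big_cons; apply: coprime_to_mul_divides.
- apply: coprime_to_prod => j js; apply: cop; rewrite ?inE ?eqxx ?js ?orbT //.
  by apply: contraNneq si => ->.
- by apply: dv; rewrite inE eqxx.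
- apply: IH => // [j l js ls|j js]; last by apply: dv; rewrite inE js orbT.
  by apply: cop; rewrite inE ?js ?ls orbT.
Qed.

Lemma coprime_toXl a b n : a != 0 -> b != 0 -> coprime_to a b ->
  coprime_to (a ^+ n) b.
Proof.
move=> a0 b0 ab; apply: coprime_to_sym => //.
exact/coprime_toX/coprime_to_sym.
Qed.

End Coprimality.

(** * Toric vectors *)

(** The lattice Z^3 / Z(1,1,1) of one-parameter subgroups of the torus of the
    plane, in the coordinates [(v_1 - v_0, v_2 - v_0)]. *)
Notation vec := (int * int)%type.

Definition toric_coord (v : vec) (i : 'I_3) : int :=
  match val i with 0%N => 0 | 1%N => v.1 | _ => v.2 end.

Definition vmin (v : vec) : int := Num.min 0 (Num.min v.1 v.2).

(** The representative of [v] in N^3 with a zero entry. *)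
Definition reduced (v : vec) (i : 'I_3) : nat := absz (toric_coord v i - vmin v).

Definition ray (l : 'I_3) : vec :=
  match val l with 0%N => (-1, -1) | 1%N => (1, 0) | _ => (0, 1) end.

(** The support function of the polygon of O(1). *)
Definition psi (v : vec) : nat := reduced v ord0.

Lemma vmin_le v i : vmin v <= toric_coord v i.
Proof. by rewrite /vmin /toric_coord; case: i => [[|[|[|]]]] //= _; lia. Qed.

Lemma reducedE v i : (reduced v i)%:Z = toric_coord v i - vmin v.
Proof. by rewrite /reduced gez0_abs // subr_ge0 vmin_le. Qed.

Lemma reduced_zero v : exists i, reduced v i = 0%N.
Proof.
have [/eqP h|h] := boolP (vmin v == 0).
  by exists ord0; apply/eqP; rewrite -eqz_nat reducedE /toric_coord /= h.
have [/eqP h1|h1] := boolP (vmin v == v.1).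
  exists (inord 1); apply/eqP; rewrite -eqz_nat reducedE /toric_coord /= inordK //.
  by rewrite h1 subrr.
exists (inord 2); apply/eqP; rewrite -eqz_nat reducedE /toric_coord /= inordK //.
by move: h h1; rewrite /vmin; lia.
Qed.

Lemma forall_ord3 (P : 'I_3 -> Prop) :
  P ord0 -> P (inord 1) -> P (inord 2) -> forall i, P i.
Proof.
move=> P0 P1 P2 [[|[|[|//]]] h].
- by rewrite (_ : Ordinal h = ord0) //; apply: val_inj.
- by rewrite (_ : Ordinal h = inord 1) //; apply: val_inj; rewrite /= inordK.
- by rewrite (_ : Ordinal h = inord 2) //; apply: val_inj; rewrite /= inordK.
Qed.

Lemma reduced_ray l i : reduced (ray l) i = (i == l).
Proof.
by elim/forall_ord3: l; elim/forall_ord3: i;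
  rewrite /reduced /ray /toric_coord /vmin /= -?val_eqE /= ?inordK.
Qed.

(** [v] lies in the interior of a cone of the fan of the plane. *)
Definition in_open_cone (v : vec) :=
  exists i0, reduced v i0 = 0%N /\ forall i, i != i0 -> (0 < reduced v i)%N.

(** The entries of [reduced v] exceed the coordinates of [v] by the same amount,
    and the coordinates cancel in the sum. *)
Lemma psi_balanced (I : Type) (s : seq I) (w : I -> int) (v : I -> vec) :
  \sum_(x <- s) w x * (v x).1 = 0 -> \sum_(x <- s) w x * (v x).2 = 0 ->
  forall i, \sum_(x <- s) w x * (reduced (v x) i)%:Z =
            \sum_(x <- s) w x * (psi (v x))%:Z.
Proof.
move=> h1 h2 i.
have E j : \sum_(x <- s) w x * (reduced (v x) j)%:Z =
    - \sum_(x <- s) w x * vmin (v x).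
  under eq_bigr do rewrite reducedE mulrBr.
  rewrite sumrB (_ : \sum_(x <- s) w x * toric_coord (v x) j = 0) ?sub0r //.
  elim/forall_ord3: j; rewrite /toric_coord /= ?inordK //.
  by rewrite big1 // => x _; rewrite mulr0.
by rewrite !E.
Qed.

Module PlaneMaps.
Import mpoly RationalMaps.

(** * Substitution in ternary forms *)

Section Forms.
Variable k : fieldType.
Local Notation P := {mpoly k[3]}.
Local Notation map3 := (3.-tuple {mpoly k[3]}).
Implicit Types (p q w : P) (f g h : map3).

(** Divisibility by a variable can be read off from the monomials. *)
Lemma coprime_toXX (i j : 'I_3) : i != j -> coprime_to ('X_i : P) 'X_j.
Proof.
move=> ij w.
have dvdXP p : divides 'X_i p <-> forall m, p@_m != 0 -> (0 < m i)%N.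
  split=> [[q ->] m|H].
    rewrite mulrC -mcoeff_msupp (perm_mem (msuppMX _ _)).
    by case/mapP=> m' _ ->; rewrite mnmDE mnm1E eqxx.
  rewrite [p]mpolyE big_seq_cond; elim/big_rec: _ => [|m q].
    by exists 0; rewrite mulr0.
  rewrite andbT mcoeff_msupp => /H mi dq; apply: dividesD => //.
  exists (p@_m *: 'X_[m - U_(i)]); rewrite -scalerAr -mpolyXD addmC submK //.
  by apply/mnm_lepP => l; rewrite mnm1E; case: eqP => [<-|].
move=> /dvdXP H; apply/dvdXP => m wm.
have := H (U_(j) + m)%MM; rewrite mulrC mcoeffMX => /(_ wm).
by rewrite mnmDE mnm1E [j == i]eq_sym (negPf ij).
Qed.

Lemma comp_mpoly_tnth i f : 'X_i \mPo f = tnth f i.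
Proof. by rewrite comp_mpolyXU (tnth_nth 0). Qed.

Lemma comp_mpolyA p g h :
  (p \mPo g) \mPo h = p \mPo [tuple tnth g i \mPo h | i < 3].
Proof.
rewrite [p \mPo g]comp_mpolyEX [RHS]comp_mpolyEX (raddf_sum (comp_mpoly h)).
apply: eq_bigr => m _. rewrite [LHS]comp_mpolyZ !comp_mpolyX rmorph_prod.
congr (_ *: _).
by apply: eq_bigr => i _; rewrite rmorphXn tnth_mktuple.
Qed.

Lemma comp_mpoly_scale d p w f : p \is d.-homog ->
  p \mPo [tuple w * tnth f i | i < 3] = w ^+ d * (p \mPo f).
Proof.
move=> /dhomogP hp; rewrite comp_mpolyEX [in RHS]comp_mpolyEX mulr_sumr.
rewrite big_seq [RHS]big_seq; apply: eq_bigr => m /hp /= dm.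
rewrite !comp_mpolyX -scalerAr; congr (_ *: _).
under eq_bigr do rewrite tnth_mktuple exprMn.
by rewrite big_split /= -dm mdegE (big_morph _ (exprD w) (expr0 w)).
Qed.

Lemma dhomog_prodr (I : Type) (s : seq I) (F : I -> P) (d : I -> nat) :
  (forall i, F i \is (d i).-homog) ->
  \prod_(i <- s) F i \is (\sum_(i <- s) d i)%N.-homog.
Proof.
move=> H; elim: s => [|i s IH]; first by rewrite !big_nil dhomog1.
by rewrite !big_cons; exact: dhomogM.
Qed.

Lemma dhomog_comp d e p f : p \is d.-homog ->
  (forall i, tnth f i \is e.-homog) -> p \mPo f \is (e * d)%N.-homog.
Proof.
move=> /dhomogP hp hf; rewrite comp_mpolyEX big_seq.
apply: rpred_sum => m /hp /= dm; rewrite rpredZ // comp_mpolyX.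
rewrite -dm mdegE big_distrr /=; apply: dhomog_prodr => i; exact: dhomogMn.
Qed.

End Forms.

(** * Triples of products of pairwise coprime polynomials *)

Section FactoredTriples.
Variables (k : fieldType) (I : finType).
Local Notation P := {mpoly k[3]}.
Local Notation map3 := (3.-tuple {mpoly k[3]}).
Variables (L : I -> P) (v : I -> vec).

Definition ftriple : map3 := [tuple \prod_x L x ^+ reduced (v x) i | i < 3].

Lemma tnth_ftriple i : tnth ftriple i = \prod_x L x ^+ reduced (v x) i.
Proof. by rewrite tnth_mktuple. Qed.

Hypothesis L_neq0 : forall x, L x != 0.
Hypothesis L_coprime : forall x y, x != y -> coprime_to (L x) (L y).

Lemma ftriple_neq0 i : tnth ftriple i != 0.
Proof.
by rewrite tnth_ftriple; apply/prodf_neq0 => x _; rewrite expf_neq0.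
Qed.

Lemma coprime_to_ftriple x i : reduced (v x) i = 0%N ->
  coprime_to (L x) (tnth ftriple i).
Proof.
move=> xi; rewrite tnth_ftriple; apply: coprime_to_prod => y _.
have [->|xy] := eqVneq y x; first by rewrite xi; exact: coprime_to1.
by apply: coprime_toX; apply: L_coprime; rewrite eq_sym.
Qed.

(** Every factor is absent from some component. *)
Lemma ftriple_no_common_factor : no_common_factor ftriple.
Proof.
move=> p hp; have cop x : coprime_to p (L x).
  have [i /coprime_to_ftriple xi] := reduced_zero (v x).
  have p0 : p != 0.
    apply: contraNneq (ftriple_neq0 i) => p0.
    by have [q ->] := hp i; rewrite p0 mul0r.
  have [q qE] := hp i; apply: coprime_to_sym => //.
  by apply: coprime_to_divr xi; exists q.
have : divides p 1.
  have cop0 : coprime_to p (tnth ftriple ord0).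
    rewrite tnth_ftriple; apply: coprime_to_prod => x _.
    exact/coprime_toX/cop.
  by apply: cop0; rewrite mulr1; exact: hp.
by case=> q qE; apply/unitrP; exists q; rewrite [q * p]mulrC -qE.
Qed.

(** The power of each factor in the first component divides the first component
    of [h], because the factor is absent from some other component. *)
Lemma ftriple_divides (h : map3) : same_map ftriple h ->
  exists w, forall i, tnth h i = w * tnth ftriple i.
Proof.
move=> same; have [w hw] : divides (tnth ftriple ord0) (tnth h ord0).
  rewrite tnth_ftriple -big_enum.
  apply: prod_coprime_divides; rewrite ?enum_uniq //.
    move=> x y _ _ xy; apply: coprime_toXl; rewrite ?expf_neq0 //.
    by apply: coprime_toX; exact: L_coprime.
  move=> x _; have [i xi] := reduced_zero (v x).
  have : coprime_to (L x ^+ reduced (v x) ord0) (tnth ftriple i).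
    apply: coprime_toXl; rewrite ?ftriple_neq0 //.
    exact: coprime_to_ftriple.
  apply; rewrite same; apply: divides_mulr.
  rewrite tnth_ftriple (bigD1 x) //=; exact/divides_mulr/divides_refl.
exists w => i; apply: (mulfI (ftriple_neq0 ord0)).
by rewrite same hw; ring.
Qed.

(** A triple without common factor which represents the same map is a constant
    multiple of [ftriple]. *)
Lemma has_alg_degree_ftriple (f : map3) (w : P) d e :
  w != 0 -> (forall i, tnth f i = w * tnth ftriple i) ->
  (forall i, tnth ftriple i \is d.-homog) ->
  has_alg_degree f e <-> e = d.
Proof.
move=> w0 fE hd; split=> [[h [same ncf he]]|->]; last first.
  exists ftriple; split=> // [i j|]; last exact: ftriple_no_common_factor.
  by rewrite !fE; ring.
have [i j|c hc] := @ftriple_divides h.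
  by apply: (mulfI w0); rewrite !mulrA -!fE same.
have /andP[/eqP cE uc] : c \is a GRing.unit.
  by apply: ncf => i; exists (tnth ftriple i).
have F0 := ftriple_neq0 ord0.
have c0 : c@_0 != 0 by apply: contraTneq uc => ->; rewrite unitr0.
have h0 : tnth h ord0 = c@_0 *: tnth ftriple ord0.
  by rewrite hc -mul_mpolyC -cE.
apply: (@dhomog_uniq _ _ mdeg (tnth h ord0)) => //.
- by rewrite h0 -mul_mpolyC mulf_neq0 // mpolyC_eq0.
- by rewrite h0; apply: dhomogZ; exact: hd.
Qed.

End FactoredTriples.
End PlaneMaps.

(** * Course-of-values recursion *)

Section CourseOfValues.
Variables (T : Type) (x0 : T) (step : nat -> (nat -> T) -> T).

(** The table of the first values of a sequence defined by course-of-values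
    recursion; past its end, it repeats the last value. *)
Fixpoint cov_upto (n : nat) : nat -> T :=
  if n is n'.+1 then
    fun j => if (j <= n')%N then cov_upto n' j else step n' (cov_upto n')
  else fun=> x0.

Definition course_of_values n := cov_upto n n.

Lemma course_of_valuesS :
  (forall n F G, (forall j, (j <= n)%N -> F j = G j) -> step n F = step n G) ->
  forall n, course_of_values n.+1 = step n course_of_values.
Proof.
move=> stepE n; rewrite /course_of_values /= ltnn; apply: stepE => j.
elim: n => [|n IH]; first by rewrite leqn0 => /eqP ->.
rewrite leq_eqVlt => /predU1P[-> //|]; rewrite ltnS => jn /=.
by rewrite jn IH.
Qed.
End CourseOfValues.

Lemma Posz_sum (I : Type) (r : seq I) (F : I -> nat) :
  (\sum_(i <- r) F i)%N%:Z = \sum_(i <- r) (F i)%:Z.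
Proof. exact: (big_morph Posz PoszD). Qed.

(** * The toric action of a monomial map *)

Section MonomialAction.
Variable M : 'M[int]_2.

(** If the coordinates of a point over a discretely valued field have the
    valuations [v], those of its image under the monomial map have the valuations
    [act v]. *)
Definition act (v : vec) : vec :=
  (M 0 0 * v.1 + M 1 0 * v.2, M 0 1 * v.1 + M 1 1 * v.2).

Definition orbit_ray (j : nat) (l : 'I_3) : vec := iter j act (ray l).

Lemma orbit_ray_balanced j :
  \sum_l (orbit_ray j l).1 = 0 /\ \sum_l (orbit_ray j l).2 = 0.
Proof.
elim: j => [|j [IH1 IH2]]; first by rewrite !big_ord_recl !big_ord0.
by split; rewrite /= big_split /= -!mulr_sumr IH1 IH2 !mulr0 addr0.
Qed.

(** The degrees of the forms created at each step: those of step n+1 are pulled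
    back from lines by the monomial map after the n-th iterate. *)
Definition degree_step n (c : nat -> nat) : nat :=
  (\sum_(j < n.+1) \sum_l c j * psi (orbit_ray (n.+1 - j) l))%N.

Definition new_degree := course_of_values 1%N degree_step.

Lemma new_degreeS n : new_degree n.+1 = degree_step n new_degree.
Proof.
apply: course_of_valuesS => {}n F G FG; apply: eq_bigr => j _.
by apply: eq_bigr => l _; rewrite FG // -ltnS.
Qed.

Lemma sum_monomial_exp v j :
  \sum_i toric_coord v i * RationalMaps.monomial_exp M j i = toric_coord (act v) j.
Proof.
pose E := RationalMaps.monomial_exp M.
have E0 i : E ord0 i = 0 by rewrite /E /RationalMaps.monomial_exp unlift_none.
have ES (j' : 'I_2) (i' : 'I_2) : E (lift ord0 j') (lift ord0 i') = M i' j'.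
  by rewrite /E /RationalMaps.monomial_exp !liftK.
rewrite -/E big_ord_recl {1}/toric_coord /= mul0r add0r.
have [j' ->|->] := unliftP ord0 j; last first.
  by rewrite big1 // => i _; rewrite E0 mulr0.
under eq_bigr do rewrite ES.
rewrite !big_ord_recl big_ord0 addr0 /toric_coord /=.
rewrite (_ : lift ord0 _ = 1 :> 'I_2); last exact: val_inj.
rewrite mulrC [v.2 * _]mulrC (_ : ord0 = 0 :> 'I_2) //.
by case: j' => -[|[|//]] h;
  [rewrite (_ : Ordinal h = 0) | rewrite (_ : Ordinal h = 1)] => //;
  exact: val_inj.
Qed.

Lemma sum_monomial_exp0 j : \sum_i RationalMaps.monomial_exp M j i = 0.
Proof.
rewrite /RationalMaps.monomial_exp; case: (unlift ord0 j) => [j'|].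
  rewrite big_ord_recl unlift_none; under [X in _ + X]eq_bigr do rewrite liftK.
  by rewrite addNr.
by rewrite big1.
Qed.

Definition monomial_min i : int :=
  \big[Order.min/0%:Z]_(l < 3) RationalMaps.monomial_exp M l i.

Lemma monomial_min_le j i : monomial_min i <= RationalMaps.monomial_exp M j i.
Proof. by rewrite /monomial_min (bigD1 j) //= ge_min lexx. Qed.

Definition cleared_exp j i : nat :=
  absz (RationalMaps.monomial_exp M j i - monomial_min i).

Lemma cleared_expE j i :
  (cleared_exp j i)%:Z = RationalMaps.monomial_exp M j i - monomial_min i.
Proof. by rewrite /cleared_exp gez0_abs // subr_ge0 monomial_min_le. Qed.

Definition monomial_degree : nat := (\sum_i cleared_exp ord0 i)%N.

Lemma sum_cleared_exp j : (\sum_i cleared_exp j i)%N = monomial_degree.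
Proof.
apply/eqP; rewrite -eqz_nat /monomial_degree !Posz_sum; apply/eqP.
by under eq_bigr do rewrite cleared_expE; under [RHS]eq_bigr do
  rewrite cleared_expE; rewrite !sumrB !sum_monomial_exp0.
Qed.

(** Exponents clearing denominators contribute the same amount in all
    coordinates. *)
Lemma cleared_exp_act v : exists n : nat, forall j,
  (\sum_i reduced v i * cleared_exp j i)%N = (n + reduced (act v) j)%N.
Proof.
pose s := \sum_i (reduced v i)%:Z * monomial_min i.
have E j : (\sum_i reduced v i * cleared_exp j i)%N%:Z =
    (reduced (act v) j)%:Z + (vmin (act v) - s).
  rewrite Posz_sum; under eq_bigr do
    rewrite PoszM cleared_expE mulrBr reducedE mulrBl.
  rewrite !sumrB sum_monomial_exp -mulr_sumr sum_monomial_exp0 reducedE /s.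
  rewrite mulr0 subr0; under [X in _ - X]eq_bigr do rewrite -reducedE.
  by ring.
have [j0 j00] := reduced_zero (act v).
exists (\sum_i reduced v i * cleared_exp j0 i)%N => j.
by apply/eqP; rewrite -eqz_nat PoszD !E j00 add0r addrC.
Qed.

End MonomialAction.

Module IteratedMaps.
Import mpoly RationalMaps PlaneMaps.

(** * The iterates of the composed map *)

Section Iterates.
Variables (k : fieldType) (M : 'M[int]_2).
Local Notation P := {mpoly k[3]}.
Local Notation map3 := (3.-tuple {mpoly k[3]}).
Local Notation g := (involution_g k).
Local Notation h := (monomial_map k M).
Local Notation ray_at := (orbit_ray M).

Definition line_form (l : 'I_3) : P := \sum_i 'X_i - 'X_l *+ 2.

Lemma tnth_involution_g l : tnth g l = 'X_l * line_form l.
Proof.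
have E : \sum_i 'X_i = 'X_0 + 'X_1 + 'X_2 :> P.
  rewrite !big_ord_recr big_ord0 /= add0r.
  by congr ('X_ _ + 'X_ _ + 'X_ _); exact: val_inj.
rewrite /line_form E; elim/forall_ord3: l.
- rewrite /tnth /= (_ : ord0 = 0 :> 'I_3) //; ring.
- rewrite /tnth /= inordK //= (_ : inord 1 = 1 :> 'I_3); last first.
    by apply: val_inj; rewrite /= inordK.
  ring.
- rewrite /tnth /= inordK //= (_ : inord 2 = 2 :> 'I_3); last first.
    by apply: val_inj; rewrite /= inordK.
  ring.
Qed.

Lemma line_form_comp l (f : map3) :
  line_form l \mPo f = \sum_i tnth f i - tnth f l *+ 2.
Proof.
rewrite /line_form comp_mpolyB comp_mpolyMn comp_mpoly_tnth.
rewrite (raddf_sum (comp_mpoly f)).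
by congr (_ - _); apply: eq_bigr => i _; rewrite [LHS]comp_mpoly_tnth.
Qed.

Lemma line_form_homog l : line_form l \is 1.-homog.
Proof.
have X1 i : ('X_i : P) \is 1.-homog by rewrite dhomogX /= mdeg1.
apply: rpredB; first by apply: rpred_sum => i _; exact: X1.
by apply: rpredMn; exact: X1.
Qed.

Lemma involution_g_homog l : tnth g l \is 2.-homog.
Proof.
rewrite tnth_involution_g; apply: (@dhomogM _ _ _ 1%N _ 1%N).
  by rewrite dhomogX /= mdeg1.
exact: line_form_homog.
Qed.

Lemma tnth_monomial_map j : tnth h j = \prod_i 'X_i ^+ cleared_exp M j i.
Proof. by rewrite tnth_mktuple. Qed.

Lemma monomial_map_homog j : tnth h j \is (monomial_degree M).-homog.
Proof.
rewrite tnth_monomial_map -(sum_cleared_exp M j).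
apply: dhomog_prodr => i; rewrite -[X in X.-homog]mul1n.
by apply: dhomogMn; rewrite dhomogX /= mdeg1.
Qed.

Lemma monomial_map_comp j (f : map3) :
  tnth h j \mPo f = \prod_i tnth f i ^+ cleared_exp M j i.
Proof.
rewrite tnth_monomial_map rmorph_prod /=; apply: eq_bigr => i _.
by rewrite rmorphXn /= [X in X ^+ _]comp_mpoly_tnth.
Qed.

(** The common factor comes from [cleared_exp_act]. *)
Lemma monomial_map_ftriple (I : finType) (L : I -> P) (v : I -> vec) :
  (forall x, L x != 0) ->
  exists2 w, w != 0 & forall j, tnth h j \mPo ftriple L v =
    w * tnth (ftriple L (act M \o v)) j.
Proof.
move=> L0; have E x : { n : nat | forall j,
    (\sum_i reduced (v x) i * cleared_exp M j i)%N =
    (n + reduced (act M (v x)) j)%N }.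
  exact/boolp.constructive_indefinite_description/cleared_exp_act.
exists (\prod_x L x ^+ sval (E x)).
  by apply/prodf_neq0 => x _; rewrite expf_neq0.
move=> j; rewrite monomial_map_comp.
under eq_bigr do rewrite tnth_ftriple -prodrXl.
rewrite exchange_big tnth_ftriple -big_split /=; apply: eq_bigr => x _.
rewrite -exprD -(svalP (E x)) (big_morph _ (exprD (L x)) (expr0 _)).
by apply: eq_bigr => i _; rewrite -exprM.
Qed.

Definition curve_step n (L : nat -> 'I_3 -> P) (l : 'I_3) : P :=
  line_form l \mPo ftriple (fun x : 'I_n.+1 * 'I_3 => L x.1 x.2)
                           (fun x => ray_at (n.+1 - x.1) x.2).

(** Equations of the curves that the iterates map into the coordinate lines,
    sorted by the number of steps this takes: [curve n l] is the pull-back by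
    [h \o f^(n-1)] of a line contracted by [g]. *)
Definition curve := course_of_values (fun l => 'X_l : P) curve_step.

(** For [m = n] this is the iterate of order [n] freed from its common factor, and
    for [m = n.+1] its image under the monomial map. *)
Definition orbit_triple n m : map3 :=
  ftriple (fun x : 'I_n.+1 * 'I_3 => curve x.1 x.2)
          (fun x => ray_at (m - x.1) x.2).

Lemma curveS n l : curve n.+1 l = line_form l \mPo orbit_triple n n.+1.
Proof.
have ext m F G : (forall j, (j <= m)%N -> F j = G j) ->
    curve_step m F = curve_step m G.
  move=> FG; rewrite /curve_step.
  have -> // : (fun x : 'I_m.+1 * 'I_3 => F x.1 x.2) = fun x => G x.1 x.2.
  by apply: boolp.funext => x; rewrite (FG x.1) // -ltnS ltn_ord.
exact: (congr1 (fun F => F l) (course_of_valuesS _ ext n)).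
Qed.

Lemma tnth_orbit_triple n m i : tnth (orbit_triple n m) i =
  \prod_(j < n.+1) \prod_l curve j l ^+ reduced (ray_at (m - j) l) i.
Proof. by rewrite tnth_ftriple pair_bigA. Qed.

Lemma prod_reduced_ray (F : 'I_3 -> P) i :
  \prod_l F l ^+ reduced (ray l) i = F i.
Proof.
rewrite (bigD1 i) //= reduced_ray eqxx expr1 big1 ?mulr1 // => l li.
by rewrite reduced_ray eq_sym (negPf li).
Qed.

Lemma orbit_triple0 i : tnth (orbit_triple 0 0) i = 'X_i.
Proof. by rewrite tnth_orbit_triple big_ord1 /= prod_reduced_ray. Qed.

Lemma orbit_tripleS n i : tnth (orbit_triple n.+1 n.+1) i =
  tnth g i \mPo orbit_triple n n.+1.
Proof.
rewrite tnth_orbit_triple big_ord_recr /= subnn /= prod_reduced_ray curveS.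
rewrite tnth_involution_g rmorphM /= [X in _ = X * _]comp_mpoly_tnth.
by rewrite tnth_orbit_triple.
Qed.

Section Coprimality.
Hypothesis two_neq0 : (2%:R : k) != 0.
Hypothesis rays_open : forall j l, in_open_cone (ray_at j.+1 l).

Definition coprime_upto n := forall (x y : 'I_n.+1 * 'I_3), x != y ->
  coprime_to (curve x.1 x.2) (curve y.1 y.2).

Lemma mpolyXi_neq0 i : 'X_i != 0 :> P.
Proof. by rewrite -msupp_eq0 msuppX. Qed.

Lemma mpolyXi_not_unit i : ~ divides ('X_i : P) 1.
Proof.
case=> q /(congr1 (fun p : P => p.@[fun=> 0])) /eqP.
by rewrite meval1 mevalM mevalXU mul0r oner_eq0.
Qed.

Lemma sum_ord3_other (F : 'I_3 -> P) l m : l != m ->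
  exists n, \sum_i F i = F l + F m + F n.
Proof.
have E : \sum_i F i = F ord0 + F (inord 1) + F (inord 2).
  rewrite !big_ord_recr big_ord0 /= add0r.
  by congr (F _ + F _ + F _); apply: val_inj; rewrite /= ?inordK.
rewrite E; elim/forall_ord3: l; elim/forall_ord3: m; rewrite ?eqxx // => _.
- by exists (inord 2); ring.
- by exists (inord 1); ring.
- by exists (inord 2); ring.
- by exists ord0; ring.
- by exists (inord 1); ring.
- by exists ord0; ring.
Qed.

(** Modulo an old curve, exactly two components of [h \o f^n] vanish, so the
    new curves are the third component up to sign. *)
Lemma old_coprime_new n (x : 'I_n.+1 * 'I_3) l : coprime_upto n ->
  coprime_to (curve x.1 x.2) (curve n.+1 l).
Proof.
move=> cop; pose F := orbit_triple n n.+1; rewrite curveS line_form_comp.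
have [i0 [x0 xpos]] : in_open_cone (ray_at (n.+1 - x.1) x.2).
  by rewrite subSn ?rays_open // -ltnS.
have cF : coprime_to (curve x.1 x.2) (tnth F i0).
  exact: (@coprime_to_ftriple _ _ (fun x : 'I_n.+1 * 'I_3 => curve x.1 x.2)
           (fun x => ray_at (n.+1 - x.1) x.2) cop x).
have dF i : i != i0 -> divides (curve x.1 x.2) (tnth F i).
  move=> /xpos xi; rewrite tnth_ftriple (bigD1 x) //=; apply: divides_mulr.
  by rewrite -(prednK xi) exprS; exact/divides_mulr/divides_refl.
rewrite (bigD1 i0) //= -/F; have [->|li] := eqVneq l i0.
  rewrite (_ : _ - _ = - tnth F i0 + \sum_(i < 3 | i != i0) tnth F i); last by ring.
  apply: coprime_toDr; first exact: coprime_toN.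
  by elim/big_rec: _ => [|i y /dF]; [exists 0; rewrite mulr0|exact: dividesD].
rewrite -addrA; apply: coprime_toDr => //; apply: dividesD.
  by elim/big_rec: _ => [|i y /dF]; [exists 0; rewrite mulr0|exact: dividesD].
by apply: dividesN; rewrite mulr2n; apply: dividesD; exact: dF.
Qed.

(** The sum of two new curves is twice the remaining component. *)
Lemma new_coprime_new n l m : coprime_upto n ->
  (forall (x : 'I_n.+1 * 'I_3), curve x.1 x.2 != 0) ->
  l != m -> coprime_to (curve n.+1 l) (curve n.+1 m).
Proof.
move=> cop nz lm; pose F := orbit_triple n n.+1.
have cF i : coprime_to (curve n.+1 l) (tnth F i).
  rewrite tnth_ftriple -big_enum; apply: coprime_to_prod => x _.
  by apply/coprime_toX/coprime_to_sym; [exact: nz|exact: old_coprime_new].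
have [i sumE] := sum_ord3_other (fun i => tnth F i) lm.
have E : curve n.+1 m = 2%:R%:MP * tnth F i + curve n.+1 l * - 1.
  rewrite !curveS !line_form_comp sumE mpolyCMn mpolyC1; ring.
rewrite E; apply: coprime_toDr; last exact/divides_mulr/divides_refl.
apply: coprime_toM => // w [q wE]; exists ((2%:R)^-1%:MP * q).
by rewrite mulrCA -wE mulrA -mpolyCM mulVf // mpolyC1 mul1r.
Qed.

(** A new curve is nonzero, because it is coprime to the variable [curve 0 0], which
    is not a unit. *)
Lemma curves_coprime n : (forall j l, (j <= n)%N -> curve j l != 0) /\
  coprime_upto n.
Proof.
elim: n => [|n [nz cop]].
  split=> [j l|[j l] [j' l']].
    by rewrite leqn0 => /eqP ->; exact: mpolyXi_neq0.
  rewrite !ord1 /= => ne; apply: coprime_toXX.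
  by apply: contraNneq ne => ->.
have nzx (x : 'I_n.+1 * 'I_3) : curve x.1 x.2 != 0 by apply: nz; rewrite -ltnS.
have nz' l : curve n.+1 l != 0.
  apply/negP => /eqP l0; have := @old_coprime_new n (ord0, ord0) l cop 1.
  rewrite l0 mul0r => H; apply: (@mpolyXi_not_unit ord0); apply: H.
  by exists 0; rewrite mulr0.
split=> [j l|[j l] [j' l'] /= ne].
  by rewrite leq_eqVlt => /predU1P[->|] //; rewrite ltnS; exact: nz.
have split_ord (i : 'I_n.+2) : i = n.+1 :> nat \/ exists i' : 'I_n.+1, i = i' :> nat.
  have := ltn_ord i; rewrite ltnS leq_eqVlt => /predU1P[]; first by left.
  by move=> i_n; right; exists (Ordinal i_n).
have [jE|[i jE]] := split_ord j; have [jE'|[i' jE']] := split_ord j';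
  rewrite jE jE'.
- apply: new_coprime_new => //; apply: contraNneq ne => ->.
  by apply/eqP; congr (_, _); apply: val_inj; rewrite /= jE jE'.
- by apply: coprime_to_sym; [exact: (nzx (i', l'))|exact: (@old_coprime_new n (i', l'))].
- exact: (@old_coprime_new n (i, l)).
- apply: (cop (i, l) (i', l')); apply: contraNneq ne => -[ii' ->].
  by apply/eqP; congr (_, _); apply: val_inj; rewrite /= jE jE' ii'.
Qed.

End Coprimality.

Definition orbit_degree n m : nat :=
  (\sum_(j < n.+1) \sum_l new_degree M j * psi (ray_at (m - j) l))%N.

(** The components of a generation have the same degree because its rays sum to
    zero. *)
Lemma orbit_triple_homog_from n m i :
  (forall j l, (j <= n)%N -> curve j l \is (new_degree M j).-homog) ->
  tnth (orbit_triple n m) i \is (orbit_degree n m).-homog.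
Proof.
move=> hom; rewrite tnth_orbit_triple.
have -> : orbit_degree n m = (\sum_(j < n.+1) \sum_l
    new_degree M j * reduced (ray_at (m - j) l) i)%N.
  apply/eqP; rewrite -eqz_nat !Posz_sum; apply/eqP; apply: eq_bigr => j _.
  have [b1 b2] := orbit_ray_balanced M (m - j).
  have E := @psi_balanced _ (index_enum 'I_3) (fun=> (new_degree M j)%:Z)
    (ray_at (m - j)).
  rewrite -!mulr_sumr b1 b2 !mulr0 in E; rewrite !Posz_sum.
  have := E erefl erefl i; rewrite !mulr_sumr => {}E.
  under eq_bigr do rewrite PoszM.
  by rewrite -E; apply: eq_bigr => l _; rewrite PoszM.
have homX j l : (j <= n)%N -> curve j l ^+ reduced (ray_at (m - j) l) i \is
    (new_degree M j * reduced (ray_at (m - j) l) i)%N.-homog.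
  by move=> /hom ?; exact: dhomogMn.
rewrite pair_bigA [X in X.-homog]pair_bigA; apply: dhomog_prodr => -[j l].
by apply: homX; rewrite -ltnS.
Qed.

Lemma curve_homog n l : curve n l \is (new_degree M n).-homog.
Proof.
elim/ltn_ind: n l => -[_|n IH] l; first by rewrite dhomogX /= mdeg1.
rewrite curveS new_degreeS -[X in X.-homog]muln1.
apply: dhomog_comp; first exact: line_form_homog.
by move=> i; apply: orbit_triple_homog_from => j l' jn; exact: IH.
Qed.

Lemma orbit_triple_homog n m i :
  tnth (orbit_triple n m) i \is (orbit_degree n m).-homog.
Proof. by apply: orbit_triple_homog_from => j l _; exact: curve_homog. Qed.

Local Notation f := (comp_map g h).

Lemma tnth_comp_map (g1 h1 : map3) i :
  tnth (comp_map g1 h1) i = tnth g1 i \mPo h1.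
Proof. by rewrite tnth_mktuple. Qed.

Lemma comp_map_scale (w : P) : w != 0 ->
  (forall j l, curve j l != 0) -> forall n,
  exists2 w', w' != 0 & forall i,
    tnth f i \mPo [tuple w * tnth (orbit_triple n n) i | i < 3] =
    w' * tnth (orbit_triple n.+1 n.+1) i.
Proof.
move=> w0 nz n; have [w1 w10 hE] :=
  @monomial_map_ftriple _ (fun x : 'I_n.+1 * 'I_3 => curve x.1 x.2)
    (fun x => ray_at (n - x.1) x.2) (fun x => nz x.1 x.2).
exists ((w ^+ monomial_degree M * w1) ^+ 2); first by rewrite !(expf_neq0, mulf_neq0).
move=> i; rewrite tnth_comp_map comp_mpolyA orbit_tripleS.
rewrite -(comp_mpoly_scale _ _ (involution_g_homog i)); congr (_ \mPo _).
apply: eq_from_tnth => j; rewrite [LHS]tnth_mktuple [RHS]tnth_mktuple.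
rewrite (comp_mpoly_scale _ _ (monomial_map_homog j)) hE mulrA; congr (_ * _).
rewrite !tnth_ftriple; apply: eq_bigr => -[a b] _ /=.
by rewrite subSn // -ltnS.
Qed.

Hypothesis two_neq0 : (2%:R : k) != 0.
Hypothesis rays_open : forall j l, in_open_cone (ray_at j.+1 l).

Lemma curve_neq0 j l : curve j l != 0.
Proof. by have [nz _] := curves_coprime two_neq0 rays_open j; exact: nz. Qed.

Lemma iter_map_orbit n : exists2 w, w != 0 &
  forall i, tnth (iter_map n f) i = w * tnth (orbit_triple n n) i.
Proof.
elim: n => [|n [w w0 IH]].
  exists 1; first exact: oner_neq0.
  by move=> i; rewrite mul1r orbit_triple0 tnth_mktuple.
have [w' w'0 E] := comp_map_scale w0 curve_neq0 n.
exists w' => // i; rewrite -E /iter_map iterS tnth_comp_map.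
by congr (_ \mPo _); apply: eq_from_tnth => j; 
  rewrite -/(iter_map n f) IH [RHS]tnth_mktuple.
Qed.

Lemma has_alg_degree_iter n d :
  has_alg_degree (iter_map n f) d <-> d = orbit_degree n n.
Proof.
have [w w0 E] := iter_map_orbit n.
apply: (@has_alg_degree_ftriple _ _ (fun x : 'I_n.+1 * 'I_3 => curve x.1 x.2)
          (fun x => ray_at (n - x.1) x.2) _ _ _ w _ _ w0 E).
- by move=> x; exact: curve_neq0.
- by have [_] := curves_coprime two_neq0 rays_open n.
- by move=> i; exact: orbit_triple_homog.
Qed.

End Iterates.
End IteratedMaps.

(** * Degrees of extensions of subfields of a field *)

Section SubfieldBases.
Variable K : fieldType.
Implicit Types (E L : K -> Prop).

Definition subring_pred E :=
  [/\ E 0, E 1, forall x y, E x -> E y -> E (x - y) &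
      forall x y, E x -> E y -> E (x * y)].

Definition subfield_pred E := subring_pred E /\ forall x, E x -> E x^-1.

Lemma subring_opp E x : subring_pred E -> E x -> E (- x).
Proof. by case=> E0 _ EB _ Ex; rewrite -sub0r; exact: EB. Qed.

Lemma subring_add E x y : subring_pred E -> E x -> E y -> E (x + y).
Proof.
move=> hE Ex Ey; rewrite -[y]opprK; case: (hE) => _ _ EB _.
by apply: EB => //; exact: subring_opp.
Qed.

Lemma subring_sum E (I : Type) (s : seq I) (P : pred I) (F : I -> K) :
  subring_pred E -> (forall i, P i -> E (F i)) -> E (\sum_(i <- s | P i) F i).
Proof.
move=> hE H; apply: big_ind => //; first by case: hE.
by move=> x y; exact: subring_add.
Qed.

Lemma subring_prod E (I : Type) (s : seq I) (P : pred I) (F : I -> K) :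
  subring_pred E -> (forall i, P i -> E (F i)) -> E (\prod_(i <- s | P i) F i).
Proof. by case=> E0 E1 EB EM H; apply: big_ind. Qed.

Lemma subring_det E n (A : 'M[K]_n) : subring_pred E ->
  (forall i j, E (A i j)) -> E (\det A).
Proof.
move=> hE EA; case: (hE) => _ E1 _ EM; apply: subring_sum => // s _.
apply: (EM); last exact: subring_prod.
by case: (odd_perm s); rewrite ?expr0 ?expr1 //; exact: subring_opp.
Qed.

Lemma subfield_invmx E n (A : 'M[K]_n) : subfield_pred E ->
  (forall i j, E (A i j)) -> forall i j, E (invmx A i j).
Proof.
move=> [hE EV] EA i j; case: (hE) => _ E1 _ EM.
rewrite /invmx; case: ifP => // _; rewrite mxE; apply: (EM).
  by apply: EV; exact: subring_det.
rewrite mxE; apply: (EM); last by apply: subring_det => // l m; rewrite !mxE.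
rewrite -signr_odd; case: (odd _); rewrite ?expr0 ?expr1 //.
exact: subring_opp.
Qed.

(** A form of [has_ext_degree] in which uniqueness is expressed by linear
    independence. *)
Definition is_basis E L (I : finType) (b : I -> K) :=
  [/\ forall i, E (b i),
      forall x, E x -> exists c : I -> K,
        (forall i, L (c i)) /\ x = \sum_i c i * b i &
      forall c : I -> K, (forall i, L (c i)) -> \sum_i c i * b i = 0 ->
        forall i, c i = 0].

Lemma is_basis_unique E L (I : finType) (b : I -> K) : subring_pred L ->
  is_basis E L b -> forall x, E x -> exists! c : {ffun I -> K},
    (forall i, L (c i)) /\ x = \sum_i c i * b i.
Proof.
move=> [_ _ LB _] [_ sp fr] x /sp[c [cL xE]]; exists (finfun c); split.
  by split=> [i|]; rewrite ?ffunE // xE; apply: eq_bigr => i _; rewrite ffunE.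
move=> c' [c'L xE']; apply/ffunP => i; rewrite ffunE; apply/eqP.
rewrite -subr_eq0; apply/eqP; apply: (fr (fun i => c i - c' i)).
  by move=> j; exact: LB.
under eq_bigr do rewrite mulrBl.
by rewrite sumrB -xE -xE' subrr.
Qed.

Lemma unique_is_basis E L (I : finType) (b : I -> K) : subring_pred L ->
  E 0 -> (forall i, E (b i)) ->
  (forall x, E x -> exists! c : {ffun I -> K},
    (forall i, L (c i)) /\ x = \sum_i c i * b i) -> is_basis E L b.
Proof.
move=> [L0 _ _ _] E0 bE H; split=> // [x /H[c [[cL xE] _]]|c cL c0 i].
  by exists c.
have [c' [_ uniq_c]] := H 0 E0.
have z : c' = [ffun=> 0].
  apply: uniq_c; split=> [j|]; first by rewrite ffunE.
  by rewrite big1 // => j _; rewrite ffunE mul0r.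
have /ffunP/(_ i) : c' = finfun c.
  apply: uniq_c; split=> [j|]; first by rewrite ffunE.
  by under eq_bigr do rewrite ffunE.
by rewrite z !ffunE.
Qed.

(** One product of the two transition matrices is the identity, and the rank
    compares their sizes. *)
Lemma is_basis_card_le E L n n' (b : 'I_n -> K) (b' : 'I_n' -> K) :
  subring_pred L -> is_basis E L b -> is_basis E L b' -> (n' <= n)%N.
Proof.
move=> hL [bE sp fr] [bE' sp' fr']; case: (hL) => L0 L1 LB LM.
have /boolp.choice [C hC] : forall j, exists c, (forall i, L (c i)) /\
  b' j = \sum_i c i * b i by move=> j; exact: sp.
have /boolp.choice [C' hC'] : forall i, exists c, (forall j, L (c j)) /\
  b i = \sum_j c j * b' j by move=> j; exact: sp'.
pose A : 'M[K]_(n', n) := \matrix_(j, i) C j i.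
pose A' : 'M[K]_(n, n') := \matrix_(i, j) C' i j.
have AA' : A *m A' = 1%:M.
  apply/matrixP => j l; apply/eqP; rewrite -subr_eq0; apply/eqP.
  apply: (fr' (fun l => (A *m A') j l - (1%:M : 'M_n') j l)) => [m|].
    apply: (LB); last by rewrite mxE; case: eqP.
    rewrite mxE; apply: subring_sum => // i _; rewrite !mxE.
    by apply: LM; [have [] := hC j|have [] := hC' i].
  under eq_bigr do rewrite mulrBl.
  rewrite sumrB [X in _ - X](_ : _ = b' j); last first.
    rewrite (bigD1 j) //= mxE eqxx mul1r big1 ?addr0 // => m mj.
    by rewrite mxE eq_sym (negPf mj) mul0r.
  apply/eqP; rewrite subr_eq0; apply/eqP.
  have [_ ->] := hC j; under eq_bigr do rewrite mxE big_distrl /=.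
  rewrite exchange_big; apply: eq_bigr => i _ /=; have [_ ->] := hC' i.
  by rewrite mulr_sumr; apply: eq_bigr => m _; rewrite !mxE mulrA.
by rewrite -[n'](@mxrank1 K) -AA' (leq_trans (mxrankM_maxl _ _)) // rank_leq_col.
Qed.

Lemma is_basis_reindex E L (I J : finType) (b : I -> K) (e : J -> I) :
  bijective e -> is_basis E L b -> is_basis E L (b \o e).
Proof.
move=> [e' eK e'K] [bE sp fr]; have be : bijective e by exists e'.
split=> [j|x /sp[c [cL ->]]|c cL c0 j]; first exact: bE.
  exists (c \o e); split=> [j|]; first exact: cL.
  by rewrite (reindex e) //; exact: onW_bij.
rewrite -[j]eK; apply: (fr (c \o e')) => [i|]; first exact: cL.
rewrite (reindex e) /=; last exact: onW_bij.
by under eq_bigr do rewrite eK.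
Qed.

Lemma is_basis_tower E F L (I J : finType) (b : I -> K) (b' : J -> K) :
  subring_pred E -> subring_pred F -> (forall x, F x -> E x) ->
  (forall x, L x -> F x) ->
  is_basis E F b -> is_basis F L b' ->
  is_basis E L (fun x : I * J => b' x.2 * b x.1).
Proof.
move=> hE hF FE LF [bE sp fr] [bF sp' fr']; case: hE => _ _ _ EM.
have FM : forall x y, F x -> F y -> F (x * y) by case: hF.
split=> [[i j]|x /sp[c [cF ->]]|c cL c0 [i j]] /=.
- by apply: (EM) => //; exact: FE.
- have /boolp.choice[d hd] : forall i, exists d, (forall j, L (d j)) /\
    c i = \sum_j d j * b' j by move=> i; exact: sp'.
  exists (fun x => d x.1 x.2); split=> [[i j]|]; first by have [] := hd i.
  rewrite -(pair_bigA _ (fun i j => d i j * (b' j * b i))) /=.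
  apply: eq_bigr => i _; have [_ ->] := hd i; rewrite mulr_suml.
  by apply: eq_bigr => j _; rewrite mulrA.
apply: (fr' (fun j => c (i, j))) => //.
apply: (fr (fun i => \sum_j c (i, j) * b' j)) => [{}i|].
  by apply: subring_sum => // m _; apply: FM => //; exact: LF.
move: c0; rewrite (eq_bigr (fun x => c (x.1, x.2) * (b' x.2 * b x.1))).
  2: by case.
rewrite -(pair_bigA _ (fun i j => c (i, j) * (b' j * b i))) /= => c0.
apply: etrans c0; apply: eq_bigr => l _; rewrite mulr_suml.
by apply: eq_bigr => m _; rewrite mulrA.
Qed.

Definition image_pred (s : K -> K) E (y : K) := exists2 x, E x & y = s x.

Lemma subring_image E (s : {rmorphism K -> K}) : subring_pred E ->
  subring_pred (image_pred s E).
Proof.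
case=> E0 E1 EB EM; split.
- by exists 0; rewrite ?rmorph0.
- by exists 1; rewrite ?rmorph1.
- by move=> _ _ [x Ex ->] [y Ey ->]; exists (x - y); [exact: EB|rewrite rmorphB].
- by move=> _ _ [x Ex ->] [y Ey ->]; exists (x * y); [exact: EM|rewrite rmorphM].
Qed.

Lemma is_basis_image E L (s : {rmorphism K -> K}) (I : finType) (b : I -> K) :
  is_basis E L b -> is_basis (image_pred s E) (image_pred s L) (s \o b).
Proof.
move=> [bE sp fr]; split=> [i|_ [x /sp[c [cL ->]] ->]|c cL c0 i].
- by exists (b i).
- exists (s \o c); split=> [i|]; first by exists (c i).
  by rewrite rmorph_sum; apply: eq_bigr => i _; rewrite rmorphM.
have /boolp.choice[d hd] : forall i, exists d, L d /\ c i = s d.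
  by move=> j; have [d] := cL j; exists d.
have [_ ->] := hd i; rewrite (fr d) ?rmorph0 // => [j|].
  by have [] := hd j.
apply: (fmorph_inj s); rewrite rmorph0 rmorph_sum; apply: etrans c0.
by apply: eq_bigr => j _; rewrite rmorphM; have [_ ->] := hd j.
Qed.

(** Iterating an endomorphism [s] of [E] multiplies the degrees of the
    successive extensions E / s(E) / s(s(E)) / ... *)
Lemma is_basis_iter E (s : {rmorphism K -> K}) N (b : 'I_N -> K) n :
  subring_pred E -> (forall x, E x -> E (s x)) ->
  is_basis E (image_pred s E) b ->
  exists c : 'I_(N ^ n) -> K, is_basis E (image_pred (iter n s) E) c.
Proof.
move=> hE sE hb; elim: n => [|n [c hc]].
  exists (fun=> 1); split=> [i|x Ex|c]; first by case: hE.
    exists (fun=> x); split=> [_|]; first by exists x.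
    by rewrite big_ord1 mulr1.
  by move=> _; rewrite big_ord1 mulr1 => c0 i; rewrite ord1.
have hc' := @is_basis_image _ _ s _ _ hc.
have hE' := subring_image s hE.
have := is_basis_tower hE hE' _ _ hb hc'.
have -> : image_pred s (image_pred (iter n s) E) = image_pred (iter n.+1 s) E.
  apply: boolp.funext => y; apply: boolp.propext; split.
    by case=> _ [x Ex ->] ->; exists x.
  by case=> x Ex ->; exists (iter n s x) => //; exists x.
have iE x : E x -> E (iter n s x) by elim: (n) => //= m IH /IH; exact: sE.
case=> [x [y Ey ->]|x [y Ey ->]|]; first exact: sE.
  by exists (iter n s y) => //; exact: iE.
move=> bE sp fr.
have cE : #|{: 'I_N * 'I_(N ^ n)}| = (N ^ n.+1)%N by rewrite card_prod !card_ord expnS.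
exists ((fun x : 'I_N * 'I_(N ^ n) => (s \o c) x.2 * b x.1) \o
        (fun i : 'I_(N ^ n.+1) => enum_val (cast_ord (esym cE) i))).
apply: is_basis_reindex => //.
apply: bij_comp; first exact: enum_val_bij.
by exists (cast_ord cE) => i; rewrite ?cast_ordK ?cast_ordKV.
Qed.

End SubfieldBases.

(** * Extending an injective endomorphism to the field of fractions *)

Section FractionLift.
Variable D : idomainType.
Local Notation K := {fraction D}.
Local Notation "x %:F" := (@tofrac D x).

Lemma fraction_quotient_pair (x : K) :
  exists nd, nd.2 != 0 /\ x = nd.1%:F / nd.2%:F.
Proof.
elim/quotW: x => -[[n d] /= d0]; exists (n, d); split=> //=.
have dF0 : d%:F != 0 by rewrite tofrac_eq0.
apply: (mulIf dF0); rewrite divfK //.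
unlock FracField.tofrac; rewrite -[LHS]FracField.pi_mul; apply/eqmodP.
rewrite /= /FracField.equivf /FracField.mulf /=.
by rewrite !numden_Ratio ?mulr1 ?oner_neq0 //= mulrC.
Qed.

Lemma fraction_quotient (x : K) : exists n d, d != 0 /\ x = n%:F / d%:F.
Proof. by have [[n d] /= h] := fraction_quotient_pair x; exists n, d. Qed.

Variable s : {rmorphism D -> D}.
Hypothesis s_inj : injective s.

Definition fraction_lift (x : K) : K :=
  let nd := boolp.cid (fraction_quotient_pair x) in
  (s (sval nd).1)%:F / (s (sval nd).2)%:F.

Lemma fraction_liftE n d : d != 0 -> 
  fraction_lift (n%:F / d%:F) = (s n)%:F / (s d)%:F.
Proof.
move=> d0; rewrite /fraction_lift.
case: boolp.cid => -[n' d'] /= [d'0 E].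
have sd0 x : x != 0 -> (s x)%:F != 0.
  by move=> x0; rewrite tofrac_eq0 -(rmorph0 s) (inj_eq s_inj).
have F0 x : x != 0 -> x%:F != 0 by rewrite tofrac_eq0.
move/eqP: E; rewrite eqr_div ?F0 // -!tofracM tofrac_eq => /eqP E.
by apply/eqP; rewrite eqr_div ?sd0 // -!tofracM tofrac_eq -!rmorphM -E.
Qed.

Lemma fraction_lift_morphism : { S : {rmorphism K -> K} |
  forall n d, d != 0 -> S (n%:F / d%:F) = (s n)%:F / (s d)%:F }.
Proof.
have F0 x : x != 0 -> x%:F != 0 by rewrite tofrac_eq0.
have sF0 x : x != 0 -> (s x)%:F != 0.
  by move=> x0; rewrite tofrac_eq0 -(rmorph0 s) (inj_eq s_inj).
have zm : zmod_morphism fraction_lift.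
  move=> x y; have [n [d [d0 ->]]] := fraction_quotient x.
  have [n' [d' [d'0 ->]]] := fraction_quotient y.
  rewrite -mulNr addf_div ?F0 // -!(tofracM, tofracN, tofracD).
  rewrite !fraction_liftE ?mulf_neq0 // -mulNr addf_div ?sF0 //.
  by rewrite -!(tofracM, tofracN, tofracD) !(rmorphM, rmorphD, rmorphN).
have mm : monoid_morphism fraction_lift.
  split=> [|x y].
    rewrite -[in LHS](divr1 1) -tofrac1 fraction_liftE ?oner_neq0 //.
    by rewrite rmorph1 tofrac1 divr1.
  have [n [d [d0 ->]]] := fraction_quotient x.
  have [n' [d' [d'0 ->]]] := fraction_quotient y.
  rewrite mulf_div -!tofracM !fraction_liftE ?mulf_neq0 //.
  by rewrite !rmorphM mulf_div -!tofracM.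
pose m1 := GRing.isZmodMorphism.Build K K fraction_lift zm.
pose m2 := GRing.isMonoidMorphism.Build K K fraction_lift mm.
pose S : {rmorphism K -> K} := HB.pack fraction_lift m1 m2.
by exists S => n d; exact: fraction_liftE.
Qed.

End FractionLift.

Lemma quotient3 (F : fieldType) (a b c u v : F) : a != 0 ->
  a * (u * v) / (a * (b * c)) = u / b * (v / c).
Proof. by move=> a0; rewrite -mulf_div divff // mul1r mulf_div. Qed.

Module FunctionField.
Import mpoly RationalMaps PlaneMaps IteratedMaps.

(** * The function field of the plane and its monomials *)

Section Monomials.
Variable k : fieldType.
Local Notation P := {mpoly k[3]}.
Local Notation map3 := (3.-tuple {mpoly k[3]}).
Local Notation K := {fraction {mpoly k[3]}}.
Local Notation "p %:F" := (@tofrac {mpoly k[3]} p).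
Local Notation E := (@function_field k).
Local Notation o1 := (lift ord0 (0 : 'I_2) : 'I_3).
Local Notation o2 := (lift ord0 (1 : 'I_2) : 'I_3).

Lemma big_ord2 (T : Type) (idx : T) (op : Monoid.law idx) (F : 'I_2 -> T) :
  \big[op/idx]_(i < 2) F i = op (F 0) (F 1).
Proof.
rewrite !big_ord_recl big_ord0 Monoid.mulm1.
by congr (op (F _) (F _)); exact: val_inj.
Qed.

Lemma big_ord3 (T : Type) (idx : T) (op : Monoid.law idx) (F : 'I_3 -> T) :
  \big[op/idx]_(i < 3) F i = op (F ord0) (op (F o1) (F o2)).
Proof. by rewrite big_ord_recl big_ord2. Qed.

(** The characters of the torus, as rational functions of the plane. *)
Definition torus_monomial (v : vec) : K :=
  (('X_o1)%:F / ('X_ord0)%:F) ^ v.1 * (('X_o2)%:F / ('X_ord0)%:F) ^ v.2.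

Lemma tofracX_neq0 i : ('X_i)%:F != 0 :> K.
Proof. by rewrite tofrac_eq0 mpolyXi_neq0. Qed.

Lemma ratio_neq0 i : ('X_i)%:F / ('X_ord0)%:F != 0 :> K.
Proof. by rewrite mulf_neq0 ?invr_eq0 ?tofracX_neq0. Qed.

Lemma torus_monomialD v w : torus_monomial (v.1 + w.1, v.2 + w.2) =
  torus_monomial v * torus_monomial w.
Proof. by rewrite /torus_monomial !expfzDr ?ratio_neq0 //= mulrACA. Qed.

Lemma function_field_subfield : subfield_pred E.
Proof.
have F0 (x : P) : x != 0 -> x%:F != 0 by rewrite tofrac_eq0.
split; first split.
- exists 0%N, 0, 1; split; rewrite ?dhomog0 ?dhomog1 ?oner_neq0 //.
  by rewrite tofrac0 mul0r.
- exists 0%N, 1, 1; split; rewrite ?dhomog1 ?oner_neq0 //.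
  by rewrite tofrac1 divr1.
- move=> _ _ [d [p [q [hp hq q0 ->]]]] [e [p' [q' [hp' hq' q'0 ->]]]].
  exists (d + e)%N, (p * q' - p' * q), (q * q'); split.
  + apply: rpredB; first exact: dhomogM.
    by rewrite addnC; exact: dhomogM.
  + exact: dhomogM.
  + by rewrite mulf_neq0.
  by rewrite -mulNr addf_div ?F0 // tofracB !tofracM mulNr.
- move=> _ _ [d [p [q [hp hq q0 ->]]]] [e [p' [q' [hp' hq' q'0 ->]]]].
  exists (d + e)%N, (p * p'), (q * q'); split; rewrite ?mulf_neq0 //;
    try exact: dhomogM.
  by rewrite mulf_div !tofracM.
move=> _ [d [p [q [hp hq q0 ->]]]]; have [->|p0] := eqVneq p 0.
  rewrite tofrac0 mul0r invr0; exists 0%N, 0, 1.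
  by split; rewrite ?dhomog0 ?dhomog1 ?oner_neq0 // tofrac0 mul0r.
by exists d, q, p; split=> //; rewrite invf_div.
Qed.

Lemma function_field_const (c : k) : E (c%:MP)%:F.
Proof.
exists 0%N, c%:MP, 1; split; rewrite ?dhomog1 ?oner_neq0 ?tofrac1 ?divr1 //.
by rewrite -[c]mulr1 mpolyCM mpolyC1 mul_mpolyC dhomogZ // dhomog1.
Qed.

Lemma function_field_torus v : E (torus_monomial v).
Proof.
have [[E0 E1 EB EM] EV] := function_field_subfield.
have Er i : E (('X_i)%:F / ('X_ord0)%:F).
  by exists 1%N, 'X_i, 'X_ord0; split; rewrite ?mpolyXi_neq0 // dhomogX /= mdeg1.
have Ez x (n : int) : E x -> E (x ^ n).
  move=> Ex; have En m : E (x ^+ m).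
    by elim: m => [|m IH]; rewrite ?expr0 // exprS; exact: EM.
  by case: n => m; [exact: En|apply: (EV); exact: En].
by apply: (EM); apply: Ez.
Qed.

Lemma dehomogenizeX d (m : 'X_{1..3}) : mdeg m = d ->
  ('X_[m])%:F / ('X_ord0)%:F ^+ d = torus_monomial ((m o1)%:Z, (m o2)%:Z).
Proof.
move=> <-; rewrite mpolyXE_id big_ord3 mdegE big_ord3 /= !tofracM !tofracXn.
rewrite /torus_monomial -!exprnP !expr_div_n !exprD.
by rewrite quotient3 // expf_neq0 ?tofracX_neq0.
Qed.

(** A form becomes a combination of characters when divided by a power of the
    first variable. *)
Lemma dehomogenize d (p : P) : p \is d.-homog ->
  p%:F / ('X_ord0)%:F ^+ d = \sum_(m <- msupp p)
    ((p@_m)%:MP)%:F * torus_monomial ((m o1)%:Z, (m o2)%:Z).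
Proof.
move=> /dhomogP hp; rewrite {1}[p]mpolyE rmorph_sum mulr_suml big_seq [RHS]big_seq.
apply: eq_bigr => m /hp /= dm.
by rewrite -mul_mpolyC tofracM -mulrA dehomogenizeX.
Qed.

End Monomials.
End FunctionField.

(** The action of a monomial map on the characters of the torus. *)
Definition char_act (M : 'M[int]_2) (w : vec) : vec :=
  (M 0 0 * w.1 + M 0 1 * w.2, M 1 0 * w.1 + M 1 1 * w.2).

(** [rep] lists, with nonnegative coordinates, the classes of Z^2 modulo the
    image of [char_act M], and [char_act M] is injective. *)
Definition char_reps (M : 'M[int]_2) N (rep : 'I_N -> nat * nat) :=
  (forall v : vec, exists i w, v = ((char_act M w).1 + (rep i).1%:Z,
                                    (char_act M w).2 + (rep i).2%:Z)) /\
  (forall i i' w w',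
    (char_act M w).1 + (rep i).1%:Z = (char_act M w').1 + (rep i').1%:Z ->
    (char_act M w).2 + (rep i).2%:Z = (char_act M w').2 + (rep i').2%:Z ->
    i = i' /\ w = w').

Lemma exprz_act (F : fieldType) (x y : F) (a b c d v w : int) :
  x != 0 -> y != 0 ->
  (x ^ a * y ^ b) ^ v * (x ^ c * y ^ d) ^ w =
  x ^ (a * v + c * w) * y ^ (b * v + d * w).
Proof.
by move=> x0 y0; rewrite !expfzMl !exprz_exp mulrACA -!expfzDr.
Qed.

Module TopologicalDegree.
Import mpoly RationalMaps PlaneMaps IteratedMaps FunctionField.

(** * The degree of a monomial map *)

Section MonomialDegree.
Variables (k : fieldType) (M : 'M[int]_2) (N : nat) (rep : 'I_N -> nat * nat).
Hypothesis reps : char_reps M rep.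
Local Notation P := {mpoly k[3]}.
Local Notation map3 := (3.-tuple {mpoly k[3]}).
Local Notation K := {fraction {mpoly k[3]}}.
Local Notation "p %:F" := (@tofrac {mpoly k[3]} p).
Local Notation E := (@function_field k).
Local Notation o1 := (lift ord0 (0 : 'I_2) : 'I_3).
Local Notation o2 := (lift ord0 (1 : 'I_2) : 'I_3).
Local Notation h := (monomial_map k M).

Definition exp_map (m : 'X_{1..3}) : 'X_{1..3} :=
  [multinom (\sum_j m j * cleared_exp M j i)%N | i < 3].

Lemma comp_monomial_mapX m : 'X_[m] \mPo h = 'X_[exp_map m] :> P.
Proof.
rewrite comp_mpolyX [RHS]mpolyXE_id.
under eq_bigr do rewrite tnth_monomial_map -prodrXl.
rewrite exchange_big /=; apply: eq_bigr => i _.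
rewrite mnmE (big_morph _ (exprD _) (expr0 _)).
by apply: eq_bigr => j _; rewrite -exprM mulnC.
Qed.

Definition rep_bound : nat := (\sum_i ((rep i).1 + (rep i).2))%N.

(** The homogeneous form of degree [rep_bound] of the representative. *)
Definition rep_monomial (i : 'I_N) : 'X_{1..3} :=
  [multinom (match val j with
             | 0 => rep_bound - ((rep i).1 + (rep i).2)
             | 1 => (rep i).1 | _ => (rep i).2 end)%N | j < 3].

Lemma mdeg_rep_monomial i : mdeg (rep_monomial i) = rep_bound.
Proof.
rewrite mdegE big_ord3 /= !mnmE /= subnK //.
by rewrite /rep_bound (bigD1 i) //= leq_addr.
Qed.

Lemma mdeg_exp_map m : mdeg (exp_map m) = (monomial_degree M * mdeg m)%N.
Proof.
rewrite mdegE; under eq_bigr do rewrite mnmE.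
rewrite exchange_big mdegE big_distrr /=; apply: eq_bigr => j _.
by rewrite -big_distrr /= sum_cleared_exp mulnC.
Qed.

Lemma exp_map_char (m : 'X_{1..3}) (a : 'I_2) :
  \sum_j (m j)%:Z * monomial_exp M j (lift ord0 a) =
  M a 0 * (m o1)%:Z + M a 1 * (m o2)%:Z.
Proof.
rewrite big_ord3 /= /monomial_exp unlift_none !liftK.
by rewrite mulr0 add0r; congr (_ + _); rewrite mulrC.
Qed.

Lemma exp_map_lift (m : 'X_{1..3}) (a : 'I_2) :
  (exp_map m (lift ord0 a))%:Z = M a 0 * (m o1)%:Z + M a 1 * (m o2)%:Z
    - (mdeg m)%:Z * monomial_min M (lift ord0 a).
Proof.
rewrite mnmE Posz_sum -exp_map_char mdegE Posz_sum mulr_suml -sumrB.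
by apply: eq_bigr => j _; rewrite PoszM cleared_expE mulrBr.
Qed.

Lemma monomial_degree_gt0 : (0 < monomial_degree M)%N.
Proof.
rewrite lt0n; apply/eqP => d0.
have ce0 j i : monomial_exp M j i = monomial_exp M ord0 i.
  have z j' : cleared_exp M j' i = 0%N.
    apply/eqP; have /eqP := sum_cleared_exp M j'.
    by rewrite d0 sum_nat_eq0 => /forallP/(_ i).
  by apply/eqP; rewrite -subr_eq0 -(subrK (monomial_min M i) (monomial_exp M j i))
    -addrA -[monomial_min _ _ - _]opprB -!cleared_expE !z.
have M0 a b : M a b = 0.
  by have := ce0 (lift ord0 b) (lift ord0 a);
    rewrite /monomial_exp !liftK unlift_none.
have [i [w _]] := reps.1 (0, 0).
have [] := reps.2 i i (0, 0) (1, 0).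
- by rewrite /char_act /= !M0 !mul0r.
- by rewrite /char_act /= !M0 !mul0r.
by move=> _ [].
Qed.

(** Distinct representatives stay apart modulo the image of the matrix. *)
Lemma exp_map_rep_inj m m' i i' :
  (exp_map m + rep_monomial i = exp_map m' + rep_monomial i')%MM ->
  m = m' /\ i = i'.
Proof.
move=> e; have dm : mdeg m = mdeg m'.
  have := congr1 mdeg e; rewrite !mdegD !mdeg_rep_monomial !mdeg_exp_map.
  move/addIn/eqP; rewrite eqn_mul2l; have := monomial_degree_gt0.
  by case: (monomial_degree M) => //= d _ /eqP.
have comp (a : 'I_2) : M a 0 * (m o1)%:Z + M a 1 * (m o2)%:Z +
       (rep_monomial i (lift ord0 a))%:Z =
     M a 0 * (m' o1)%:Z + M a 1 * (m' o2)%:Z +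
       (rep_monomial i' (lift ord0 a))%:Z.
  have := congr1 (fun x : 'X_{1..3} => (x (lift ord0 a))%:Z) e.
  rewrite /= !mnmDE !PoszD !exp_map_lift dm => H.
  by apply: (addIr (- ((mdeg m')%:Z * monomial_min M (lift ord0 a)))); rewrite addrAC H addrAC.
have := comp 0; have := comp 1; rewrite !mnmE /= => c1 c0.
have [-> ww] := reps.2 i i' ((m o1)%:Z, (m o2)%:Z) ((m' o1)%:Z, (m' o2)%:Z) c0 c1.
case: ww => w1 w2; split=> //.
apply/mnmP => j; move: dm; rewrite !mdegE !big_ord3 /= w1 w2 => /addIn m0.
by case: (unliftP ord0 j) => [j' ->|->] //; case: j' => -[|[|//]] hj;
  [rewrite (_ : lift _ _ = o1) // | rewrite (_ : lift _ _ = o2) //]; exact: val_inj.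
Qed.

(** The terms have no monomial in common, by [exp_map_rep_inj]. *)
Lemma comp_monomial_map_free (c : 'I_N -> P) :
  \sum_i (c i \mPo h) * 'X_[rep_monomial i] = 0 -> forall i, c i = 0.
Proof.
move=> c0 i; apply/mpolyP => m; rewrite mcoeff0.
have := congr1 (mcoeff (exp_map m + rep_monomial i)%MM) c0; rewrite mcoeff0.
rewrite raddf_sum /= => <-.
have co j : ((c j \mPo h) * 'X_[rep_monomial j])@_(exp_map m + rep_monomial i) =
    \sum_(m' <- msupp (c j)) (c j)@_m' *
      (exp_map m' + rep_monomial j == exp_map m + rep_monomial i)%MM%:R.
  rewrite comp_mpolyEX mulr_suml raddf_sum /=; apply: eq_bigr => m' _.
  by rewrite comp_monomial_mapX -scalerAl -mpolyXD mcoeffZ mcoeffX.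
under eq_bigr do rewrite co.
rewrite (bigD1 i) //= [X in _ + X]big1 => [|j ji]; last first.
  apply: big1 => m' _; case: eqP => [/exp_map_rep_inj[_ ij]|]; rewrite ?mulr0 //.
  by rewrite ij eqxx in ji.
rewrite addr0; have [mi|mi] := boolP (m \in msupp (c i)); last first.
  rewrite (memN_msupp_eq0 mi) big_seq big1 // => m' m'i.
  case: eqP => [/exp_map_rep_inj[mm' _]|_]; last by rewrite mulr0.
  by rewrite -mm' m'i in mi.
rewrite (bigD1_seq m) ?msupp_uniq //= eqxx mulr1 big1 ?addr0 // => m' m'm.
case: eqP => [/exp_map_rep_inj[mm' _]|]; rewrite ?mulr0 //.
by rewrite mm' eqxx in m'm.
Qed.

Lemma char_reps_index : exists i : 'I_N, True.
Proof. by have [i _] := reps.1 (0, 0); exists i. Qed.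

Lemma comp_monomial_map_inj : injective (comp_mpoly h : P -> P).
Proof.
have [i0 _] := char_reps_index.
move=> p q pq; apply/eqP; rewrite -subr_eq0; apply/eqP.
pose c i := if i == i0 then p - q else 0.
have := @comp_monomial_map_free c _ i0; rewrite /c eqxx; apply.
rewrite (bigD1 i0) //= eqxx comp_mpolyB pq subrr mul0r add0r.
by apply: big1 => i /negPf ->; rewrite comp_mpoly0 mul0r.
Qed.

Definition monomial_pullback : {rmorphism K -> K} :=
  sval (fraction_lift_morphism comp_monomial_map_inj).
Local Notation s := monomial_pullback.

Lemma monomial_pullbackE p q : q != 0 ->
  s (p%:F / q%:F) = (p \mPo h)%:F / (q \mPo h)%:F.
Proof. exact: (svalP (fraction_lift_morphism comp_monomial_map_inj)). Qed.

Lemma comp_monomial_map_neq0 q : q != 0 -> q \mPo h != 0.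
Proof.
by move=> q0; rewrite -(comp_mpoly0 h) (inj_eq comp_monomial_map_inj).
Qed.

Lemma monomial_pullback_E u : E u -> E (s u).
Proof.
move=> [d [p [q [hp hq q0 ->]]]]; rewrite monomial_pullbackE //.
exists (monomial_degree M * d)%N, (p \mPo h), (q \mPo h).
by split=> //; [apply: dhomog_comp|apply: dhomog_comp|exact: comp_monomial_map_neq0];
  move=> // i; exact: monomial_map_homog.
Qed.

Lemma monomial_pullback_const c : s (c%:MP)%:F = (c%:MP)%:F.
Proof.
rewrite -[in LHS](divr1 (c%:MP)%:F) -tofrac1 monomial_pullbackE ?oner_neq0 //.
by rewrite comp_mpolyC comp_mpoly1 tofrac1 divr1.
Qed.

Lemma monomial_pullback_torus v :
  s (torus_monomial k v) = torus_monomial k (char_act M v).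
Proof.
have gen (a : 'I_2) : s (('X_(lift ord0 a))%:F / ('X_ord0)%:F) =
    torus_monomial k (M 0 a, M 1 a).
  rewrite monomial_pullbackE ?mpolyXi_neq0 // !comp_mpoly_tnth monomial_mapE.
  by rewrite big_ord2.
rewrite /torus_monomial rmorphM !fmorphXz !gen /torus_monomial /=.
by rewrite exprz_act ?ratio_neq0.
Qed.

Local Notation span u := (exists c : 'I_N -> K, (forall i, E (c i)) /\
  u = \sum_i s (c i) * torus_monomial k ((rep i).1%:Z, (rep i).2%:Z)).

Lemma span_torus v : span (torus_monomial k v).
Proof.
have [[E0 E1 EB EM] EV] := function_field_subfield k.
have [i [w ->]] := reps.1 v.
exists (fun j => if j == i then torus_monomial k w else 0); split=> [j|].
  by case: eqP => _ //; exact: function_field_torus.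
rewrite (bigD1 i) //= eqxx big1 ?addr0 => [|j /negPf ->].
  by rewrite monomial_pullback_torus -torus_monomialD.
by rewrite rmorph0 mul0r.
Qed.

Lemma span_sum (I : Type) (r : seq I) (a : I -> k) (u : I -> K) :
  (forall i, span (u i)) -> span (\sum_(i <- r) ((a i)%:MP)%:F * u i).
Proof.
have [[E0 E1 EB EM] EV] := function_field_subfield k.
move=> hu; elim: r => [|i r [c [cE IH]]].
  exists (fun=> 0); split=> //; rewrite big_nil big1 // => i _.
  by rewrite rmorph0 mul0r.
have [d [dE uE]] := hu i; exists (fun j => ((a i)%:MP)%:F * d j + c j); split=> [j|].
  apply: subring_add => //; apply: (EM) => //; exact: function_field_const.
rewrite big_cons IH uE mulr_sumr -big_split /=; apply: eq_bigr => j _.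
by rewrite rmorphD rmorphM /= monomial_pullback_const mulrDl mulrA.
Qed.

Lemma torus_rep i : ('X_[rep_monomial i])%:F / ('X_ord0)%:F ^+ rep_bound =
  torus_monomial k ((rep i).1%:Z, (rep i).2%:Z).
Proof. by rewrite (dehomogenizeX _ (mdeg_rep_monomial i)) !mnmE. Qed.

(** Clearing denominators reduces this to [comp_monomial_map_free]. *)
Lemma torus_reps_free (c : 'I_N -> K) :
  \sum_i s (c i) * torus_monomial k ((rep i).1%:Z, (rep i).2%:Z) = 0 ->
  forall i, c i = 0.
Proof.
have /boolp.choice[nd hnd] : forall i, exists nd : P * P,
    nd.2 != 0 /\ c i = nd.1%:F / nd.2%:F.
  by move=> i; have [n [d h]] := fraction_quotient (c i); exists (n, d).
pose q := \prod_i (nd i).2.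
have q0 : q != 0 by apply/prodf_neq0 => i _; have [] := hnd i.
pose p i := (nd i).1 * \prod_(j | j != i) (nd j).2.
have F0 (x : P) : x != 0 -> x%:F != 0 by rewrite tofrac_eq0.
have cE i : c i = (p i)%:F / q%:F.
  have [d0 ->] := hnd i; apply/eqP; rewrite eqr_div ?F0 // -!tofracM tofrac_eq.
  by rewrite /p /q (bigD1 i) //= -mulrA [X in _ * X]mulrC.
move=> H i; suff p0 : p i = 0 by rewrite cE p0 tofrac0 mul0r.
have X0 : ('X_ord0)%:F ^+ rep_bound != 0 :> K by rewrite expf_neq0 ?tofracX_neq0.
have qh0 := F0 _ (comp_monomial_map_neq0 q0).
move: i; apply: comp_monomial_map_free; apply/eqP; rewrite -tofrac_eq0.
have /eqP : (\sum_i (p i \mPo h) * 'X_[rep_monomial i])%:F /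
    ('X_ord0)%:F ^+ rep_bound / (q \mPo h)%:F = 0.
  rewrite rmorph_sum !mulr_suml; apply: etrans H; apply: eq_bigr => j _.
  rewrite cE monomial_pullbackE // -torus_rep rmorphM -!mulrA; congr (_ * _).
  by rewrite [RHS]mulrC -mulrA.
by rewrite !mulf_eq0 !invr_eq0 (negPf X0) (negPf qh0) !orbF.
Qed.

(** A quotient of two forms is a quotient of two combinations of characters.
    Division is possible because the multiplication by a nonzero combination Q is
    injective on the span of the representatives, hence given by an invertible
    matrix over the image field. *)
Lemma monomial_basis : is_basis E (image_pred s E)
  (fun i => torus_monomial k ((rep i).1%:Z, (rep i).2%:Z)).
Proof.
have subE := function_field_subfield k; have [[E0 E1 EB EM] EV] := subE.
split=> [i|u [d [p [q [hp hq q0 ->]]]]|c cE c0 i]; first exact: function_field_torus.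
  pose X0d := (('X_ord0)%:F ^+ d : K).
  have X0 : X0d != 0 by rewrite expf_neq0 ?tofracX_neq0.
  have -> : p%:F / q%:F = (p%:F / X0d) / (q%:F / X0d).
    by rewrite invf_div mulrA divfK.
  have sp : span (p%:F / X0d).
    by rewrite (dehomogenize hp); apply: span_sum => m; exact: span_torus.
  have /boolp.choice[A hA] : forall i,
      span (q%:F / X0d * torus_monomial k ((rep i).1%:Z, (rep i).2%:Z)).
    move=> i; rewrite (dehomogenize hq) mulr_suml.
    under eq_bigr do rewrite -mulrA -torus_monomialD.
    by apply: span_sum => m; exact: span_torus.
  have Q0 : q%:F / X0d != 0 by apply: mulf_neq0; [rewrite tofrac_eq0 | exact: invr_neq0 X0].
  move: (q%:F / X0d) (p%:F / X0d) Q0 sp hA => Q U Q0 [c [cE ->]] hA.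
  pose B : 'M[K]_N := \matrix_(i, j) A i j.
  have mulQ (v : 'rV[K]_N) :
      Q * \sum_i s (v 0 i) * torus_monomial k ((rep i).1%:Z, (rep i).2%:Z) =
      \sum_j s ((v *m B) 0 j) * torus_monomial k ((rep j).1%:Z, (rep j).2%:Z).
    under [RHS]eq_bigr do rewrite mxE rmorph_sum mulr_suml.
    rewrite exchange_big mulr_sumr; apply: eq_bigr => i _.
    rewrite mulrCA; have [_ ->] := hA i; rewrite mulr_sumr.
    by apply: eq_bigr => j _; rewrite mxE rmorphM mulrA.
  have Bu : B \in unitmx.
    rewrite -row_free_unit -kermx_eq0; apply/rowV0P => v /sub_kermxP vB.
    have := mulQ v; rewrite vB [RHS]big1 => [/eqP|i _]; last by rewrite mxE rmorph0 mul0r.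
    rewrite mulf_eq0 (negPf Q0) => /eqP /torus_reps_free v0.
    by apply/rowP => i; rewrite mxE; exact: v0.
  pose w := (\row_i c i) *m invmx B.
  exists (fun i => s (w 0 i)); split=> [i|].
    exists (w 0 i) => //; rewrite mxE; apply: subring_sum => // j _.
    rewrite !mxE; apply: (EM) => //; apply: subfield_invmx => // l m.
    by rewrite mxE; have [] := hA l.
  apply: (mulfI Q0); rewrite mulQ (mulmxKV Bu) [LHS]mulrC (divfK Q0).
  by apply: eq_bigr => i _; rewrite mxE.
have /boolp.choice[d hd] : forall i, exists d, c i = s d.
  by move=> j; have [d _ ->] := cE j; exists d.
rewrite hd (torus_reps_free (c := d)) ?rmorph0 //.
by rewrite -[RHS]c0; apply: eq_bigr => j _; rewrite hd.
Qed.

End MonomialDegree.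
End TopologicalDegree.

Lemma involution_square_identity (R : comNzRingType) (x y z : R) :
  let a := y + z - x in let b := z + x - y in let c := x + y - z in
  let S := x * a + (y * b + z * c) in
  [/\ x * a * (S - (x * a) *+ 2) = a * (b * c) * x,
      y * b * (S - (y * b) *+ 2) = a * (b * c) * y &
      z * c * (S - (z * c) *+ 2) = a * (b * c) * z].
Proof. by split; ring. Qed.

Lemma line_identity (R : comNzRingType) (x y z : R) :
  [/\ x + (y + z) - x *+ 2 = y + z - x, x + (y + z) - y *+ 2 = z + x - y &
      x + (y + z) - z *+ 2 = x + y - z].
Proof. by split; ring. Qed.

Module IteratedDegree.
Import mpoly RationalMaps PlaneMaps IteratedMaps FunctionField TopologicalDegree.

(** * The topological degree of the iterates *)

Section Involution.
Variable k : fieldType.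
Local Notation P := {mpoly k[3]}.
Local Notation K := {fraction {mpoly k[3]}}.
Local Notation "p %:F" := (@tofrac {mpoly k[3]} p).
Local Notation E := (@function_field k).
Local Notation o1 := (lift ord0 (0 : 'I_2) : 'I_3).
Local Notation o2 := (lift ord0 (1 : 'I_2) : 'I_3).
Local Notation g := (involution_g k).
Local Notation line := (line_form k).

Lemma line_formE : [/\ line ord0 = 'X_o1 + 'X_o2 - 'X_ord0,
  line o1 = 'X_o2 + 'X_ord0 - 'X_o1 & line o2 = 'X_ord0 + 'X_o1 - 'X_o2].
Proof.
rewrite /line_form !big_ord3 /=.
by have [] := line_identity ('X_ord0 : P) 'X_o1 'X_o2.
Qed.

Definition line_product : P := line ord0 * (line o1 * line o2).

(** The composition of [g] with itself is the identity up to the product of the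
    contracted lines. *)
Lemma tnth_g_comp i : tnth g i \mPo g = line_product * 'X_i.
Proof.
have [l0 l1 l2] := line_formE.
have [e0 e1 e2] := involution_square_identity ('X_ord0 : P) ('X_o1) ('X_o2).
have lg l : line l \mPo g = tnth g ord0 + (tnth g o1 + tnth g o2) - tnth g l *+ 2.
  by rewrite line_form_comp big_ord3.
rewrite [X in X \mPo g]tnth_involution_g rmorphM /= comp_mpoly_tnth lg.
have gE l : tnth g l = 'X_l * line l := tnth_involution_g k l.
rewrite !gE l0 l1 l2 /line_product l0 l1 l2.
case: (unliftP ord0 i) => [j ->|->]; last by rewrite l0 e0.
case: (unliftP ord0 j) => [j' ->|->].
  rewrite (_ : lift ord0 (lift ord0 j') = o2); last by apply: val_inj; case: j' => -[].
  by rewrite l2 e2.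
rewrite (_ : lift ord0 ord0 = o1); last exact: val_inj.
by rewrite l1 e1.
Qed.

Lemma line_neq0 l : line l != 0.
Proof.
have [l0 l1 l2] := line_formE.
have c i j m : i != j -> m != j -> ('X_i + 'X_m - 'X_j : P)@_U_(j) != 0.
  move=> ij mj; rewrite mcoeffB mcoeffD !mcoeffXU eqxx (negPf ij) (negPf mj).
  by rewrite addr0 sub0r oppr_eq0 oner_eq0.
have nz (p : P) m : p@_m != 0 -> p != 0.
  by apply: contra => /eqP ->; rewrite mcoeff0.
case: (unliftP ord0 l) => [j ->|->]; last by rewrite l0; apply/nz/c.
case: (unliftP ord0 j) => [j' ->|->].
  rewrite (_ : lift ord0 (lift ord0 j') = o2); last by apply: val_inj; case: j' => -[].
  by rewrite l2; apply/nz/c.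
by rewrite (_ : lift ord0 ord0 = o1) ?l1; [apply/nz/c|exact: val_inj].
Qed.

Lemma line_product_neq0 : line_product != 0.
Proof. by rewrite !mulf_neq0 ?line_neq0. Qed.

Lemma comp_g_g d (p : P) : p \is d.-homog ->
  (p \mPo g) \mPo g = line_product ^+ d * p.
Proof.
move=> hp; rewrite comp_mpolyA -[in RHS](comp_mpoly_id p).
rewrite -(comp_mpoly_scale _ _ hp); congr (_ \mPo _).
by apply: eq_from_tnth => i; rewrite [LHS]tnth_mktuple [RHS]tnth_mktuple
  tnth_g_comp tnth_mktuple.
Qed.

(** Components of distinct degrees stay apart under substitution. *)
Lemma comp_inj_homog e (f : 3.-tuple P) : (0 < e)%N ->
  (forall i, tnth f i \is e.-homog) ->
  (forall d (p : P), p \is d.-homog -> p \mPo f = 0 -> p = 0) ->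
  injective (comp_mpoly f).
Proof.
move=> e0 hf hp p q pq; apply/eqP; rewrite -subr_eq0; apply/eqP.
have : (p - q) \mPo f = 0 by rewrite comp_mpolyB pq subrr.
move: (p - q) => {pq p q}p pf.
set n := mmeasure mdeg p; pose F (i : 'I_n) := pihomog mdeg i p.
have pE : p = \sum_i F i by exact: pihomog_partitionE.
have cF : p \mPo f = \sum_i (F i \mPo f) by rewrite {1}pE; exact: raddf_sum.
rewrite pE; apply: big1 => d _; apply: (hp d); first exact: pihomogP.
have hF i : F i \mPo f \is (e * i)%N.-homog.
  by apply: dhomog_comp => //; exact: pihomogP.
have := congr1 (pihomog mdeg (e * d)) pf; rewrite pihomog0 cF raddf_sum /=.
rewrite (bigD1 d) //= big1 ?addr0 => [|c cd]; first by rewrite pihomog_dE.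
apply: (pihomog_ne0 _ (hF c)).
by rewrite eqn_mul2l -leqn0 leqNgt e0 /=.
Qed.

Lemma comp_g_inj : injective (comp_mpoly g : P -> P).
Proof.
apply: (@comp_inj_homog 2) => // [i|d p hp pg0]; first exact: involution_g_homog.
have /eqP := comp_g_g hp; rewrite pg0 comp_mpoly0 eq_sym mulf_eq0.
by rewrite expf_eq0 (negPf line_product_neq0) andbF => /eqP.
Qed.

Definition involution_pullback : {rmorphism K -> K} :=
  sval (fraction_lift_morphism comp_g_inj).

Lemma involution_pullbackE p q : q != 0 ->
  involution_pullback (p%:F / q%:F) = (p \mPo g)%:F / (q \mPo g)%:F.
Proof. exact: (svalP (fraction_lift_morphism comp_g_inj)). Qed.

Lemma comp_g_neq0 (q : P) : q != 0 -> q \mPo g != 0.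
Proof. by move=> q0; rewrite -(comp_mpoly0 g) (inj_eq comp_g_inj). Qed.

Lemma involution_pullback_E u : E u -> E (involution_pullback u).
Proof.
move=> [d [p [q [hp hq q0 ->]]]]; rewrite involution_pullbackE //.
exists (2 * d)%N, (p \mPo g), (q \mPo g).
by split=> //; [apply: dhomog_comp|apply: dhomog_comp|exact: comp_g_neq0];
  move=> // i; exact: involution_g_homog.
Qed.

Lemma involution_pullbackK u : E u ->
  involution_pullback (involution_pullback u) = u.
Proof.
move=> [d [p [q [hp hq q0 ->]]]].
rewrite involution_pullbackE // involution_pullbackE ?comp_g_neq0 //.
rewrite !(comp_g_g hp) !(comp_g_g hq) !tofracM -mulf_div divff ?mul1r //.
by rewrite tofrac_eq0 expf_neq0 // line_product_neq0.
Qed.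

End Involution.

Section Composite.
Variables (k : fieldType) (M : 'M[int]_2) (N : nat) (rep : 'I_N -> nat * nat).
Hypothesis reps : char_reps M rep.
Local Notation P := {mpoly k[3]}.
Local Notation K := {fraction {mpoly k[3]}}.
Local Notation "p %:F" := (@tofrac {mpoly k[3]} p).
Local Notation E := (@function_field k).
Local Notation g := (involution_g k).
Local Notation h := (monomial_map k M).
Local Notation f := (comp_map g h).
Local Notation sh := (monomial_pullback k reps).
Local Notation sg := (involution_pullback k).

Definition pullback : {rmorphism K -> K} := (sh \o sg : {rmorphism _ -> _}).

Lemma pullback_comp u : pullback u = sh (sg u).
Proof. by []. Qed.

Lemma comp_f (p : P) : p \mPo f = (p \mPo g) \mPo h.
Proof. by rewrite comp_mpolyA. Qed.

Lemma comp_f_neq0 (q : P) : q != 0 -> q \mPo f != 0.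
Proof.
by move=> q0; rewrite comp_f (comp_monomial_map_neq0 reps) // comp_g_neq0.
Qed.

Lemma pullbackE (p q : P) : q != 0 ->
  pullback (p%:F / q%:F) = (p \mPo f)%:F / (q \mPo f)%:F.
Proof.
move=> q0; apply: etrans (pullback_comp _) _.
apply: etrans (congr1 (fun u => sh u) (involution_pullbackE p q0)) _.
by rewrite !comp_f; exact: monomial_pullbackE (comp_g_neq0 q0).
Qed.

Lemma comp_iter_mapS n (p : P) :
  p \mPo iter_map n.+1 f = (p \mPo f) \mPo iter_map n f.
Proof. by rewrite comp_mpolyA. Qed.

Lemma comp_iter_map_neq0 n (q : P) : q != 0 -> q \mPo iter_map n f != 0.
Proof.
elim: n q => [|n IH] q q0; first by rewrite comp_mpoly_id.
by rewrite comp_iter_mapS IH // comp_f_neq0.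
Qed.

Lemma iter_pullbackE n (p q : P) : q != 0 ->
  iter n pullback (p%:F / q%:F) =
  (p \mPo iter_map n f)%:F / (q \mPo iter_map n f)%:F.
Proof.
elim: n p q => [|n IH] p q q0; first by rewrite !comp_mpoly_id.
rewrite iterSr (pullbackE p q0) (IH _ _ (comp_f_neq0 q0)).
by rewrite -!comp_iter_mapS.
Qed.

Lemma pullback_field_iter n :
  pullback_field (iter_map n f) = image_pred (iter n pullback) E.
Proof.
apply: boolp.funext => u; apply: boolp.propext; split.
  move=> [d [p [q [hp hq q0 ->]]]].
  have q1 : q != 0 by apply: contraNneq q0 => ->; rewrite comp_mpoly0.
  by exists (p%:F / q%:F); [exists d, p, q|rewrite iter_pullbackE].
move=> [_ [d [p [q [hp hq q0 ->]]]] ->]; exists d, p, q; split=> //.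
  exact: comp_iter_map_neq0.
exact: iter_pullbackE.
Qed.

Lemma pullback_E u : E u -> E (pullback u).
Proof. by move=> Eu; apply/monomial_pullback_E/involution_pullback_E. Qed.

(** The pull-back by the involution is an automorphism of the function field, so
    it does not change the image. *)
Lemma image_pullback : image_pred pullback E = image_pred sh E.
Proof.
apply: boolp.funext => u; apply: boolp.propext; split.
  by move=> [v Ev ->]; exists (sg v) => //; exact: involution_pullback_E.
move=> [v Ev ->]; exists (sg v); first exact: involution_pullback_E.
apply: etrans (congr1 (fun u => sh u) (esym (involution_pullbackK Ev))) _.
exact/esym/pullback_comp.
Qed.

Lemma has_top_degree_iter n d : has_top_degree (iter_map n f) d <-> d = (N ^ n)%N.
Proof.
have [subE _] := function_field_subfield k.
have hb := monomial_basis k reps; rewrite -image_pullback in hb.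
have [c hc] := is_basis_iter n subE pullback_E hb.
rewrite /has_top_degree pullback_field_iter.
have subL : subring_pred (image_pred (iter n pullback) E).
  elim: n {c hc} => [|n IH].
    case: subE => E0 E1 EB EM; split; [by exists 0|by exists 1| |].
      by move=> _ _ [x Ex ->] [y Ey ->]; exists (x - y) => //; exact: EB.
    by move=> _ _ [x Ex ->] [y Ey ->]; exists (x * y) => //; exact: EM.
  have := subring_image pullback IH.
  suff -> : image_pred pullback (image_pred (iter n pullback) E) =
    image_pred (iter n.+1 pullback) E by [].
  apply: boolp.funext => y; apply: boolp.propext; split.
    by case=> _ [x Ex ->] ->; exists x.
  by case=> x Ex ->; exists (iter n pullback x) => //; exists x.
have [E0 _ _ _] := subE.
split=> [[b [bE bU]]|->].
  have hb' := unique_is_basis subL E0 bE bU.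
  apply/eqP; rewrite eqn_leq (is_basis_card_le subL hc hb').
  by rewrite (is_basis_card_le subL hb' hc).
exists c; split; first by case: hc.
exact: is_basis_unique subL hc.
Qed.

End Composite.
End IteratedDegree.

(** * The matrix of a Gaussian integer *)

Section GaussMatrix.
Variable mu : int[i].
Local Notation a := (complex.Re mu).
Local Notation b := (complex.Im mu).

Definition gauss_norm : nat := (`|a|%N ^ 2 + `|b|%N ^ 2)%N.

Lemma gauss_normE : gauss_norm%:Z = a ^+ 2 + b ^+ 2.
Proof. by rewrite /gauss_norm PoszD -!abszX !gez0_abs ?sqr_ge0. Qed.

Lemma gauss_mxE : [/\ gauss_mx mu 0 0 = a, gauss_mx mu 0 1 = - b,
  gauss_mx mu 1 0 = b & gauss_mx mu 1 1 = a].
Proof. by rewrite !mxE. Qed.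

Lemma act_gauss v : act (gauss_mx mu) v = (a * v.1 + b * v.2, a * v.2 - b * v.1).
Proof. by have [m00 m01 m10 m11] := gauss_mxE; rewrite /act m00 m01 m10 m11; congr (_, _); ring. Qed.

Lemma char_act_gauss v :
  char_act (gauss_mx mu) v = (a * v.1 - b * v.2, b * v.1 + a * v.2).
Proof. by have [m00 m01 m10 m11] := gauss_mxE; rewrite /char_act m00 m01 m10 m11; congr (_, _); ring. Qed.

Hypothesis mu_neq0 : mu != 0.

Lemma gauss_norm_gt0 : (0 < gauss_norm)%N.
Proof.
rewrite lt0n; apply: contra mu_neq0; rewrite -eqz_nat gauss_normE.
rewrite paddr_eq0 ?sqr_ge0 // !sqrf_eq0 => /andP[/eqP a0 /eqP b0].
by case: (mu) a0 b0 => x y /= -> ->.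
Qed.

(** The ideal generated by [mu] has the Hermite basis (N/g, 0), (c, g) with
    g = gcd(Re mu, Im mu), so that the box 0 <= x < N/g, 0 <= y < g is a set of
    representatives. *)
Lemma char_reps_gauss : exists rep : 'I_gauss_norm -> nat * nat,
  char_reps (gauss_mx mu) rep.
Proof.
have grid_size_gt0 := gauss_norm_gt0; pose g := gcdz a b.
have [u' [u ug]] := Bezoutz a b.
have [a' aE] : exists a', a = a' * g by apply/dvdzP; exact: dvdz_gcdl.
have [b' bE] : exists b', b = b' * g by apply/dvdzP; exact: dvdz_gcdr.
have g0 : 0 < g.
  rewrite lt_neqAle (_ : 0 <= g) // andbT eq_sym; apply: contraTneq grid_size_gt0 => g0.
  by rewrite -ltz_nat gauss_normE aE bE g0 !mulr0 expr0n.
have bez : u' * a' + u * b' = 1.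
  apply: (mulIf (lt0r_neq0 g0)); rewrite mul1r.
  by have : u' * a + u * b = g := ug; rewrite {1}aE {1}bE => ugE; rewrite -[RHS]ugE; ring.
pose L := (a' ^+ 2 + b' ^+ 2) * g.
have NE : gauss_norm%:Z = L * g by rewrite gauss_normE aE bE /L; ring.
have L0 : 0 < L by rewrite -(pmulr_lgt0 _ g0) -NE.
pose gn := `|g|%N; have gE : gn%:Z = g by rewrite gez0_abs // ltW.
have gn0 : (0 < gn)%N by rewrite -ltz_nat gE.
have divg (i : nat) : i%:Z = (i %/ gn)%N%:Z * g + (i %% gn)%N%:Z.
  by rewrite -gE -PoszM -PoszD -divn_eq.
exists (fun i => (i %/ gn, i %% gn)%N); split=> [[p q]|i i' [x y] [x' y']].
  pose t := (q %/ g)%Z; pose y := (q %% g)%Z.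
  have y0 : 0 <= y by exact: modz_ge0 (lt0r_neq0 g0).
  have yg : y < g by exact: ltz_pmod.
  pose p' := p - t * (a * u - b * u').
  pose s := (p' %/ L)%Z; pose x := (p' %% L)%Z.
  have x0 : 0 <= x by exact: modz_ge0 (lt0r_neq0 L0).
  have xL : x < L by exact: ltz_pmod.
  have hi : (absz (x * g + y)%R < gauss_norm)%N.
    rewrite -ltz_nat gez0_abs ?NE; last by rewrite addr_ge0 // mulr_ge0 // ltW.
    have : x + 1 <= L by rewrite lezD1.
    by rewrite -(ler_pM2r g0) mulrDl mul1r => /(lt_le_trans _); apply; rewrite ltrD2l.
  have iE : (absz (x * g + y))%:Z = x * g + y.
    by rewrite gez0_abs // addr_ge0 // mulr_ge0 // ltW.
  have modE : ((absz (x * g + y)%R %% gn)%N)%:Z = y.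
    by rewrite -modz_nat iE gE modzMDl modz_small // y0 yg.
  have divE : ((absz (x * g + y)%R %/ gn)%N)%:Z = x.
    have := divg (absz (x * g + y)); rewrite iE modE => /addIr.
    by move=> /(mulIf (lt0r_neq0 g0)).
  exists (Ordinal hi), (t * u + s * a', t * u' - s * b').
  rewrite char_act_gauss /= modE divE.
  have qE : q = t * g + y by exact: divz_eq.
  have pE : p' = s * L + x by exact: divz_eq.
  have {pE}pE : p = t * (a * u - b * u') + s * L + x by rewrite -addrA -pE /p'; ring.
  have agg : u' * a + u * b = g := ug.
  congr (_, _).
    by rewrite pE /L aE bE; ring.
  by rewrite qE -agg; move: (y) => z; rewrite aE bE; ring.
rewrite !char_act_gauss /= => e1 e2.
have sub4 (A m A' m' : int) : A + m = A' + m' -> A - A' = m' - m by lia.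
pose dx := x - x'; pose dy := y - y'.
have E2 : b * dx + a * dy = (i' %% gn)%N%:Z - (i %% gn)%N%:Z.
  by rewrite -(sub4 _ _ _ _ e2) /dx /dy; ring.
have E1 : a * dx - b * dy = (i' %/ gn)%N%:Z - (i %/ gn)%N%:Z.
  by rewrite -(sub4 _ _ _ _ e1) /dx /dy; ring.
have small (c m n d : int) : c * m = n - d -> 0 < m -> 0 <= n < m -> 0 <= d < m ->
    c = 0.
  move=> cm m0 /andP[n0 nm] /andP[d0 dm]; case: (ltrgtP c 0) => // c0.
    have : m <= - c * m by apply: ler_peMl; [exact: ltW|lia].
    by rewrite mulNr cm; lia.
  have : m <= c * m by apply: ler_peMl; [exact: ltW|lia].
  by rewrite cm; lia.
have ydiff : b' * dx + a' * dy = 0.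
  apply: (small _ g (i' %% gn)%N (i %% gn)%N) => //.
  - by rewrite -E2 aE bE; ring.
  - by rewrite -gE lez_nat ltz_nat ltn_mod gn0.
  - by rewrite -gE lez_nat ltz_nat ltn_mod gn0.
have quot_lt (j : 'I_gauss_norm) : 0 <= (j %/ gn)%N%:Z < L.
  rewrite lez_nat /= -(ltr_pM2r g0) -NE -gE -PoszM ltz_nat.
  exact: leq_ltn_trans (leq_divM _ _) (ltn_ord j).
(* multiplying the two relations by Bezout coefficients *)
have xdiff : u' * dx - u * dy = 0.
  apply: (small _ L (i' %/ gn)%N (i %/ gn)%N) => //.
  rewrite -E1 -[RHS]mul1r -bez /L aE bE.
  have -> : (u' * dx - u * dy) * ((a' ^+ 2 + b' ^+ 2) * g) =
      (u' * a' + u * b') * (a' * g * dx - b' * g * dy) +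
      g * (u' * b' - u * a') * (b' * dx + a' * dy) by ring.
  by rewrite ydiff mulr0 addr0.
have dx0 : dx = 0.
  rewrite -[dx]mul1r -bez.
  have -> : (u' * a' + u * b') * dx =
     a' * (u' * dx - u * dy) + u * (b' * dx + a' * dy) by ring.
  by rewrite xdiff ydiff !mulr0 !addr0.
have dy0 : dy = 0.
  have -> : dy = (u' * a' + u * b') * dy by rewrite bez mul1r.
  have -> : (u' * a' + u * b') * dy =
     u' * (b' * dx + a' * dy) - b' * (u' * dx - u * dy) by ring.
  by rewrite xdiff ydiff !mulr0 subr0.
split.
  apply: val_inj => /=; apply/eqP; rewrite -eqz_nat divg [X in _ == X]divg.
  move: E1 E2; rewrite dx0 dy0 !mulr0 subr0 ?addr0 => /esym/eqP.
  by rewrite subr_eq0 => /eqP -> /esym/eqP; rewrite subr_eq0 => /eqP ->.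
by move: dx0 dy0 => /eqP; rewrite subr_eq0 => /eqP -> /eqP; rewrite subr_eq0 => /eqP ->.
Qed.

End GaussMatrix.

From mathcomp Require Import all_classical all_reals all_analysis.
Import numFieldNormedType.Exports.
Local Open Scope classical_set_scope.
Local Open Scope complex_scope.

(** * Real-valued modulus and convergence of complex sequences *)

Section Modulus.
Variable R : realType.
Local Notation C := (cplx R).
Implicit Types (z w : C) (u : nat -> C).

Definition modulus z : R := ComplexField.Normc.normc (z : R[i]).

Lemma normCE z : `|z| = (modulus z)%:C :> C.
Proof. by []. Qed.

Lemma modulusM z w : modulus (z * w) = modulus z * modulus w.
Proof. exact: ComplexField.Normc.normcM. Qed.

Lemma ler_modulusD z w : modulus (z + w) <= modulus z + modulus w.
Proof. exact: le_normcD. Qed.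

Lemma modulusN z : modulus (- z) = modulus z.
Proof. exact: normcN. Qed.

Lemma modulusB z w : modulus (z - w) = modulus (w - z).
Proof. by rewrite -modulusN opprB. Qed.

Lemma ler_modulusB z w : modulus (z - w) <= modulus z + modulus w.
Proof. by rewrite (le_trans (ler_modulusD _ _)) // modulusN. Qed.

Lemma modulusV z : modulus z^-1 = (modulus z)^-1.
Proof. exact: ComplexField.Normc.normcV. Qed.

Lemma modulus0 : modulus 0 = 0.
Proof. exact: ComplexField.Normc.normc0. Qed.

Lemma modulus1 : modulus 1 = 1.
Proof. exact: ComplexField.Normc.normc1. Qed.

Lemma modulus_ge0 z : 0 <= modulus z.
Proof. by rewrite -ler0c -normCE normr_ge0. Qed.

Lemma modulus_eq0 z : (modulus z == 0) = (z == 0).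
Proof. by apply/eqP/eqP => [/ComplexField.Normc.eq0_normc|->] //; rewrite modulus0. Qed.

Lemma modulus_gt0 z : (0 < modulus z) = (z != 0).
Proof. by rewrite lt_def modulus_ge0 andbT modulus_eq0. Qed.

Lemma modulusX z n : modulus (z ^+ n) = modulus z ^+ n.
Proof. by elim: n => [|n IH]; rewrite ?expr0 ?modulus1 // !exprS modulusM IH. Qed.

Lemma modulus_real (x : R) : modulus x%:C = `|x|.
Proof. by rewrite /modulus /= expr0n addr0 sqrtr_sqr. Qed.

Lemma modulus_sum (I : Type) (s : seq I) (F : I -> C) :
  modulus (\sum_(i <- s) F i) <= \sum_(i <- s) modulus (F i).
Proof.
elim: s => [|i s IH]; first by rewrite !big_nil modulus0.
by rewrite !big_cons (le_trans (ler_modulusD _ _)) // lerD2l.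
Qed.

Lemma modulus_sqr z : modulus z ^+ 2 = complex.Re z ^+ 2 + complex.Im z ^+ 2.
Proof. by case: z => x y; rewrite /modulus /= sqr_sqrtr // addr_ge0 ?sqr_ge0. Qed.

Lemma Re_le_modulus z : `|complex.Re z| <= modulus z.
Proof.
rewrite -(ler_pXn2r (n := 2)) ?nnegrE ?modulus_ge0 // modulus_sqr.
by rewrite real_normK ?num_real // lerDl sqr_ge0.
Qed.

Lemma Im_le_modulus z : `|complex.Im z| <= modulus z.
Proof.
rewrite -(ler_pXn2r (n := 2)) ?nnegrE ?modulus_ge0 // modulus_sqr.
by rewrite real_normK ?num_real // lerDr sqr_ge0.
Qed.

Lemma modulus_le_ReIm z :
  modulus z <= `|complex.Re z| + `|complex.Im z|.
Proof.
case: z => x y; rewrite (_ : (x +i* y)%C = x%:C + 'i%C * y%:C); last first.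
  by apply/eqP; rewrite eq_complex /= !(mul0r, mul1r, addr0, add0r, subr0, mulr0) !eqxx.
apply: (le_trans (ler_modulusD _ _)).
rewrite modulusM !modulus_real /= !(mul0r, mul1r, addr0, add0r, subr0).
by rewrite /modulus /= !(expr0n, add0r, expr1n, sqrtr1) mul1r.
Qed.

Lemma gtC0_real (e : C) : 0 < e -> exists2 x : R, 0 < x & e = x%:C.
Proof.
case: e => x y; rewrite ltcE /= => /andP[/eqP -> x0]; exists x => //.
Qed.

Lemma near_C (z0 : C) (Q : C -> Prop) : (\forall z \near z0, Q z) <->
  exists2 d : R, 0 < d & forall z, modulus (z - z0) < d -> Q z.
Proof.
split=> [/nbhs_normP[e /= /gtC0_real[d d0 ->] H]|[d d0 H]].
  by exists d => // z zd; apply: H; rewrite /= normCE ltcR modulusB.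
apply/nbhs_normP; exists d%:C; first by rewrite /= ltcR.
by move=> z /=; rewrite normCE ltcR modulusB => /H.
Qed.

Lemma dnear_C (z0 : C) (Q : C -> Prop) : (\forall z \near z0^', Q z) <->
  exists2 d : R, 0 < d & forall z, z != z0 -> modulus (z - z0) < d -> Q z.
Proof.
rewrite near_withinE; split=> [/near_C[d d0 H]|[d d0 H]].
  by exists d => // z zz0 zd; exact: H.
by apply/near_C; exists d => // z zd zz0; exact: H.
Qed.

Lemma cvgC u (l : C) : u @ \oo --> l <->
  (fun n => modulus (u n - l)) @ \oo --> (0 : R).
Proof.
split=> [/cvgrPdist_lt H|/cvgrPdist_lt H].
  apply/cvgrPdist_lt => e e0; have := H e%:C; rewrite ltcR => /(_ e0).
  apply: filterS => n; rewrite normCE ltcR sub0r normrN ger0_norm ?modulus_ge0 //.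
  by rewrite modulusB.
apply/cvgrPdist_lt => e /gtC0_real[x x0 ->]; apply: filterS (H x x0) => n.
by rewrite sub0r normrN ger0_norm ?modulus_ge0 // normCE ltcR modulusB.
Qed.

Lemma cvgC_ReIm u (x y : R) : (fun n => complex.Re (u n)) @ \oo --> x ->
  (fun n => complex.Im (u n)) @ \oo --> y -> u @ \oo --> ((x +i* y)%C : C).
Proof.
move=> /cvgrPdist_le hx /cvgrPdist_le hy; apply/cvgC/cvgrPdist_le => e e0.
have e20 : 0 < e / 2 by rewrite divr_gt0.
near=> n; rewrite sub0r normrN ger0_norm ?modulus_ge0 //.
apply: le_trans (modulus_le_ReIm _) _; rewrite [e]splitr.
have -> : complex.Re (u n - (x +i* y)%C) = complex.Re (u n) - x by case: (u n).
have -> : complex.Im (u n - (x +i* y)%C) = complex.Im (u n) - y by case: (u n).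
apply: lerD; rewrite distrC; near: n; [exact: hx|exact: hy].
Unshelve. all: by end_near. Qed.

(** Absolute convergence, reduced to that of the real and imaginary parts. *)
Lemma cvg_series_modulus u (b : nat -> R) : (forall n, modulus (u n) <= b n) ->
  cvgn (series b) -> exists l : C, series u @ \oo --> l.
Proof.
move=> ub cb.
have part (f : nat -> R) : (forall n, `|f n| <= b n) -> cvgn (series f).
  move=> fb; apply: normed_cvg; apply: (series_le_cvg _ _ _ cb) => n.
  - exact: normr_ge0.
  - exact: le_trans (normr_ge0 _) (fb n).
  - exact: fb.
have cx := part (fun n => complex.Re (u n))
  (fun n => le_trans (Re_le_modulus _) (ub n)).
have cy := part (fun n => complex.Im (u n))
  (fun n => le_trans (Im_le_modulus _) (ub n)).
exists ((limn (series (fun n => complex.Re (u n))))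
  +i* (limn (series (fun n => complex.Im (u n)))))%C.
apply: cvgC_ReIm.
  rewrite (_ : (fun n => _) = series (fun n => complex.Re (u n))) //.
  apply/funext => n; rewrite /series /=.
  by rewrite (big_morph (@complex.Re R) (id1 := 0) (op1 := +%R)) // => -[? ?] [? ?].
rewrite (_ : (fun n => _) = series (fun n => complex.Im (u n))) //.
apply/funext => n; rewrite /series /=.
by rewrite (big_morph (@complex.Im R) (id1 := 0) (op1 := +%R)) // => -[? ?] [? ?].
Qed.

Lemma ler_dist_modulus z w : `|modulus z - modulus w| <= modulus (z - w).
Proof.
have := ler_modulusD (w - z) z; have := ler_modulusD (z - w) w.
by rewrite !subrK (modulusB w) ler_norml => h1 h2; apply/andP; split; lra.
Qed.

Lemma cvg_modulus u (l : C) :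
  u @ \oo --> l -> (fun n => modulus (u n)) @ \oo --> modulus l.
Proof.
move=> /cvgC ul; apply/cvgrPdist_le => e e0.
move/cvgrPdist_le : ul => /(_ e e0); apply: filterS => n.
rewrite sub0r normrN ger0_norm ?modulus_ge0 // distrC => ule.
exact: le_trans (ler_dist_modulus _ _) ule.
Qed.

Lemma modulus_series_le u (l : C) (b : nat -> R) (s : R) : (forall n, modulus (u n) <= b n) ->
  series u @ \oo --> l -> series b @ \oo --> s -> modulus l <= s.
Proof.
move=> ub ul bs; have := cvg_modulus ul => /cvg_lim <- //.
rewrite -(cvg_lim _ bs) //; apply: ler_lim.
- by apply/cvg_ex; exists (modulus l); exact: cvg_modulus.
- by apply/cvg_ex; exists s.
near=> n; rewrite /series /=; apply: le_trans (modulus_sum _ _) _.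
exact: ler_sum.
Unshelve. all: by end_near. Qed.

End Modulus.

Arguments modulus : simpl never.

(** * Power series with geometrically bounded coefficients *)

Section PowerSeries.
Variable R : realType.
Local Notation C := (cplx R).
Implicit Types (a b c : nat -> C) (w z : C) (M beta : R).

(** The power series with coefficients [a] converges where beta |w| < 1. *)
Definition geo_bound a M beta :=
  0 <= beta /\ forall n, modulus (a n) <= M * beta ^+ n.

Definition ps a w : C := limn (series (fun n => a n * w ^+ n)).

Lemma geo_bound_ge0 a M beta : geo_bound a M beta -> 0 <= M.
Proof.
by case=> _ /(_ 0%N); rewrite expr0 mulr1; apply: le_trans; exact: modulus_ge0.
Qed.

Lemma geo_bound_term a M beta w n : geo_bound a M beta ->
  modulus (a n * w ^+ n) <= geometric M (beta * modulus w) n.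
Proof.
move=> [_ ab]; rewrite modulusM modulusX /= exprMn mulrA.
by rewrite ler_wpM2r ?exprn_ge0 ?modulus_ge0.
Qed.

Lemma geo_ratio_norm a M beta w : geo_bound a M beta ->
  beta * modulus w < 1 -> `|beta * modulus w| < 1.
Proof. by move=> [b0 _] h; rewrite ger0_norm // mulr_ge0 ?modulus_ge0. Qed.

Lemma ps_unique a w (l : C) :
  series (fun n => a n * w ^+ n) @ \oo --> l -> ps a w = l.
Proof. by move=> h; exact: cvg_lim. Qed.

Lemma ps_cvg a M beta w : geo_bound a M beta -> beta * modulus w < 1 ->
  series (fun n => a n * w ^+ n) @ \oo --> ps a w.
Proof.
move=> ab bw; have [|l hl] := @cvg_series_modulus _ _ _
    (fun n => geo_bound_term w n ab).
  by apply: is_cvg_geometric_series; exact: geo_ratio_norm ab bw.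
by rewrite (ps_unique hl).
Qed.

Lemma modulus_ps_le a M beta w : geo_bound a M beta -> beta * modulus w < 1 ->
  modulus (ps a w) <= M / (1 - beta * modulus w).
Proof.
move=> ab bw; apply: (modulus_series_le (fun n => geo_bound_term w n ab)).
  exact: ps_cvg ab bw.
by apply: cvg_geometric_series; exact: geo_ratio_norm ab bw.
Qed.

Lemma geo_bound_shift a M beta m : geo_bound a M beta ->
  geo_bound (fun n => a (n + m)%N) (M * beta ^+ m) beta.
Proof. by case=> b0 ab; split=> // n; rewrite -mulrA -exprD addnC. Qed.

Lemma ps_recl a M beta w : geo_bound a M beta -> beta * modulus w < 1 ->
  ps a w = a 0%N + w * ps (fun n => a n.+1) w.
Proof.
move=> ab bw; apply: ps_unique; rewrite -cvg_shiftS.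
have ab' : geo_bound (fun n => a n.+1) (M * beta ^+ 1) beta.
  by have := geo_bound_shift 1 ab; under eq_fun do rewrite addn1.
rewrite (_ : [sequence _]_n = fun n => a 0%N +
    w * series (fun n => a n.+1 * w ^+ n) n).
  apply: cvgD; first exact: cvg_cst.
  by apply: cvgM; [exact: cvg_cst|exact: ps_cvg ab' bw].
apply/funext => n /=; rewrite /series /= big_nat_recl // expr0 mulr1.
by congr (_ + _); rewrite mulr_sumr; apply: eq_bigr => i _; rewrite exprS mulrCA.
Qed.

Lemma ps_tail a M beta w m : geo_bound a M beta -> beta * modulus w < 1 ->
  ps a w = \sum_(i < m) a i * w ^+ i + w ^+ m * ps (fun n => a (n + m)%N) w.
Proof.
move=> ab bw; elim: m => [|m IH].
  rewrite big_ord0 add0r expr0 mul1r; congr (ps _ w).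
  by apply/funext => n; rewrite addn0.
rewrite IH (ps_recl (geo_bound_shift m ab) bw) add0n big_ord_recr /=.
rewrite mulrDr mulrA -exprSr addrA [w ^+ m * _]mulrC; congr (_ + _ * ps _ w).
by apply/funext => n; rewrite addSnnS.
Qed.

Lemma ps_at0 a : ps a 0 = a 0%N.
Proof.
apply: ps_unique; rewrite -cvg_shiftS.
rewrite (_ : [sequence _]_n = cst (a 0%N)); first exact: cvg_cst.
apply/funext => n; rewrite /series /= big_nat_recl // expr0 mulr1.
by rewrite big1 ?addr0 // => i _; rewrite exprS mul0r mulr0.
Qed.

Lemma geo_boundD a b M M' beta : geo_bound a M beta -> geo_bound b M' beta ->
  geo_bound (fun n => a n + b n) (M + M') beta.
Proof.
move=> [b0 ha] [_ hb]; split=> // n; apply: le_trans (ler_modulusD _ _) _.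
by rewrite mulrDl lerD.
Qed.

Lemma geo_boundN a M beta : geo_bound a M beta -> geo_bound (fun n => - a n) M beta.
Proof. by move=> [b0 ha]; split=> // n; rewrite modulusN. Qed.

Lemma geo_bound_le a M M' beta beta' : M <= M' -> beta <= beta' ->
  geo_bound a M beta -> geo_bound a M' beta'.
Proof.
move=> MM bb ab; have M0 := geo_bound_ge0 ab; case: ab => b0 ab; split.
  exact: le_trans bb.
move=> n; apply: le_trans (ab n) _; apply: ler_pM => //; rewrite ?exprn_ge0 //.
by rewrite lerXn2r // nnegrE // (le_trans b0).
Qed.

Lemma psD a b M M' beta w : geo_bound a M beta -> geo_bound b M' beta ->
  beta * modulus w < 1 -> ps (fun n => a n + b n) w = ps a w + ps b w.
Proof.
move=> ha hb bw; apply: ps_unique.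
rewrite (_ : series _ = series (fun n => a n * w ^+ n) + series (fun n => b n * w ^+ n)).
  by apply: cvgD; [exact: ps_cvg ha bw|exact: ps_cvg hb bw].
by rewrite -seriesD; congr series; apply/funext => n; rewrite mulrDl.
Qed.

Lemma psN a M beta w : geo_bound a M beta -> beta * modulus w < 1 ->
  ps (fun n => - a n) w = - ps a w.
Proof.
move=> ha bw; apply: ps_unique.
rewrite (_ : series _ = - series (fun n => a n * w ^+ n)).
  by apply: cvgN; exact: ps_cvg ha bw.
by rewrite -seriesN; congr series; apply/funext => n; rewrite mulNr.
Qed.

Lemma cvg_nat_geometric (rho : R) : 0 <= rho < 1 ->
  (fun n : nat => n%:R * rho ^+ n) @ \oo --> (0 : R).
Proof.
move=> /andP[r0 r1]; pose s := Num.sqrt rho.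
have s0 : 0 <= s := sqrtr_ge0 _.
have s1 : s < 1 by rewrite -sqrtr1 ltr_sqrt.
have ss : rho = s * s by rewrite -expr2 sqr_sqrtr.
apply: (@squeeze_cvgr _ _ _ _ (cst 0) (geometric (1 - s)^-1 s)).
- near=> n; rewrite mulr_ge0 ?exprn_ge0 //= ss exprMn mulrA ler_wpM2r ?exprn_ge0 //.
  have -> : n%:R * s ^+ n = \sum_(i < n) s ^+ n.
    by rewrite sumr_const card_ord mulr_natl.
  apply: (@le_trans _ _ (\sum_(i < n) s ^+ i)).
    apply: ler_sum => i _; rewrite ler_wiXn2l ?(ltW s1) //; exact: ltnW.
  rewrite -[leRHS]div1r ler_pdivlMr ?subr_gt0 //.
  have := subrX1 s n => /(congr1 -%R); rewrite -mulNr !opprB mulrC => <-.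
  by rewrite lerBlDr lerDl exprn_ge0.
- exact: cvg_cst.
- by apply: cvg_geometric; rewrite ger0_norm.
Unshelve. all: by end_near. Qed.

Definition cauchy_prod a b n : C := \sum_(i < n.+1) a i * b (n - i)%N.

(** The partial sums of the Cauchy product differ from the product of the sums
    by N terms of size O(rho^N). *)
Lemma cvg_cauchy_prod a b M M' beta w : geo_bound a M beta -> geo_bound b M' beta ->
  beta * modulus w < 1 ->
  series (fun n => cauchy_prod a b n * w ^+ n) @ \oo --> ps a w * ps b w.
Proof.
move=> ha hb bw; pose rho := beta * modulus w.
have rho0 : 0 <= rho by rewrite mulr_ge0 ?modulus_ge0 //; case: ha.
pose T m := ps (fun n => b (n + m)%N) w.
have split_sum N : series (fun n => cauchy_prod a b n * w ^+ n) N =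
    \sum_(i < N) a i * w ^+ i * \sum_(j < N - i) b j * w ^+ j.
  rewrite /series /= big_mkord; elim: N => [|N IH]; first by rewrite !big_ord0.
  rewrite [LHS]big_ord_recr /= IH /cauchy_prod mulr_suml [X in _ + X]big_ord_recr.
  rewrite [RHS]big_ord_recr /= addrA subSnn big_ord1 subnn expr0 mulr1.
  congr (_ + _); last by rewrite mulrAC.
  rewrite -big_split /=; apply: eq_bigr => i _.
  have iN := ltn_ord i; rewrite subSn 1?ltnW // big_ord_recr /= mulrDr.
  by rewrite mulrACA -exprD subnKC // ltnW.
have diff N : series (fun n => cauchy_prod a b n * w ^+ n) N =
    series (fun n => a n * w ^+ n) N * ps b w -
    \sum_(i < N) a i * w ^+ i * (w ^+ (N - i) * T (N - i)%N).
  rewrite split_sum /series /= big_mkord mulr_suml -sumrB; apply: eq_bigr => i _.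
  by rewrite -mulrBr (ps_tail (N - i) hb bw) addrK.
rewrite (_ : series _ = (fun N => series (fun n => a n * w ^+ n) N * ps b w -
    \sum_(i < N) a i * w ^+ i * (w ^+ (N - i) * T (N - i)%N))); last exact/funext.
rewrite -[X in _ --> X]subr0; apply: cvgB.
  by apply: cvgM; [exact: ps_cvg ha bw|exact: cvg_cst].
apply/cvgC; pose K := M * (M' / (1 - rho)).
apply: (@squeeze_cvgr _ _ _ _ (cst 0) (fun N : nat => K * (N%:R * rho ^+ N))).
- near=> N; rewrite subr0 modulus_ge0 /=.
  apply: le_trans (modulus_sum _ _) _.
  rewrite mulrCA mulr_natl -[X in _ *+ X]card_ord -sumr_const.
  apply: ler_sum => i _; rewrite modulusM.
  have iN := ltnW (ltn_ord i).
  have -> : K * rho ^+ N = (M * rho ^+ i) * (rho ^+ (N - i) * (M' / (1 - rho))).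
    by rewrite -{1}(subnKC iN) exprD /K; ring.
  apply: ler_pM; rewrite ?modulus_ge0 //; first exact: geo_bound_term ha.
  rewrite modulusM modulusX.
  have hT := modulus_ps_le (geo_bound_shift (N - i) hb) bw.
  apply: le_trans (ler_wpM2l (exprn_ge0 _ (modulus_ge0 w)) hT) _.
  by rewrite /rho exprMn le_eqVlt; apply/orP; left; apply/eqP; ring.
- exact: cvg_cst.
- rewrite -[X in _ --> X](mulr0 K); apply: cvgM; first exact: cvg_cst.
  by apply: cvg_nat_geometric; rewrite rho0.
Unshelve. all: by end_near. Qed.

End PowerSeries.

(** * Re-expansion and quotients of power series *)

Section Reexpansion.
Variable R : realType.
Local Notation C := (cplx R).
Implicit Types (a b c : nat -> C) (w z : C) (M beta : R).

(** The coefficients of (f(z) - f(z0)) / (z - z0), where f is the sum of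
    a_n z^n. *)
Definition ps_slope a z0 : nat -> C := fun n => ps (fun j => a (j + n.+1)%N) z0.

Definition slope_ratio beta z0 := beta / (1 - beta * modulus z0).

Lemma geo_bound_slope a M beta z0 : geo_bound a M beta ->
  beta * modulus z0 < 1 -> geo_bound (ps_slope a z0) (M * slope_ratio beta z0) beta.
Proof.
move=> ab bz; split=> [|n]; first by case: ab.
apply: le_trans (modulus_ps_le (geo_bound_shift n.+1 ab) bz) _.
by rewrite /slope_ratio exprS le_eqVlt; apply/orP; left; apply/eqP; ring.
Qed.

Lemma ps_slopeE a M beta z0 z : geo_bound a M beta ->
  beta * modulus z0 < 1 -> beta * modulus z < 1 ->
  ps a z = ps a z0 + (z - z0) * ps (ps_slope a z0) z.
Proof.
move=> ab bz0 bz; pose T n := ps (fun j => a (j + n)%N) z0.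
have T0 : T 0%N = ps a z0.
  by rewrite /T; congr (ps _ z0); apply/funext => n; rewrite addn0.
have TS n : T n = a n + z0 * T n.+1.
  rewrite /T (ps_recl (geo_bound_shift n ab) bz0) add0n; congr (_ + _ * ps _ z0).
  by apply/funext => j; rewrite addSnnS.
have tele N : (z - z0) * series (fun n => ps_slope a z0 n * z ^+ n) N =
    T N * z ^+ N + series (fun n => a n * z ^+ n) N - ps a z0.
  rewrite /series /= !big_mkord; elim: N => [|N IH].
    by rewrite !big_ord0 mulr0 expr0 mulr1 T0 addr0 subrr.
  by rewrite !big_ord_recr /= mulrDr IH (TS N) (_ : ps_slope a z0 N = T N.+1) // exprS; ring.
have sb := geo_bound_slope ab bz0.
have lim1 : (fun N => (z - z0) * series (fun n => ps_slope a z0 n * z ^+ n) N)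
    @ \oo --> (z - z0) * ps (ps_slope a z0) z.
  by apply: cvgM; [exact: cvg_cst|exact: ps_cvg sb bz].
have limT : (fun N => T N * z ^+ N) @ \oo --> (0 : C).
  apply/cvgC; apply: (@squeeze_cvgr _ _ _ _ (cst 0)
    (geometric (M / (1 - beta * modulus z0)) (beta * modulus z))).
  - near=> N; rewrite subr0 modulus_ge0 /= modulusM modulusX exprMn mulrA.
    rewrite ler_wpM2r ?exprn_ge0 ?modulus_ge0 // mulrAC.
    exact: modulus_ps_le (geo_bound_shift N ab) bz0.
  - exact: cvg_cst.
  - by apply: cvg_geometric; exact: geo_ratio_norm ab bz.
have lim2 : (fun N => (z - z0) * series (fun n => ps_slope a z0 n * z ^+ n) N)
    @ \oo --> 0 + ps a z - ps a z0.
  rewrite (_ : (fun N => _) = fun N => T N * z ^+ N +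
      series (fun n => a n * z ^+ n) N - ps a z0); last exact/funext.
  apply: cvgB; last exact: cvg_cst.
  by apply: cvgD; [exact: limT|exact: ps_cvg ab bz].
have slopeE : (z - z0) * ps (ps_slope a z0) z = 0 + ps a z - ps a z0.
  by apply: (cvg_unique _ lim1 lim2); exact: norm_hausdorff.
by rewrite slopeE; move: (ps a z) (ps a z0) => x y; ring.
Unshelve. all: by end_near. Qed.

Definition reexpand a z0 : nat -> C :=
  fun k => ps (iter k (fun b => ps_slope b z0) a) z0.

(** Iterating the slope identity gives Taylor's formula with remainder; the
    remainder tends to 0 in the whole disk where the estimates make sense. *)
Lemma ps_reexpand a M beta z0 : geo_bound a M beta -> beta * modulus z0 < 1 ->
  geo_bound (reexpand a z0) (M / (1 - beta * modulus z0)) (slope_ratio beta z0) /\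
  forall z, beta * modulus z < 1 -> slope_ratio beta z0 * modulus (z - z0) < 1 ->
    ps a z = ps (reexpand a z0) (z - z0).
Proof.
move=> ab bz0; set q := slope_ratio beta z0.
have b0 : 0 <= beta by case: ab.
have q0 : 0 <= q by rewrite divr_ge0 // subr_ge0 ltW.
pose S k := iter k (fun b => ps_slope b z0) a.
have Sb k : geo_bound (S k) (M * q ^+ k) beta.
  elim: k => [|k IH]; first by rewrite expr0 mulr1.
  by rewrite exprSr mulrA; exact: geo_bound_slope.
have rb : geo_bound (reexpand a z0) (M / (1 - beta * modulus z0)) q.
  split=> // k; apply: le_trans (modulus_ps_le (Sb k) bz0) _.
  by rewrite mulrAC.
split=> [|z bz qz]; first exact: rb.
apply/esym/ps_unique.
have taylor N : series (fun n => reexpand a z0 n * (z - z0) ^+ n) N =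
    ps a z - (z - z0) ^+ N * ps (S N) z.
  rewrite /series /= big_mkord; elim: N => [|N IH].
    by rewrite big_ord0 expr0 mul1r subrr.
  rewrite big_ord_recr /= IH (ps_slopeE (Sb N) bz0 bz) exprSr.
  rewrite /reexpand -/(S N); move: (ps (S N) z0) (ps (ps_slope (S N) z0) z).
  by move: (ps a z) (z - z0) => p w x y; ring.
rewrite (_ : series _ = fun N => ps a z - (z - z0) ^+ N * ps (S N) z).
  2: exact/funext.
rewrite -[X in _ --> X]subr0; apply: cvgB; first exact: cvg_cst.
apply/cvgC; apply: (@squeeze_cvgr _ _ _ _ (cst 0)
  (geometric (M / (1 - beta * modulus z)) (q * modulus (z - z0)))).
- near=> N; rewrite subr0 modulus_ge0 /= modulusM modulusX.
  apply: le_trans (ler_wpM2l (exprn_ge0 _ (modulus_ge0 _)) (modulus_ps_le (Sb N) bz)) _.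
  by rewrite (exprMn N q) le_eqVlt; apply/orP; left; apply/eqP; ring.
- exact: cvg_cst.
- by apply: cvg_geometric; rewrite ger0_norm // mulr_ge0 ?modulus_ge0.
Unshelve. all: by end_near. Qed.

(** The n-th coefficient of the power series whose product by [b] is [a]. *)
Definition ps_quot_step a b n (c : nat -> C) : C :=
  (a n.+1 - \sum_(i < n.+1) c i * b (n.+1 - i)%N) / b 0%N.

Definition ps_quot a b := course_of_values (a 0%N / b 0%N) (ps_quot_step a b).

Lemma cauchy_prod_quot a b n : b 0%N != 0 -> cauchy_prod (ps_quot a b) b n = a n.
Proof.
move=> b0; case: n => [|n]; first by rewrite /cauchy_prod big_ord1 /= divfK.
have stepE m F G : (forall j, (j <= m)%N -> F j = G j) ->
    ps_quot_step a b m F = ps_quot_step a b m G.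
  move=> FG; congr ((_ - _) / _); apply: eq_bigr => i _.
  by rewrite FG // -ltnS.
rewrite /cauchy_prod big_ord_recr /= subnn /ps_quot (course_of_valuesS _ stepE).
by rewrite -/(ps_quot a b) /ps_quot_step divfK // addrC subrK.
Qed.

Lemma geo_bound_quot a b M beta : b 0%N != 0 ->
  geo_bound a M beta -> geo_bound b M beta ->
  let K := M / modulus (b 0%N) in
  geo_bound (ps_quot a b) K (beta * (1 + K)).
Proof.
move=> b00 ab bb K; have M0 := geo_bound_ge0 ab; case: ab => beta0 ab; case: bb => _ bb.
have K0 : 0 <= K by rewrite divr_ge0 ?modulus_ge0.
split=> [|n]; first by rewrite mulr_ge0 ?addr_ge0.
elim/ltn_ind: n => n IH; have mb0 : modulus (b 0%N) != 0 by rewrite modulus_eq0.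
have MK : M = K * modulus (b 0%N) by rewrite /K divfK.
(* the recursion bounds the n-th coefficient by K beta^n times a geometric sum *)
have main : modulus (\sum_(i < n) ps_quot a b i * b (n - i)%N) <=
    M * beta ^+ n * ((1 + K) ^+ n - 1).
  apply: le_trans (modulus_sum _ _) _.
  apply: (@le_trans _ _ (\sum_(i < n) M * beta ^+ n * (K * (1 + K) ^+ i))).
    apply: ler_sum => i _; rewrite modulusM.
    have iN := ltn_ord i.
    apply: le_trans (ler_pM _ _ (IH i iN) (bb (n - i)%N)) _; rewrite ?modulus_ge0 //.
    have -> : beta ^+ n = beta ^+ i * beta ^+ (n - i).
      by rewrite -exprD subnKC // ltnW.
    by rewrite exprMn le_eqVlt; apply/orP; left; apply/eqP; ring.
  by rewrite -mulr_sumr -mulr_sumr subrX1 (addrC 1 K) addrK lexx.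
have E : ps_quot a b n * b 0%N = a n - \sum_(i < n) ps_quot a b i * b (n - i)%N.
  have := cauchy_prod_quot a n b00; rewrite /cauchy_prod big_ord_recr /= subnn => <-.
  by rewrite addrAC subrr add0r.
rewrite -(ler_pM2r (_ : 0 < modulus (b 0%N))) ?modulus_gt0 // -modulusM E.
apply: le_trans (ler_modulusB _ _) _; apply: le_trans (lerD (ab n) main) _.
by rewrite MK exprMn le_eqVlt; apply/orP; left; apply/eqP; ring.
Qed.

End Reexpansion.

(** * Analytic functions *)

Section Analytic.
Variable R : realType.
Local Notation C := (cplx R).
Implicit Types (F G : C -> C) (a b : nat -> C) (w z : C) (M beta d : R).

(** [has_power_series] with explicit geometric bounds. *)
Definition expands F z0 a := exists M beta d, [/\ geo_bound a M beta, 0 < d &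
  forall z, modulus (z - z0) < d ->
    beta * modulus (z - z0) < 1 /\ F z = ps a (z - z0)].

(** Convergence at a single point other than the centre bounds the terms there,
    which gives a geometric bound on the coefficients. *)
Lemma expandsP F z0 a : has_power_series F z0 a <-> expands F z0 a.
Proof.
split=> [/near_C[d d0 H]|[M [beta [d [ab d0 H]]]]]; last first.
  apply/near_C; exists d => // z /H[bz ->]; exact: ps_cvg ab bz.
pose rho := d / 2; have rho0 : 0 < rho by rewrite divr_gt0.
have rhod : rho < d by rewrite /rho; lra.
have := H (z0 + rho%:C); rewrite addrAC subrr add0r modulus_real.
rewrite gtr0_norm // => /(_ rhod) hs.
have /cvgC/cvgrPdist_lt/(_ 1 ltr01) [N _ HN] :=
  cvg_series_cvg_0 (cvgP _ hs).
pose B := 1 + \sum_(n < N) modulus (a n) * rho ^+ n.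
have ab : geo_bound a B rho^-1.
  split=> [|n]; first by rewrite invr_ge0 ltW.
  rewrite exprVn ler_pdivlMr ?exprn_gt0 //.
  have S0 : 0 <= \sum_(n < N) modulus (a n) * rho ^+ n.
    by apply: sumr_ge0 => i _; rewrite mulr_ge0 ?modulus_ge0 // exprn_ge0 // ltW.
  have [nN|Nn] := ltnP n N.
    rewrite /B (bigD1 (Ordinal nN)) //= addrCA lerDl addr_ge0 //.
    by apply: sumr_ge0 => i _; rewrite mulr_ge0 ?modulus_ge0 // exprn_ge0 // ltW.
  have := HN n Nn; rewrite /= sub0r normrN subr0 ger0_norm ?modulus_ge0 //.
  rewrite modulusM modulusX modulus_real gtr0_norm // => /ltW h.
  by apply: le_trans h _; rewrite lerDl.
exists B, rho^-1, rho; split=> // z zr.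
have bz : rho^-1 * modulus (z - z0) < 1 by rewrite mulrC ltr_pdivrMr // mul1r.
split=> //; have h1 := H z (lt_trans zr rhod); have h2 := ps_cvg ab bz.
by apply: (cvg_unique _ h1 h2); exact: norm_hausdorff.
Qed.

Lemma geo_bound_common a b M M' beta beta' :
  geo_bound a M beta -> geo_bound b M' beta' ->
  let B := Num.max M M' in let q := Num.max beta beta' in
  geo_bound a B q /\ geo_bound b B q.
Proof.
move=> ha hb B q; split.
  by apply: geo_bound_le ha; rewrite /B /q le_max lexx.
by apply: geo_bound_le hb; rewrite /B /q le_max lexx orbT.
Qed.

(** Near the centre the leading term dominates. *)
Lemma ps_lower_bound a M beta : geo_bound a M beta -> a 0%N != 0 ->
  exists2 d, 0 < d & forall w, modulus w < d ->
    beta * modulus w < 1 /\ modulus (a 0%N) / 2 <= modulus (ps a w).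
Proof.
move=> ab a0; have M0 := geo_bound_ge0 ab; have b0 : 0 <= beta by case: ab.
have ma0 : 0 < modulus (a 0%N) by rewrite modulus_gt0.
pose K := 2 * (beta + M * beta / (modulus (a 0%N) / 2) + 1).
have K0 : 0 < K by rewrite /K mulr_gt0 // ltr_wpDl // addr_ge0 // !mulr_ge0 // invr_ge0 mulr_ge0 // ltW.
exists K^-1; first by rewrite invr_gt0.
move=> w wK; have {}wK : modulus w * K < 1 by rewrite -ltr_pdivlMr // mul1r.
have w0 := modulus_ge0 w.
have T0 : 0 <= M * beta / (modulus (a 0%N) / 2).
  by rewrite !mulr_ge0 // invr_ge0 divr_ge0 // ltW.
have bw : beta * modulus w <= 1 / 2.
  move: wK; rewrite /K; have := mulr_ge0 w0 T0; nra.
have bw1 : beta * modulus w < 1 by lra.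
split=> //; rewrite (ps_recl ab bw1).
have sb := geo_bound_shift 1 ab.
have tail : modulus (ps (fun n => a n.+1) w) <= 2 * (M * beta).
  have -> : (fun n => a n.+1) = (fun n => a (n + 1)%N).
    by apply/funext => n; rewrite addn1.
  apply: le_trans (modulus_ps_le sb bw1) _.
  rewrite expr1 ler_pdivrMr ?subr_gt0 //.
  by have := mulr_ge0 M0 b0; nra.
have wt : modulus (w * ps (fun n => a n.+1) w) <= modulus (a 0%N) / 2.
  rewrite modulusM; apply: le_trans (ler_wpM2l w0 tail) _.
  have TE : M * beta = M * beta / (modulus (a 0%N) / 2) * (modulus (a 0%N) / 2).
    by rewrite divfK // lt0r_neq0 // divr_gt0.
  have h : modulus w * (2 * (M * beta / (modulus (a 0%N) / 2))) <= 1.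
    move: wK; rewrite /K; have := mulr_ge0 w0 b0; nra.
  rewrite TE mulrA mulrA -{1}[_ / 2]mulr1; nra.
have := ler_modulusB (a 0%N + w * ps (fun n => a n.+1) w) (w * ps (fun n => a n.+1) w).
by rewrite addrK; lra.
Qed.

(** The formal quotient converges by [geo_bound_quot], and [cauchy_prod_quot]
    identifies its sum. *)
Lemma expands_quot F G z0 a b : expands F z0 a -> expands G z0 b -> b 0%N != 0 ->
  expands (fun z => F z / G z) z0 (ps_quot a b).
Proof.
move=> [M [beta [d [ab d0 HF]]]] [M' [beta' [d' [bb d'0 HG]]]] b00.
have [] := geo_bound_common ab bb; set B := Num.max _ _; set q := Num.max _ _.
move=> ab' bb'; have qb := geo_bound_quot b00 ab' bb'.
set K := B / modulus (b 0%N) in qb; set q' := q * (1 + K) in qb.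
have [d1 d10 low] := ps_lower_bound bb b00.
have K0 : 0 <= K by rewrite divr_ge0 ?modulus_ge0 // (geo_bound_ge0 ab').
have q0 : 0 <= q by case: ab'.
have qq' : q <= q' by rewrite ler_peMr // lerDl.
have q'0 : 0 <= q' := le_trans q0 qq'.
pose e := Num.min (Num.min d d') (Num.min d1 (q' + 1)^-1).
have q'1 : 0 < q' + 1 by rewrite ltr_wpDl.
exists K, q', e; split=> //; first by rewrite !lt_min d0 d'0 d10 invr_gt0.
move=> z; rewrite !lt_min => /andP[/andP[/HF[_ FE] /HG[_ GE]] /andP[/low[_ zlow] zq]].
have bz : q' * modulus (z - z0) < 1.
  have : modulus (z - z0) * (q' + 1) < 1 by rewrite -ltr_pdivlMr // mul1r.
  by have := modulus_ge0 (z - z0); nra.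
split=> //; rewrite FE GE.
have g0 : ps b (z - z0) != 0.
  rewrite -modulus_gt0; apply: lt_le_trans zlow.
  by rewrite divr_gt0 // modulus_gt0.
have bb'' := geo_bound_le (lexx B) qq' bb'.
have ab'' := geo_bound_le (lexx B) qq' ab'.
have h1 := cvg_cauchy_prod qb bb'' bz; have h2 := ps_cvg ab'' bz.
have E : series (fun n => cauchy_prod (ps_quot a b) b n * (z - z0) ^+ n) =
    series (fun n => a n * (z - z0) ^+ n).
  by congr series; apply/funext => n; rewrite cauchy_prod_quot.
rewrite E in h1; apply: (mulIf g0); rewrite divfK //.
by apply: (cvg_unique _ h2 h1); exact: norm_hausdorff.
Qed.

(** The m-th coefficient being the first nonzero one, the lower bound holds for the
    series divided by the m-th power of z - z0. *)
Lemma expands_order F z0 a : expands F z0 a -> (exists n, a n != 0) ->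
  exists m c d, [/\ 0 < c, 0 < d & forall z, modulus (z - z0) < d ->
     c * modulus (z - z0) ^+ m <= modulus (F z)].
Proof.
move=> [M [beta [d [ab d0 H]]]] ex; pose m := ex_minn ex.
have [am min_m] : a m != 0 /\ forall n, (n < m)%N -> a n = 0.
  rewrite /m; case: ex_minnP => n an minn; split=> // i i_n; apply/eqP.
  by apply: contraTT i_n => ai; rewrite -leqNgt minn.
have [d1 d10 low] := ps_lower_bound (geo_bound_shift m ab) am.
exists m, (modulus (a m) / 2), (Num.min d d1); split.
- by rewrite divr_gt0 // modulus_gt0.
- by rewrite lt_min d0.
move=> z; rewrite lt_min => /andP[/H[bz ->] /low[_ zlow]].
rewrite (ps_tail m ab bz) big1 => [|i _]; last by rewrite min_m ?mul0r.
rewrite add0r modulusM modulusX mulrC ler_wpM2l ?exprn_ge0 ?modulus_ge0 //.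
Qed.

Lemma expands_bounded F z0 a : expands F z0 a -> exists B d, 0 < d /\
  forall z, modulus (z - z0) < d -> modulus (F z) <= B.
Proof.
move=> [M [beta [d [ab d0 H]]]]; have M0 := geo_bound_ge0 ab.
have b0 : 0 <= beta by case: ab.
have b1 : 0 < 2 * (beta + 1) by rewrite mulr_gt0 // ltr_wpDl.
exists (2 * M), (Num.min d (2 * (beta + 1))^-1); split.
  by rewrite lt_min d0 invr_gt0.
move=> z; rewrite lt_min => /andP[/H[bz ->] zb].
apply: le_trans (modulus_ps_le ab bz) _; rewrite ler_pdivrMr ?subr_gt0 //.
have : modulus (z - z0) * (2 * (beta + 1)) < 1 by rewrite -ltr_pdivlMr // mul1r.
by have := modulus_ge0 (z - z0); nra.
Qed.

Lemma expands_at F z0 a : expands F z0 a -> F z0 = a 0%N.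
Proof.
move=> [M [beta [d [_ d0 /(_ z0)]]]]; rewrite subrr modulus0 => /(_ d0)[_ ->].
exact: ps_at0.
Qed.

(** An analytic function is bounded near its centre. *)
Lemma analytic_not_pole F z0 m : analytic_at F z0 -> ~ pole_at F m z0.
Proof.
move=> [a /expandsP /expands_bounded[B [d [d0 FB]]]].
move=> [m0 [h [[b /expandsP hb] h0 /dnear_C[d' d'0 FE]]]].
have b00 : b 0%N != 0 by rewrite -(expands_at hb).
have [M [beta [d2 [bb d20 hE]]]] := hb.
have [d3 d30 low] := ps_lower_bound bb b00.
set c := modulus (b 0%N) / 2 in low; have c0 : 0 < c by rewrite divr_gt0 ?modulus_gt0.
pose B' := Num.max B 0 + 1; have B'0 : 0 < B' by rewrite ltr_wpDl // le_max lexx orbT.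
pose e := Num.min (Num.min (Num.min d d') (Num.min d2 d3)) (Num.min 1 (c / B')) / 2.
have mn0 : 0 < Num.min (Num.min (Num.min d d') (Num.min d2 d3)) (Num.min 1 (c / B')).
  by rewrite !lt_min d0 d'0 d20 d30 ltr01 divr_gt0.
have e0 : 0 < e by rewrite divr_gt0.
have : e < Num.min (Num.min (Num.min d d') (Num.min d2 d3)) (Num.min 1 (c / B')).
  by rewrite /e; lra.
rewrite !lt_min => /andP[/andP[/andP[ed ed'] /andP[ed2 ed3]] /andP[e1 ec]].
pose z := z0 + e%:C; have zE : z - z0 = e%:C by rewrite /z addrAC subrr add0r.
have mz : modulus (z - z0) = e by rewrite zE modulus_real gtr0_norm.
have zz0 : z != z0 by rewrite -subr_eq0 -modulus_eq0 mz gt_eqF.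
have := FB z; rewrite mz => /(_ ed); rewrite FE ?mz // modulusM modulusV modulusX mz.
have := hE z; rewrite mz => /(_ ed2)[_ ->].
have := low (z - z0); rewrite mz => /(_ ed3)[_ {}low].
have em : e ^+ m <= e.
  case: (m) m0 => // n _; rewrite exprS ler_piMr ?(ltW e0) //.
  by rewrite exprn_ile1 ?ltW.
rewrite ler_pdivrMr ?exprn_gt0 // => hB.
have : c <= B' * e.
  apply: le_trans low _; apply: le_trans hB _.
  apply: (@le_trans _ _ (B' * e ^+ m)); last by rewrite ler_pM2l.
  rewrite ler_wpM2r ?exprn_ge0 ?(ltW e0) // /B'.
  by rewrite -[leLHS]addr0 lerD // le_max lexx.
by rewrite leNgt mulrC -ltr_pdivlMr // ec.
Qed.

End Analytic.

(** * The function D / (2 - D) *)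

Section RealSeries.
Variable R : realType.
Local Notation C := (cplx R).

Lemma ReB (z w : C) : complex.Re (z - w) = complex.Re z - complex.Re w.
Proof. by case: z w => ? ? []. Qed.

Lemma ImB (z w : C) : complex.Im (z - w) = complex.Im z - complex.Im w.
Proof. by case: z w => ? ? []. Qed.

Lemma cvg_Re (u : nat -> C) (l : C) : u @ \oo --> l ->
  (fun n => complex.Re (u n)) @ \oo --> complex.Re l.
Proof.
move=> /cvgC/cvgrPdist_le ul; apply/cvgrPdist_le => e e0.
apply: filterS (ul e e0) => n; rewrite sub0r normrN ger0_norm ?modulus_ge0 //.
apply: le_trans; rewrite distrC.
rewrite -ReB.
exact: Re_le_modulus.
Qed.

Lemma cvg_Im (u : nat -> C) (l : C) : u @ \oo --> l ->
  (fun n => complex.Im (u n)) @ \oo --> complex.Im l.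
Proof.
move=> /cvgC/cvgrPdist_le ul; apply/cvgrPdist_le => e e0.
apply: filterS (ul e e0) => n; rewrite sub0r normrN ger0_norm ?modulus_ge0 //.
apply: le_trans; rewrite distrC.
rewrite -ImB.
exact: Im_le_modulus.
Qed.

Lemma ps_real (a : nat -> C) (w : C) (q : nat -> R) M beta :
  geo_bound a M beta -> beta * modulus w < 1 ->
  (forall n, a n * w ^+ n = (q n)%:C) -> (forall n, 0 <= q n) ->
  exists s : R, [/\ ps a w = s%:C, series q @ \oo --> s &
    forall N, \sum_(i < N) q i <= s].
Proof.
move=> ab bw aq q0; have h := ps_cvg ab bw.
have E : series (fun n => a n * w ^+ n) = fun N => (series q N)%:C.
  apply/funext => N; rewrite /series /= rmorph_sum; apply: eq_bigr => i _.
  exact: aq.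
rewrite E in h; have hR := cvg_Re h; have hI := cvg_Im h.
have im0 : complex.Im (ps a w) = 0.
  by apply: (cvg_unique _ hI (cvg_cst 0)); exact: norm_hausdorff.
exists (complex.Re (ps a w)); split=> [||N].
- by move: im0; case: (ps a w) => x y /= ->.
- exact: hR.
rewrite -(big_mkord xpredT q) -(cvg_lim _ hR) //.
apply: limr_ge; first by apply/cvg_ex; exists (complex.Re (ps a w)).
near=> n; have Nn : (N <= n)%N by near: n; exists N.
rewrite /= /series /= (big_cat_nat _ Nn) //= lerDl.
by apply: sumr_ge0 => i _.
Unshelve. all: by end_near. Qed.

End RealSeries.

Section Quotient.
Variables (R : realType) (d : nat -> R) (l L beta : R).
Local Notation C := (cplx R).
Hypothesis d0 : d 0%N = 1.
Hypothesis beta0 : 0 < beta.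
Hypothesis l0 : 0 < l.
Hypothesis d_ge : forall n, l * beta ^+ n <= d n.
Hypothesis d_le : forall n, d n <= L * beta ^+ n.

Definition dC n : C := (d n)%:C.
Definition D (z : C) : C := ps dC z.
Definition Fquot (z : C) : C := D z / (2 - D z).

Lemma d_gt0 n : 0 < d n.
Proof. by apply: lt_le_trans (d_ge n); rewrite mulr_gt0 ?exprn_gt0. Qed.

Lemma geo_dC : geo_bound dC L beta.
Proof. by split=> [|n]; rewrite ?(ltW beta0) // modulus_real gtr0_norm ?d_gt0. Qed.

Lemma D_at0 : D 0 = 1.
Proof. by rewrite /D ps_at0 /dC d0. Qed.

Lemma D_real (x : R) : 0 <= x -> beta * x < 1 ->
  exists s : R, [/\ D x%:C = s%:C, series (fun n => d n * x ^+ n) @ \oo --> s &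
    forall N, \sum_(i < N) d i * x ^+ i <= s].
Proof.
move=> x0 bx; apply: (ps_real geo_dC).
- by rewrite modulus_real ger0_norm.
- by move=> n; rewrite /dC -rmorphXn -rmorphM.
- by move=> n; rewrite mulr_ge0 ?exprn_ge0 // ltW // d_gt0.
Qed.

Lemma D_Lipschitz (x y b : R) : 0 <= x <= b -> 0 <= y <= b -> beta * b < 1 ->
  modulus (D x%:C - D y%:C) <= `|x - y| *
    (L * (beta / (1 - beta * b)) / (1 - beta * b)).
Proof.
move=> /andP[x0 xb] /andP[y0 yb] bb; have L0 := geo_bound_ge0 geo_dC.
have small t : 0 <= t -> t <= b -> beta * modulus (t%:C : C) <= beta * b.
  by move=> t0 tb; rewrite modulus_real ger0_norm // ler_pM2l.
have sx := le_lt_trans (small x x0 xb) bb; have sy := le_lt_trans (small y y0 yb) bb.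
rewrite /D (ps_slopeE geo_dC sy sx) addrAC subrr add0r modulusM.
rewrite -rmorphB modulus_real ler_wpM2l //.
apply: le_trans (modulus_ps_le (geo_bound_slope geo_dC sy) sx) _.
have r1 : 0 < 1 - beta * b by rewrite subr_gt0.
apply: ler_pM.
- by rewrite mulr_ge0 // divr_ge0 ?(ltW beta0) // subr_ge0 ltW.
- by rewrite invr_ge0 subr_ge0 ltW.
- rewrite ler_wpM2l // /slope_ratio ler_pM2l // lef_pV2 ?posrE ?subr_gt0 //.
  by rewrite lerD2l lerN2 small.
by rewrite lef_pV2 ?posrE ?subr_gt0 // lerD2l lerN2 small.
Qed.

(** D is continuous on the real interval [0, 1 / beta), equals 1 at the origin and
    exceeds 2 near the right end by the lower bound on its coefficients. *)
Lemma D_eq2 : exists p : R, [/\ 0 < p, beta * p < 1 & D p%:C = 2].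
Proof.
have L0 := geo_bound_ge0 geo_dC.
(* at b the geometric lower bound l / (1 - beta b) of D equals 4 or more *)
pose t := Num.min (l / 4) (1 / 2); pose b := (1 - t) / beta.
have t0 : 0 < t by rewrite lt_min !divr_gt0.
have tl : t <= l / 4 by rewrite ge_min lexx.
have t1 : t <= 1 / 2 by rewrite ge_min lexx orbT.
have bb : beta * b = 1 - t by rewrite /b mulrCA divff ?mulr1 // gt_eqF.
have b0 : 0 < b by rewrite divr_gt0 // subr_gt0; lra.
have bb1 : beta * b < 1 by rewrite bb; lra.
pose f (x : R) := complex.Re (D x%:C).
have fb : 2 <= f b.
  have [s [Ds _ sN]] := D_real (ltW b0) bb1; rewrite /f Ds /=.
  have h : geometric l (beta * b) = fun n => l * beta ^+ n * b ^+ n.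
    by apply/funext => n /=; rewrite exprMn mulrA.
  have := @cvg_geometric_series R l (beta * b).
  rewrite ger0_norm ?bb; last lra.
  have lt1 : 1 - t < 1 by lra.
  move=> /(_ lt1) cg; apply: (@le_trans _ _ (l * (1 - (1 - t))^-1)).
    by rewrite opprB addrCA subrr addr0 ler_pdivlMr //; lra.
  rewrite -(cvg_lim _ cg) //; apply: limr_le; first by apply/cvg_ex; eexists; exact: cg.
  near=> n; rewrite /series /= big_mkord; apply: le_trans (sN n).
  apply: ler_sum => i _; rewrite -bb exprMn mulrA ler_wpM2r ?exprn_ge0 // ltW //.
have f0 : f 0 = 1 by rewrite /f D_at0.
have cf : {within `[0, b], continuous f}.
  apply/subspace_continuousP => x /=; rewrite in_itv /= => xb.
  apply/cvgrPdist_le => e e0.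
  pose K := L * (beta / (1 - beta * b)) / (1 - beta * b) + 1.
  have K0 : 0 < K.
    rewrite ltr_wpDl // !mulr_ge0 ?invr_ge0 ?(ltW beta0) // subr_ge0 ltW //.
  rewrite near_withinE; near=> y => /=; rewrite in_itv /= => yb.
  rewrite /f -ReB.
  apply: le_trans (Re_le_modulus _) _; apply: le_trans (D_Lipschitz xb yb bb1) _.
  have xy : `|x - y| < e / K.
    by near: y; apply: cvgr_dist_lt; [exact: cvg_id|rewrite divr_gt0].
  have /ltW : `|x - y| * K < e by rewrite -ltr_pdivlMr.
  by apply: le_trans; rewrite ler_wpM2l // lerDl ler01.
have between : Num.min (f 0) (f b) <= 2 <= Num.max (f 0) (f b).
  by rewrite f0 ge_min le_max fb orbT andbT ler1n.
have [p /[!in_itv]/= /andP[p0 pb] fp] := IVT (ltW b0) cf between.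
have bp : beta * p < 1 by apply: le_lt_trans bb1; rewrite ler_pM2l.
have [s [Ds _ _]] := D_real p0 bp.
have Dp : D p%:C = 2.
  by move: fp; rewrite /f Ds /= => ->; rewrite rmorph_nat.
exists p; split=> //; rewrite lt_neqAle p0 andbT; apply/eqP => p00.
by move: fp; rewrite -p00 f0 => /eqP; rewrite (eqr_nat R 1 2).
Unshelve. all: by end_near. Qed.

End Quotient.

Section QuotientPoles.
Variables (R : realType) (d : nat -> R) (l L beta : R).
Local Notation C := (cplx R).
Hypothesis d0 : d 0%N = 1.
Hypothesis beta0 : 0 < beta.
Hypothesis l0 : 0 < l.
Hypothesis d_ge : forall n, l * beta ^+ n <= d n.
Hypothesis d_le : forall n, d n <= L * beta ^+ n.
Local Notation dC := (dC d).
Local Notation D := (D d).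
Local Notation F := (Fquot d).
Implicit Types (z w : C).
Let geo := geo_dC beta0 l0 d_ge d_le.

Definition coef_const (x : C) : nat -> C := fun n => if n == 0%N then x else 0.

Lemma geo_bound_const x q : 0 <= q -> geo_bound (coef_const x) (modulus x) q.
Proof.
move=> q0; split=> // -[|n]; first by rewrite expr0 mulr1.
by rewrite /coef_const /= modulus0 mulr_ge0 ?modulus_ge0 ?exprn_ge0.
Qed.

Lemma ps_const x w : ps (coef_const x) w = x.
Proof.
apply: ps_unique; rewrite -cvg_shiftS.
rewrite (_ : [sequence _]_n = cst x); first exact: cvg_cst.
apply/funext => n; rewrite /series /= big_nat_recl // expr0 mulr1 /coef_const /=.
by rewrite big1 ?addr0 // => i _; rewrite mul0r.
Qed.

Lemma expands_const_sub x (G : C -> C) z0 a : expands G z0 a ->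
  expands (fun z => x - G z) z0 (fun n => coef_const x n + - a n).
Proof.
move=> [M [q [e [ab e0 H]]]]; have q0 : 0 <= q by case: ab.
have cb := geo_bound_const x q0; have nb := geo_boundN ab.
exists (modulus x + M), q, e; split=> //; first exact: geo_boundD.
move=> z /H[qz GE]; split=> //.
by rewrite (psD cb nb qz) (psN ab qz) ps_const GE.
Qed.

Lemma expands_ps (a : nat -> C) M q (z0 : C) : geo_bound a M q -> q * modulus z0 < 1 ->
  expands (ps a) z0 (reexpand a z0).
Proof.
move=> ab qz0; have [rb H] := ps_reexpand ab qz0; have q0 : 0 <= q by case: ab.
have s0 : 0 <= slope_ratio q z0 by rewrite divr_ge0 // subr_ge0 ltW.
pose e := Num.min ((1 - q * modulus z0) / (q + 1)) (slope_ratio q z0 + 1)^-1.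
have q1 : 0 < q + 1 by rewrite ltr_wpDl.
have s1 : 0 < slope_ratio q z0 + 1 by rewrite ltr_wpDl.
exists (M / (1 - q * modulus z0)), (slope_ratio q z0), e; split; first exact: rb.
  by rewrite lt_min invr_gt0 s1 divr_gt0 ?subr_gt0.
move=> z {rb}; rewrite lt_min (ltr_pdivlMr _ _ q1) => /andP[h1 h2].
have m0 := modulus_ge0 (z - z0).
have sz : slope_ratio q z0 * modulus (z - z0) < 1.
  have : modulus (z - z0) * (slope_ratio q z0 + 1) < 1.
    by rewrite -ltr_pdivlMr // mul1r.
  by nra.
split; first exact: sz.
apply: H sz.
have := ler_modulusD (z - z0) z0; rewrite subrK => tri.
have := ler_wpM2l q0 tri; nra.
Qed.

Lemma D_expands (z0 : C) : beta * modulus z0 < 1 -> expands D z0 (reexpand dC z0).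
Proof. exact: expands_ps geo. Qed.

Lemma reexpand0 (z0 : C) : beta * modulus z0 < 1 -> reexpand dC z0 0%N = D z0.
Proof. by move=> bz; rewrite -(expands_at (D_expands bz)). Qed.

Lemma F_analytic (z0 : C) : beta * modulus z0 < 1 -> D z0 != 2 -> analytic_at F z0.
Proof.
move=> bz D2; exists (ps_quot (reexpand dC z0)
  (fun n => coef_const 2 n + - reexpand dC z0 n)); apply/expandsP.
apply: expands_quot (D_expands bz) (expands_const_sub 2 (D_expands bz)) _.
by rewrite /coef_const /= reexpand0 // subr_eq0 eq_sym.
Qed.

(** A sequence with the same Cauchy product as the formal quotient is equal to
    it, so F has the expected expansion at the origin. *)
Lemma F_power_series (c : nat -> C) :
  (forall n, cauchy_prod c (fun n => coef_const 2 n - dC n) n = dC n) ->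
  has_power_series F 0 c.
Proof.
move=> cE; apply/expandsP; pose b n := coef_const 2 n + - dC n.
have b0 : b 0%N = 1.
  by rewrite /b /coef_const /= /dC d0 -(rmorph1 (real_complex R)) -(rmorph_nat (real_complex R)) -rmorphB; congr _%:C; lra.
have bn0 : b 0%N != 0 by rewrite b0 oner_eq0.
have z0b : beta * modulus (0 : C) < 1 by rewrite modulus0 mulr0.
have De : expands D 0 dC.
  exists L, beta, beta^-1; split; [exact: geo|by rewrite invr_gt0|].
  move=> z; rewrite subr0 => zb; split=> //.
  by rewrite mulrC -ltr_pdivlMr // mul1r.
have := expands_quot De (expands_const_sub 2 De) bn0.
suff -> : c = ps_quot dC b by [].
apply/funext => n; elim/ltn_ind: n => n IH.
have := cauchy_prod_quot dC n bn0; rewrite -(cE n) /cauchy_prod.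
rewrite !big_ord_recr /= subnn -/(b 0%N) b0 !mulr1.
rewrite (eq_bigr (fun i : 'I_n => c i * b (n - i)%N)).
  by move=> /addrI.
by move=> i _; rewrite IH.
Qed.

Variable p : R.
Hypothesis p0 : 0 < p.
Hypothesis p1 : beta * p < 1.
Hypothesis Dp : D p%:C = 2.
Hypothesis D_uniq : forall z, beta * modulus z < 1 -> D z = 2 -> z = p%:C.

Lemma modulus_p : modulus (p%:C : C) = p.
Proof. by rewrite modulus_real gtr0_norm. Qed.

(** The slope of D at p has nonnegative coefficients and a positive constant
    term, so D takes the value 2 with multiplicity one. *)
Lemma slope_at_p_neq0 : ps (ps_slope dC p%:C) p%:C != 0.
Proof.
have bp : beta * modulus (p%:C : C) < 1 by rewrite modulus_p.
have /choice[q hq] : forall n, exists q : R, [/\ 0 <= q, (n = 0%N -> 0 < q) &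
    ps_slope dC p%:C n * p%:C ^+ n = q%:C].
  move=> n; have [s [sE _ sN]] := @ps_real R (fun j => dC (j + n.+1)) p%:C
    (fun j => d (j + n.+1)%N * p ^+ j) _ _ (geo_bound_shift n.+1 geo) bp
    (fun j => ltac:(by rewrite /dC -rmorphXn -rmorphM))
    (fun j => ltac:(by rewrite mulr_ge0 ?exprn_ge0 // ltW // (d_gt0 beta0 l0 d_ge))).
  exists (s * p ^+ n); rewrite /ps_slope sE -rmorphXn -rmorphM; split=> //.
    by rewrite mulr_ge0 ?exprn_ge0 ?(ltW p0) //; have := sN 0%N; rewrite big_ord0.
  move=> ->; rewrite expr0 mulr1; apply: lt_le_trans (sN 1%N).
  by rewrite big_ord1 mulr_gt0 ?exprn_gt0 // (d_gt0 beta0 l0 d_ge).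
have [s [-> _ sN]] := @ps_real R _ p%:C q _ _ (geo_bound_slope geo bp) bp
  (fun n => let: And3 _ _ e := hq n in e) (fun n => let: And3 e _ _ := hq n in e).
have [_ /(_ erefl) q0 _] := hq 0%N.
have s0 : 0 < s by apply: lt_le_trans (sN 1%N); rewrite big_ord1.
by rewrite -modulus_eq0 modulus_real normr_eq0 gt_eqF.
Qed.

Lemma F_pole_p : pole_at F 1 p%:C.
Proof.
have bp : beta * modulus (p%:C : C) < 1 by rewrite modulus_p.
pose E := ps (ps_slope dC p%:C); have Eb := geo_bound_slope geo bp.
have Ee := expands_ps Eb bp.
have r0 : reexpand (ps_slope dC p%:C) p%:C 0%N = E p%:C.
  by rewrite -(expands_at Ee).
have c0E : coef_const 0 0%N + - reexpand (ps_slope dC p%:C) p%:C 0%N = - E p%:C.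
  by rewrite /coef_const /= add0r r0.
split=> //; exists (fun z => D z / (0 - E z)); split.
- exists (ps_quot (reexpand dC p%:C)
    (fun n => coef_const 0 n + - reexpand (ps_slope dC p%:C) p%:C n)).
  apply/expandsP; apply: expands_quot (D_expands bp) (expands_const_sub 0 Ee) _.
  by rewrite c0E oppr_eq0 slope_at_p_neq0.
- by rewrite Dp sub0r mulf_neq0 ?pnatr_eq0 // invr_eq0 oppr_eq0 slope_at_p_neq0.
apply/dnear_C; exists ((1 - beta * p) / beta); first by rewrite divr_gt0 ?subr_gt0.
move=> z zp; rewrite ltr_pdivlMr // => h.
have bz : beta * modulus z < 1.
  have := ler_modulusD (z - p%:C) p%:C; rewrite subrK modulus_p => tri.
  by have := ler_wpM2l (ltW beta0) tri; lra.
have DE : D z = 2 + (z - p%:C) * E z by rewrite /D (ps_slopeE geo bp bz) -/(D _) Dp.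
rewrite /F expr1 {2}DE opprD addrA subrr !sub0r mulrC -mulrA -invfM.
by rewrite mulNr mulrC [E z * _]mulrC.
Qed.

Lemma F_meromorphic : meromorphic_on (disk beta^-1) F.
Proof.
move=> z; rewrite /disk /= normCE ltcR => zb.
have bz : beta * modulus z < 1 by rewrite mulrC -ltr_pdivlMr // mul1r.
have [D2|D2] := eqVneq (D z) 2; last by left; exact: F_analytic.
by right; exists 1%N; rewrite (D_uniq bz D2); exact: F_pole_p.
Qed.

Lemma F_only_pole m z : disk beta^-1 z -> pole_at F m z -> z = p%:C.
Proof.
rewrite /disk /= normCE ltcR => zb pz.
have bz : beta * modulus z < 1 by rewrite mulrC -ltr_pdivlMr // mul1r.
apply: (D_uniq bz); apply/eqP; apply: contrapT => /negP D2.
exact: (analytic_not_pole (F_analytic bz D2) pz).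
Qed.

Hypothesis D_unbounded : forall w : C, beta * modulus w = 1 -> forall e : R, 0 < e ->
  exists w' : C, [/\ w' != w, beta * modulus w' = 1, modulus (w' - w) < e &
    forall B t : R, 0 < t -> exists rho : R,
      [/\ 1 - t < rho, 0 < rho, rho < 1 & B < modulus (D (rho%:C * w'))]].

(** Near [w], the modulus of an analytic function other than 0 is at least
    c |z - w|^m.  This prevents G + 1 from extending F + 1 = 2 / (2 - D), which
    comes arbitrarily close to 0 on a radius ending near [w], but not at [w]. *)
Lemma F_natural_boundary : natural_boundary beta^-1 F.
Proof.
move=> w; rewrite /circle /= normCE => /complexI wb [G [[a /expandsP Ga]
  /near_C[e e0 GF]]].
have bw : beta * modulus w = 1 by rewrite wb divff // gt_eqF.
pose a' : nat -> C := fun n => coef_const (-1) n + - a n.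
have He : expands (fun z => - 1 - G z) w a' := expands_const_sub (-1) Ga.
have F1 z : D z != 2 -> - 1 - F z = - (2 / (2 - D z)).
  move=> D2; have D2' : 2 - D z != 0 by rewrite subr_eq0 eq_sym.
  rewrite /F -[X in - X - _](divff D2') -mulNr -mulrBl -mulNr; congr (_ / _).
  by rewrite opprB addrAC subrr sub0r.
have inside (rho : R) w' : 0 < rho -> rho < 1 -> beta * modulus w' = 1 ->
    beta * modulus (rho%:C * w' : C) < 1 /\ disk beta^-1 (rho%:C * w' : C).
  move=> r0 r1 bw'; have bz : beta * modulus (rho%:C * w' : C) < 1.
    by rewrite modulusM modulus_real gtr0_norm // mulrCA bw' mulr1.
  by split=> //; rewrite /disk /= normCE ltcR -div1r ltr_pdivlMr // mulrC.
(* the function 2 / (2 - D) does not vanish, so G is not identically -1 *)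
have [ex|nex] := pselect (exists n, a' n != 0); last first.
  have [M [q [e' [_ e'0 He']]]] := He.
  pose t := Num.min e e' * beta / 2; have e1 : 0 < Num.min e e' by rewrite lt_min e0.
  pose rho := Num.max (1 - t) (1 / 2).
  have t0 : 0 < t by rewrite divr_gt0 ?mulr_gt0.
  have rho0 : 0 < rho by rewrite lt_max; apply/orP; right; rewrite divr_gt0.
  have rho1 : rho < 1 by rewrite gt_max ltrBlDr ltrDl t0 /= ltr_pdivrMr // mul1r ltr1n.
  have [bz dz] := inside rho w rho0 rho1 bw.
  have near_w : modulus (rho%:C * w - w) < Num.min e e'.
    rewrite -{2}[w]mul1r -mulrBl modulusM -(rmorph1 (real_complex R)) -rmorphB.
    rewrite modulus_real wb ltr_pdivrMr // distrC ger0_norm ?subr_ge0 ?(ltW rho1) //.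
    apply: (@le_lt_trans _ _ t); first by rewrite lerBlDr -lerBlDl le_max lexx.
    by rewrite /t ltr_pdivrMr // ltr_pMr ?mulr_gt0 // ltr1n.
  move: near_w; rewrite lt_min => /andP[ze ze'].
  have [qz /=] := He' _ ze'; rewrite (GF _ ze dz) (_ : a' = coef_const 0); last first.
    apply/funext => n; rewrite (_ : coef_const 0 n = 0) ?/coef_const; last by case: (n).
    by apply/eqP; apply: contrapT => /negP an; apply: nex; exists n.
  rewrite ps_const; have [D2|D2] := eqVneq (D (rho%:C * w)) 2.
    by rewrite /F D2 subrr invr0 mulr0 subr0 => /eqP; rewrite oppr_eq0 oner_eq0.
  rewrite F1 // => /eqP; rewrite oppr_eq0 mulf_eq0 invr_eq0 subr_eq0 pnatr_eq0 /=.
  by rewrite eq_sym (negPf D2).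
have [m [c [e' [c0 e'0 low]]]] := expands_order He ex.
have e1 : 0 < Num.min e e' / 2 by rewrite divr_gt0 // lt_min e0.
have [w' [w'w bw' w'e unb]] := D_unbounded bw e1.
set s := modulus (w' - w) in w'e; have s0 : 0 < s by rewrite modulus_gt0 subr_eq0.
have k0 : 0 < c * (s / 2) ^+ m by rewrite mulr_gt0 // exprn_gt0 // divr_gt0.
have [|rho [rt rho0 rho1 DB]] := unb (2 + 2 / (c * (s / 2) ^+ m)) (s * beta / 2).
  by rewrite divr_gt0 // mulr_gt0.
have [bz dz] := inside rho w' rho0 rho1 bw'; set z := _ * w' in DB bz dz.
have zw' : modulus (z - w') < s / 2.
  rewrite /z -{2}[w']mul1r -mulrBl modulusM -(rmorph1 (real_complex R)) -rmorphB.
  rewrite modulus_real distrC ger0_norm ?subr_ge0 ?(ltW rho1) //.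
  rewrite -(ltr_pM2l beta0) mulrCA bw' mulr1 mulrA [beta * s]mulrC.
  by rewrite ltrBlDr -ltrBlDl.
have tri1 := ler_modulusD (z - w') (w' - w); rewrite addrA subrK -/s in tri1.
have tri2 := ler_modulusB (z - w) (z - w').
have zE (x y v : C) : x - y - (x - v) = v - y by ring.
rewrite zE -/s in tri2.
have zs : s / 2 <= modulus (z - w) by lra.
have zmin : modulus (z - w) < Num.min e e' by lra.
move: zmin; rewrite lt_min => /andP[ze ze'].
have := low _ ze'; rewrite /= (GF _ ze dz).
have Dbig : 2 / (c * (s / 2) ^+ m) < modulus (2 - D z).
  have m2 : modulus (2 : C) = 2.
    by rewrite -(rmorph_nat (real_complex R)) modulus_real ger0_norm.
  have := ler_modulusD (D z - 2) 2; rewrite subrK m2 modulusB; lra.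
have D2 : D z != 2.
  apply: contraTneq Dbig => ->; rewrite subrr modulus0 -leNgt divr_ge0 //.
  exact: ltW.
rewrite F1 // modulusN modulusM modulusV.
have -> : modulus (2 : C) = 2.
  by rewrite -(rmorph_nat (real_complex R)) modulus_real ger0_norm.
have Dpos : 0 < modulus (2 - D z) by apply: lt_trans Dbig; rewrite divr_gt0.
rewrite ler_pdivlMr // => h.
have hs : c * (s / 2) ^+ m * modulus (2 - D z) <= 2.
  apply: le_trans h; rewrite ler_wpM2r ?(ltW Dpos) // ler_wpM2l ?(ltW c0) //.
  by apply: lerXn2r => //; rewrite nnegrE ?modulus_ge0 // divr_ge0 // ltW.
by move: Dbig; rewrite ltr_pdivrMr // mulrC ltNge hs.
Qed.

End QuotientPoles.

(** * Growth of renewal sequences *)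

Section Growth.
Variable R : realType.

Lemma cvg_root_const (x : R) : 0 < x -> (fun n : nat => x `^ n%:R^-1) @ \oo --> (1 : R).
Proof.
move=> x0; rewrite (_ : (fun n => _) = fun n : nat => expR (n%:R^-1 * ln x)).
  have h : (fun n : nat => n%:R^-1 * ln x) @ \oo --> (0 * ln x : R).
    apply: cvgM; last exact: cvg_cst.
    by rewrite -cvg_shiftS; exact: cvg_harmonic.
  rewrite -[X in _ --> X](@expR0 R) -(mul0r (ln x)).
  exact: (cvg_comp _ _ h (@continuous_expR R _)).
by apply/funext => n; rewrite /powR gt_eqF.
Qed.

Lemma cvg_root_geometric (e : nat -> R) (A k K : R) : 0 < A -> 0 < k ->
  (forall n, (0 < n)%N -> k * A ^+ n <= e n <= K * A ^+ n) ->
  (fun n : nat => e n `^ n%:R^-1) @ \oo --> A.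
Proof.
move=> A0 k0 eb; have K0 : 0 < K.
  have /andP[h1 h2] := eb 1%N isT.
  have : 0 < K * A ^+ 1 by apply: lt_le_trans h2; apply: lt_le_trans h1; rewrite mulr_gt0.
  by rewrite expr1 pmulr_lgt0.
have root x n : 0 < x -> (0 < n)%N -> (x * A ^+ n) `^ n%:R^-1 = x `^ n%:R^-1 * A.
  move=> x0 n0; rewrite powRM ?(ltW x0) ?exprn_ge0 ?(ltW A0) //; congr (_ * _).
  rewrite -powR_mulrn ?(ltW A0) // -powRrM mulfV ?pnatr_eq0 ?gtn_eqF //.
  by rewrite powRr1 // ltW.
apply: (@squeeze_cvgr _ _ _ _ (fun n : nat => k `^ n%:R^-1 * A)
                              (fun n : nat => K `^ n%:R^-1 * A)).
- near=> n; have n0 : (0 < n)%N by near: n; exists 1%N.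
  have /andP[h1 h2] := eb n n0; rewrite -!root //.
  have e0 : 0 <= e n by apply: le_trans h1; rewrite mulr_ge0 ?exprn_ge0 ?ltW.
  by rewrite !ge0_ler_powR ?nnegrE ?invr_ge0 ?mulr_ge0 ?exprn_ge0 ?(ltW k0) ?(ltW K0) ?(ltW A0).
- rewrite -[X in _ --> X]mul1r; apply: cvgM; last exact: cvg_cst.
  exact: cvg_root_const.
- rewrite -[X in _ --> X]mul1r; apply: cvgM; last exact: cvg_cst.
  exact: cvg_root_const.
Unshelve. all: by end_near. Qed.

End Growth.

Section Renewal.
Variables (R : realType) (d c : nat -> R) (L beta p : R).
Hypothesis d0 : d 0%N = 1.
Hypothesis d_pos : forall n, 0 < d n.
Hypothesis d_le : forall n, d n <= L * beta ^+ n.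
Hypothesis beta0 : 0 < beta.
Hypothesis p0 : 0 < p.
Hypothesis p1 : beta * p < 1.
Hypothesis sum2 : series (fun n => d n * p ^+ n) @ \oo --> (2 : R).
Hypothesis sum_le2 : forall N, \sum_(i < N) d i * p ^+ i <= 2.
Hypothesis c0 : c 0%N = 1.
Hypothesis cS : forall n, c n.+1 = \sum_(j < n.+1) c j * d (n.+1 - j)%N.

Let q n := d n.+1 * p ^+ n.+1.
Let y n := c n * p ^+ n.
Let Q n := 1 - \sum_(i < n) q i.

Let q_gt0 n : 0 < q n.
Proof. by rewrite mulr_gt0 ?exprn_gt0. Qed.

Let sum_q n : 1 + \sum_(i < n) q i = \sum_(i < n.+1) d i * p ^+ i.
Proof. by rewrite big_ord_recl d0 expr0 mulr1. Qed.

Let Q_ge0 n : 0 <= Q n.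
Proof. by rewrite /Q subr_ge0 -(lerD2l 1) sum_q (le_trans (sum_le2 _)). Qed.

Let yS n : y n.+1 = \sum_(j < n.+1) y j * q (n - j)%N.
Proof.
rewrite /y cS mulr_suml; apply: eq_bigr => j _.
have jn : (j <= n)%N by rewrite -ltnS.
have -> : p ^+ n.+1 = p ^+ j * p ^+ (n.+1 - j) by rewrite -exprD subnKC // leqW.
by rewrite /q -subSn // mulrACA.
Qed.

Let y_ge0 n : 0 <= y n.
Proof.
elim/ltn_ind: n => -[_|n IH]; first by rewrite /y c0 mul1r.
by rewrite yS; apply: sumr_ge0 => j _; rewrite mulr_ge0 ?(ltW (q_gt0 _)) // IH.
Qed.

Let Q_le1 n : Q n <= 1.
Proof. by rewrite /Q gerBl; apply: sumr_ge0 => i _; exact: ltW. Qed.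

(** The last renewal before time n happened somewhere: summing the probability
    of each position gives 1. *)
Let y_Q n : \sum_(j < n.+1) y j * Q (n - j)%N = 1.
Proof.
elim: n => [|n IH].
  by rewrite big_ord1 /y c0 /Q subn0 big_ord0 subr0 expr0 !mulr1.
rewrite big_ord_recr /= subnn {2}/Q big_ord0 subr0 mulr1 -[RHS]IH yS -big_split /=.
apply: eq_bigr => j _; have jn : (j <= n)%N by rewrite -ltnS.
by rewrite subSn // /Q big_ord_recr /=; ring.
Qed.

Let y_le1 n : y n <= 1.
Proof.
rewrite -(y_Q n) big_ord_recr /= subnn {2}/Q big_ord0 subr0 mulr1 lerDr.
by apply: sumr_ge0 => j _; rewrite mulr_ge0.
Qed.

Let Q_geo n : Q n <= L / (1 - beta * p) * (beta * p) ^+ n.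
Proof.
have L0 : 0 <= L.
  by have := d_le 0; rewrite d0 expr0 mulr1; apply: le_trans.
have t0 : 0 <= beta * p by rewrite mulr_ge0 // ltW.
have t1 : 0 < 1 - beta * p by rewrite subr_gt0.
have -> : Q n = 2 - \sum_(i < n.+1) d i * p ^+ i.
  by rewrite -sum_q /Q; ring.
rewrite lerBlDr -[leLHS](cvg_lim _ sum2) //.
apply: limr_le; first by apply/cvg_ex; exists 2.
near=> N; have nN : (n.+1 <= N)%N by near: N; exists n.+1.
rewrite /series /= (big_cat_nat _ nN) //= big_mkord addrC lerD2r.
apply: (@le_trans _ _ (\sum_(n.+1 <= i < N) L * (beta * p) ^+ i)).
  by apply: ler_sum => i _; rewrite exprMn mulrA ler_wpM2r ?exprn_ge0 // ltW.
rewrite -mulr_sumr -mulrA ler_wpM2l // [leRHS]mulrC ler_pdivlMr //.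
rewrite -{1}(subnKC nN) geometric_partial_tail geometric_seriesE; last first.
  by rewrite lt_eqF.
rewrite /= divfK ?lt0r_neq0 // exprSr.
apply: (@le_trans _ _ ((beta * p) ^+ n * (beta * p))).
  apply: ler_piMr; last by rewrite gerBl exprn_ge0.
  by apply: mulr_ge0 => //; exact: exprn_ge0.
by rewrite ler_piMr ?exprn_ge0 // ltW.
Unshelve. all: by end_near. Qed.

(** The numbers [y n] are the probabilities of renewal at time n, for a waiting
    time of law [q].  As long waits are unlikely, a renewal happens with
    probability at least 1/2 in a window of fixed length, and after a renewal
    each time of the window is reached by single steps with a probability bounded
    below. *)
Lemma renewal_lower : exists2 k, 0 < k & forall n, k <= y n.
Proof.
have L0 : 0 <= L.
  by have := d_le 0; rewrite d0 expr0 mulr1; apply: le_trans.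
have [t [K [t0 t1 K0 QK]]] : exists t K, [/\ 0 <= t, 0 < 1 - t, 0 <= K &
    forall m, Q m <= K * t ^+ m].
  exists (beta * p), (L / (1 - beta * p)); split; last exact: Q_geo.
  - by rewrite mulr_ge0 // ltW.
  - by rewrite subr_gt0.
  - by rewrite divr_ge0 // subr_ge0 ltW.
(* beyond the lag J the waiting-time tails sum to at most 1/2 *)
have [J HJ] : exists J, K / (1 - t) * t ^+ J <= 1 / 2.
  have ct : `|t| < 1 by rewrite ger0_norm // -subr_gt0.
  have /cvgrPdist_le/(_ (1/2)) := cvg_geometric (K / (1 - t)) ct.
  rewrite divr_gt0 // => /(_ isT)[J _ HJ]; exists J.
  have := HJ J (leqnn _); rewrite /= sub0r normrN ger0_norm //.
  by rewrite mulr_ge0 ?exprn_ge0 // divr_ge0 // ltW.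
have q1 : q 0%N <= 1.
  by have := Q_ge0 1; rewrite /Q big_ord1 subr_ge0.
have yq n m : (m <= n)%N -> q 0%N ^+ m * y (n - m)%N <= y n.
  elim: m => [|m IH] mn; first by rewrite expr0 mul1r subn0.
  apply: le_trans (IH (ltnW mn)); rewrite exprSr -mulrA ler_wpM2l ?exprn_ge0 ?(ltW (q_gt0 _)) //.
  rewrite -(subnSK mn) yS big_ord_recr /= subnn mulrC lerDr.
  by apply: sumr_ge0 => j _; rewrite mulr_ge0 // ltW.
exists (q 0%N ^+ J / (2 * J.+1%:R)).
  by rewrite divr_gt0 ?exprn_gt0 // mulr_gt0.
move=> n; rewrite ler_pdivrMr ?mulr_gt0 //.
have qJ0 : 0 <= q 0%N ^+ J by rewrite exprn_ge0 // ltW.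
have rev_sum : \sum_(m < n.+1) y (n - m)%N * Q m = 1.
  rewrite -(y_Q n) (reindex_inj rev_ord_inj) /=; apply: eq_bigr => j _.
  by rewrite subSS subKn // -ltnS.
have split_bound : 1 / 2 <= \sum_(m < n.+1 | (m < J)%N) y (n - m)%N.
  have far : \sum_(m < n.+1 | ~~ (m < J)%N) y (n - m)%N * Q m <= 1 / 2.
    apply: le_trans HJ.
    apply: (@le_trans _ _ (\sum_(m < n.+1 | ~~ (m < J)%N) K * t ^+ m)).
      apply: ler_sum => m _; rewrite -[leRHS]mul1r.
      apply: ler_pM; [exact: y_ge0|exact: Q_ge0|exact: y_le1|exact: QK].
    rewrite -mulr_sumr mulrAC -mulrA ler_wpM2l // ler_pdivlMr //.
    rewrite -(big_mkord (fun m => ~~ (m < J)%N) (fun m => t ^+ m)).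
    under eq_bigl do rewrite -leqNgt.
    have [Jn|nJ] := leqP J n.+1; last first.
      rewrite big_nat_cond big_pred0 ?mul0r ?exprn_ge0 // => m.
      by apply/negP => /andP[/andP[_ mn] Jm]; move: (leq_trans nJ Jm); rewrite ltnNge ltnW.
    rewrite (big_cat_nat (n := J)) //= big_nat_cond big_pred0 => [|m]; last first.
      by apply/negP => /andP[/andP[_ mJ]]; rewrite leqNgt mJ.
    rewrite Monoid.mul1m big_nat_cond (eq_bigl (fun m => (J <= m < n.+1)%N)) => [|m]; last first.
      by case: (J <= m)%N; rewrite ?andbF ?andbT.
    rewrite -big_nat -{1}(subnKC Jn) geometric_partial_tail geometric_seriesE; last first.
      by rewrite lt_eqF // -subr_gt0.
    rewrite /= divfK ?lt0r_neq0 //.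
    by rewrite ler_piMr ?exprn_ge0 // gerBl exprn_ge0.
  move: rev_sum; rewrite (bigID (fun m : 'I_n.+1 => (m < J)%N)) /= => tot.
  have near_le : \sum_(m < n.+1 | (m < J)%N) y (n - m)%N * Q m <=
      \sum_(m < n.+1 | (m < J)%N) y (n - m)%N.
    by apply: ler_sum => m _; rewrite ler_piMr ?Q_le1 ?y_ge0.
  by lra.
have : q 0%N ^+ J * \sum_(m < n.+1 | (m < J)%N) y (n - m)%N <= J.+1%:R * y n.
  rewrite mulr_sumr.
  apply: (@le_trans _ _ (\sum_(m < n.+1 | (m < J)%N) y n)).
    apply: ler_sum => m mJ; have mn : (m <= n)%N by rewrite -ltnS.
    apply: le_trans (yq n m mn); rewrite ler_wpM2r //.
    by rewrite ler_wiXn2l ?(ltW (q_gt0 _)) // ltnW.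
  apply: (@le_trans _ _ (J%:R * y n)); last by rewrite ler_wpM2r // ler_nat.
  have [Jn|nJ] := leqP J n.+1.
    by rewrite (big_ord_narrow Jn) sumr_const card_ord mulr_natl.
  apply: (@le_trans _ _ (\sum_(m < n.+1) y n)).
    by rewrite [leRHS](bigID (fun m : 'I_n.+1 => (m < J)%N)) /= lerDl sumr_ge0.
  by rewrite sumr_const card_ord -[leLHS]mulr_natl ler_wpM2r // ler_nat ltnW.
have := ler_wpM2l qJ0 split_bound.
move: (\sum_(m < n.+1 | _) _) (q 0%N ^+ J) => S a h1 h2.
by rewrite mulrCA mulrA; lra.
Qed.

Lemma renewal_upper n : y n <= 1.
Proof. exact: y_le1. Qed.

End Renewal.

(** * The unit circle and the degree function *)

Section CircleFunction.
Variable R : realType.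
Local Notation C := (cplx R).
Implicit Types (z w : C) (s t : R).

Definition ei t : C := (cos t +i* sin t)%C.

Lemma eiD s t : ei (s + t) = ei s * ei t.
Proof.
rewrite /ei cosD sinD; apply/eqP; rewrite eq_complex /=; apply/andP; split; apply/eqP; ring.
Qed.

Lemma ei0 : ei 0 = 1.
Proof. by rewrite /ei cos0 sin0. Qed.

Lemma eiX t n : ei t ^+ n = ei (n%:R * t).
Proof.
elim: n => [|n IH]; first by rewrite expr0 mul0r ei0.
by rewrite exprS IH -eiD -[in RHS]natr1 mulrDl mul1r addrC.
Qed.

Lemma ei2pi : ei (pi *+ 2) = 1.
Proof. by rewrite /ei cos2pi sin2pi. Qed.

Lemma modulus_ei t : modulus (ei t) = 1.
Proof. by rewrite /modulus /= cos2Dsin2 sqrtr1. Qed.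

Lemma ei_neq0 t : ei t != 0.
Proof. by rewrite -modulus_eq0 modulus_ei oner_eq0. Qed.

Lemma conj_ei t : ((ei t)^*)%C = ei (- t).
Proof. by rewrite /ei cosN sinN. Qed.

Lemma eiV t : (ei t)^-1 = ei (- t).
Proof.
apply: (mulfI (ei_neq0 t)); rewrite divff ?ei_neq0 // -eiD subrr; exact/esym/ei0.
Qed.

Lemma ei_periodic t (n : nat) : ei (t + n%:R * (pi *+ 2)) = ei t.
Proof. by rewrite eiD -eiX ei2pi expr1n mulr1. Qed.

Lemma modulus_ei_sub1 t : modulus (ei t - 1) ^+ 2 = 2 * (1 - cos t).
Proof.
rewrite modulus_sqr /= subr0; have := cos2Dsin2 t; nra.
Qed.

Lemma sin_le t : 0 <= t -> sin t <= t.
Proof.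
move=> t0; rewrite -subr_ge0.
have : sin t - sin 0 <= t - 0 -> 0 <= t - sin t by rewrite sin0 !subr0 subr_ge0.
apply; have [->|tn0] := eqVneq t 0; first by rewrite !subrr.
have tgt : 0 < t by rewrite lt_neqAle eq_sym tn0.
have [x _ ->] := @MVT R sin cos 0 t tgt (fun x _ => is_derive_sin x)
   (continuous_subspaceT (@continuous_sin R)).
by rewrite ler_piMl ?subr_ge0 // cos_le1.
Qed.

Lemma norm_sin_le t : `|sin t| <= `|t|.
Proof.
wlog t0 : t / 0 <= t => [H|].
  have [|/ltW t0] := leP 0 t; first exact: H.
  by rewrite -normrN -sinN -[leRHS]normrN H // oppr_ge0.
rewrite [leRHS]ger0_norm // ler_norml sin_le // andbT lerNl.
have [t1|t1] := leP t 1.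
  have : 0 <= sin t; last by move=> h; apply: (@le_trans _ _ 0) => //; rewrite oppr_le0.
  apply: sin_ge0_pi; rewrite t0 /= (le_trans t1) // (le_trans _ (pi_ge2 R)) //.
  by rewrite ler1n.
by apply: le_trans (ltW t1); rewrite lerNl sin_geN1.
Qed.

Lemma ei_Lipschitz s t : modulus (ei s - ei t) <= `|s - t|.
Proof.
have -> : ei s - ei t = ei t * (ei (s - t) - 1).
  by rewrite mulrBr mulr1 -eiD (addrC t) subrK.
rewrite modulusM modulus_ei mul1r; move: (s - t) => x.
rewrite -(ler_pXn2r (n := 2)) ?nnegrE ?modulus_ge0 // modulus_ei_sub1.
have -> : 2 * (1 - cos x) = 4 * sin (x / 2) ^+ 2.
  rewrite {1}[x]splitr -mulr2n cos_mulr2n; have := cos2Dsin2 (x / 2); nra.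
have h : sin (x / 2) ^+ 2 <= (x / 2) ^+ 2.
  rewrite -[leLHS]real_normK ?num_real // -[leRHS]real_normK ?num_real //.
  by rewrite ler_pXn2r ?nnegrE // norm_sin_le.
by rewrite real_normK ?num_real //; lra.
Qed.

Lemma unit_ei z : modulus z = 1 -> exists2 t, 0 <= t < pi *+ 2 & z = ei t.
Proof.
move=> z1; have := modulus_sqr z; rewrite z1 expr1n.
case: z {z1} => x y /= xy; have x1 : -1 <= x <= 1.
  by rewrite -ler_norml -(ler_pXn2r (n := 2)) ?nnegrE // expr1n real_normK ?num_real //; nra.
have pi0 := pi_gt0 R.
have sinE : sin (acos x) = `|y|.
  by rewrite sin_acos // (_ : 1 - x ^+ 2 = y ^+ 2) ?sqrtr_sqr //; lra.
have cosE : cos (acos x) = x by rewrite acosK // in_itv.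
have [y0|y0] := leP 0 y.
  exists (acos x); first by rewrite acos_ge0 //= (le_lt_trans (acos_lepi x1)) // mulr2n ltrDl.
  by rewrite /ei cosE sinE ger0_norm.
have a0 : 0 < acos x.
  rewrite lt_neqAle acos_ge0 // andbT; apply: contraTneq y0 => a0.
  by move: sinE; rewrite -a0 sin0 => /esym/normr0_eq0 ->; rewrite ltxx.
exists (pi *+ 2 - acos x).
  by rewrite subr_ge0 gtrBl a0 andbT (le_trans (acos_lepi x1)) // mulr2n lerDl ltW.
rewrite eiD ei2pi mul1r /ei cosN sinN cosE sinE ltr0_norm // opprK //.
Qed.

(** Extends [psi] from the lattice to all complex numbers. *)
Definition PsiC z : R := Num.max 0 (Num.max (- complex.Re z) (- complex.Im z)).

Definition rayC (l : 'I_3) : C :=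
  match val l with 0%N => (-1 -i* 1)%C | 1%N => 1 | _ => 'i%C end.

(** The degree of the monomial map of the multiplication by z, extended from
    Gaussian integers to all complex numbers. *)
Definition toric_degree z : R := \sum_l PsiC (z * rayC l).

Lemma PsiC_ge0 z : 0 <= PsiC z.
Proof. by rewrite le_max lexx. Qed.

Lemma PsiC_homog (x : R) z : 0 <= x -> PsiC (x%:C * z) = x * PsiC z.
Proof.
move=> x0; case: z => a b; rewrite /PsiC /= !mul0r subr0 addr0 -!mulrN.
by rewrite !maxr_pMr // mulr0.
Qed.

Lemma PsiC_Lipschitz z w : PsiC z <= PsiC w + modulus (z - w).
Proof.
have h1 := Re_le_modulus (w - z); have h2 := Im_le_modulus (w - z).
rewrite modulusB (le_trans _ (lexx _)) //; move: h1 h2; rewrite ReB ImB !ler_norml.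
move=> /andP[_ h1] /andP[_ h2]; have m0 := modulus_ge0 (w - z).
have w0 := PsiC_ge0 w.
have wr : - complex.Re w <= PsiC w by rewrite /PsiC !le_max lexx /= orbT.
have wi : - complex.Im w <= PsiC w by rewrite /PsiC !le_max lexx /= !orbT.
rewrite {1}/PsiC !ge_max; apply/and3P; split; lra.
Qed.

Lemma sum3 (F : 'I_3 -> R) : \sum_l F l = F ord0 + F (inord 1) + F (inord 2).
Proof.
rewrite !big_ord_recr big_ord0 /= add0r.
by congr (F _ + F _ + F _); apply: val_inj; rewrite /= ?inordK.
Qed.

Lemma rayCE : [/\ rayC ord0 = (-1 -i* 1)%C, rayC (inord 1) = 1 & rayC (inord 2) = 'i%C].
Proof. by rewrite /rayC /= !inordK. Qed.

Lemma modulus_rayC l : modulus (rayC l) <= 2.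
Proof.
have [r0 r1 r2] := rayCE; elim/forall_ord3: l; rewrite ?r0 ?r1 ?r2.
- apply: le_trans (modulus_le_ReIm _) _; rewrite /= !normrN1 ?normr1.
  by rewrite -mulr2n.
- by rewrite modulus1 ler1n.
- apply: le_trans (modulus_le_ReIm _) _; rewrite /= normr0 normr1 add0r ler1n //.
Qed.

Lemma toric_degree_Lipschitz z w : toric_degree z <= toric_degree w + 6 * modulus (z - w).
Proof.
have -> : toric_degree w + 6 * modulus (z - w) =
    \sum_(l < 3) (PsiC (w * rayC l) + 2 * modulus (z - w)).
  by rewrite /toric_degree big_split /= sumr_const card_ord -mulr_natr; lra.
apply: ler_sum => l _; apply: le_trans (PsiC_Lipschitz _ (w * rayC l)) _.
rewrite lerD2l -mulrBl modulusM mulrC ler_wpM2r ?modulus_ge0 //.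
exact: modulus_rayC.
Qed.

Lemma norm_toric_degree_sub z w : `|toric_degree z - toric_degree w| <= 6 * modulus (z - w).
Proof.
have h1 := toric_degree_Lipschitz z w; have h2 := toric_degree_Lipschitz w z.
by rewrite modulusB in h2; rewrite ler_norml; apply/andP; split; rewrite ?(modulusB z); move: h1 h2; rewrite ?(modulusB z); lra.
Qed.

Lemma toric_degree_ge0 z : 0 <= toric_degree z.
Proof. by apply: sumr_ge0 => l _; exact: PsiC_ge0. Qed.

Lemma toric_degree0 : toric_degree 0 = 0.
Proof. by apply: big1 => l _; rewrite mul0r /PsiC /= oppr0 !maxxx. Qed.

Lemma toric_degree_le z : toric_degree z <= 6 * modulus z.
Proof. by have := toric_degree_Lipschitz z 0; rewrite toric_degree0 add0r subr0. Qed.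

Lemma toric_degree_homog (x : R) z : 0 <= x -> toric_degree (x%:C * z) = x * toric_degree z.
Proof.
by move=> x0; rewrite /toric_degree mulr_sumr; apply: eq_bigr => l _; rewrite -mulrA PsiC_homog.
Qed.

Lemma toric_degree1 : toric_degree 1 = 1.
Proof.
have [r0 r1 r2] := rayCE; rewrite /toric_degree sum3 r0 r1 r2 !mul1r /PsiC /=.
by rewrite !(mulr0, mulr1, oppr0, opprK) /Num.max; do ?case: ifP; lra.
Qed.

(** A vector and its multiples by [i] and [-1-i] are not all in the cone where
    [PsiC] vanishes. *)
Lemma toric_degree_ge z : modulus z <= 2 * toric_degree z.
Proof.
have [r0 r1 r2] := rayCE; apply: le_trans (modulus_le_ReIm z) _.
rewrite /toric_degree sum3 r0 r1 r2 mulr1; case: z => x y /=.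
have ge (v : C) : [/\ 0 <= PsiC v, - complex.Re v <= PsiC v & - complex.Im v <= PsiC v].
  by rewrite /PsiC !le_max !lexx !orbT.
have [a1 a2 a3] := ge (x +i* y)%C; have [b1 b2 b3] := ge ((x +i* y)%C * 'i%C).
have [c1 c2 c3] := ge ((x +i* y)%C * (-1 -i* 1)%C).
move: a1 a2 a3 b1 b2 b3 c1 c2 c3 => /=.
move: (PsiC (x +i* y)%C) (PsiC ((x +i* y)%C * 'i%C)) (PsiC ((x +i* y)%C * (-1 -i* 1)%C)).
move=> A B E; rewrite !(mulr0, mulr1, mulrN1, sub0r, addr0, add0r).
by case: (ger0P x) => hx; case: (ger0P y) => hy; lra.
Qed.

(** With toric vectors seen as Gaussian integers, the monomial map acts as the
    multiplication by the conjugate of [mu]. *)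
Definition toC (v : vec) : C := ((v.1)%:~R +i* (v.2)%:~R)%C.

Lemma psi_toC v : (psi v)%:R = PsiC (toC v).
Proof.
have intr_max (a b : int) : (Num.max a b)%:~R = Num.max a%:~R b%:~R :> R.
  have [ab|/ltW ab] := leP a b; first by rewrite !max_r ?ler_int.
  by rewrite !max_l ?ler_int.
rewrite pmulrn /psi reducedE /toric_coord /vmin.
have -> : 0 - Num.min 0 (Num.min v.1 v.2) = Num.max 0 (Num.max (- v.1) (- v.2)) by lia.
by rewrite /PsiC /= !intr_max !mulrNz.
Qed.

Lemma toC_ray l : toC (ray l) = rayC l.
Proof.
by elim/forall_ord3: l; rewrite /toC /ray /rayC /= ?inordK //= ?mulrN1z ?mulr1z ?mulr0z.
Qed.

Lemma toC_act (mu : int[i]) v :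
  toC (act (gauss_mx mu) v) = (gauss_cplx R mu)^*%C * toC v.
Proof.
rewrite act_gauss /toC /gauss_cplx /=; apply/eqP; rewrite eq_complex /=.
by rewrite !intrD !mulrNz !intrM; apply/andP; split; apply/eqP; ring.
Qed.

Lemma toC_orbit (mu : int[i]) m l :
  toC (orbit_ray (gauss_mx mu) m l) = (gauss_cplx R mu)^*%C ^+ m * rayC l.
Proof.
elim: m => [|m IH]; first by rewrite expr0 mul1r toC_ray.
by rewrite /orbit_ray iterS toC_act -/(orbit_ray _ m l) IH exprS mulrA.
Qed.

End CircleFunction.

(** * Fourier coefficients of the degree function on roots of unity *)

Section Sectors.
Variable R : realType.
Implicit Types t : R.
Local Notation P t := (PsiC (ei t)).
Local Notation c := (cos (pi / 4) : R).

Lemma cos_pi4 : [/\ sin (pi / 4) = c, 0 < c & 2 * c ^+ 2 = 1].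
Proof.
have pi0 := pi_gt0 R; have sc : sin (pi / 4) = c.
  rewrite -cosBpihalf -cosN opprB; congr cos; lra.
have c0 : 0 < c by apply: cos_gt0_pihalf; apply/andP; split; lra.
by split=> //; have := cos2Dsin2 (pi / 4 : R); rewrite sc; lra.
Qed.

Lemma PsiC_ei t : P t = Num.max 0 (Num.max (- cos t) (- sin t)).
Proof. by []. Qed.

Lemma PsiC_sector1 t : 0 <= t <= pi / 2 -> P t = 0.
Proof.
move=> /andP[t0 t1]; have pi0 := pi_gt0 R; rewrite PsiC_ei.
have cg : 0 <= cos t by apply: cos_ge0_pihalf; apply/andP; split; lra.
have sg : 0 <= sin t by apply: sin_ge0_pi; apply/andP; split; lra.
by apply: max_l; rewrite ge_max !oppr_le0 cg sg.
Qed.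

Lemma PsiC_sector2 t : pi / 2 <= t <= 5 * (pi / 4) -> P t = - cos t.
Proof.
move=> /andP[t0 t1]; have pi0 := pi_gt0 R; rewrite PsiC_ei.
have [sc c0 _] := cos_pi4.
have cg : 0 <= - cos t.
  by rewrite -sinBpihalf; apply: sin_ge0_pi; apply/andP; split; lra.
have sg : 0 <= sin t - cos t.
  rewrite -(pmulr_lge0 _ c0) mulrBl -{1}[c]/(cos _) -{2}sc -sinB.
  by apply: sin_ge0_pi; apply/andP; split; lra.
by rewrite [Num.max (- _) _]max_l ?max_r //; lra.
Qed.

Lemma PsiC_sector3 t : 5 * (pi / 4) <= t <= pi *+ 2 -> P t = - sin t.
Proof.
rewrite mulr2n => /andP[t0 t1]; have pi0 := pi_gt0 R; rewrite PsiC_ei.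
have [sc c0 _] := cos_pi4.
have sg : 0 <= - sin t.
  have := sin_ge0_pi (x := t - pi); rewrite sinB cospi sinpi mulr0 mulrN1 subr0.
  by apply; apply/andP; split; lra.
have cg : 0 <= cos t - sin t.
  have h2 : 0 <= - sin (t - pi / 4).
    have := sin_ge0_pi (x := t - pi / 4 - pi).
    rewrite [sin (_ - pi)]sinB cospi sinpi mulr0 mulrN1 subr0.
    by apply; apply/andP; split; lra.
  by rewrite -(pmulr_lge0 _ c0); move: h2; rewrite sinB sc; lra.
by rewrite [Num.max (- _) _]max_r ?max_r //; lra.
Qed.

Lemma cos_lt1 t : 0 < t < pi *+ 2 -> cos t < 1.
Proof.
rewrite mulr2n => /andP[t0 t1]; have pi0 := pi_gt0 R.
have half x : 0 < x <= pi -> cos x < 1.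
  move=> /andP[x0 x1]; rewrite -cos0 ltr_cos ?in_itv //= ?lexx ?pi_ge0 //.
  by rewrite ltW.
have [tp|tp] := leP t pi; first by apply: half; rewrite t0.
rewrite -cosN -cosD2pi mulr2n; apply: half; apply/andP; split; lra.
Qed.

End Sectors.

Section Grid.
Variables (R : realType) (M : nat).
Hypothesis M0 : (0 < M)%N.
Local Notation C := (cplx R).
Local Notation N := (8 * M)%N.
Local Notation c := (cos (pi / 4) : R).

(** The grid has 8M points, so that it contains the directions of the rays, which
    are multiples of pi / 4. *)
Definition grid_step : R := pi / (4 * M%:R).
Local Notation h := grid_step.
Local Notation alpha n := (n%:R * h).
Definition zeta : C := ei h.

Lemma grid_size_gt0 : (0 < N)%N. Proof. by rewrite muln_gt0. Qed.

Lemma grid_step_gt0 : 0 < h.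
Proof. by rewrite divr_gt0 ?pi_gt0 // mulr_gt0 // ltr0n. Qed.

Lemma alphaM (n : nat) : alpha (n * M)%N = n%:R * (pi / 4).
Proof.
have m0 : (M%:R : R) != 0 by rewrite pnatr_eq0 -lt0n.
by rewrite natrM /grid_step; field.
Qed.

Lemma alpha_le m n : (m <= n)%N -> alpha m <= alpha n.
Proof. by move=> mn; rewrite ler_pM2r ?grid_step_gt0 // ler_nat. Qed.

Lemma alphaS n : alpha n.+1 = alpha n + h.
Proof. by rewrite -natr1 mulrDl mul1r. Qed.

Lemma alphaN : alpha N = pi *+ 2.
Proof. by rewrite alphaM mulr2n; lra. Qed.

Lemma zetaX n : zeta ^+ n = ei (alpha n).
Proof. exact: eiX. Qed.

Lemma zetaN : zeta ^+ N = 1.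
Proof. by rewrite zetaX alphaN ei2pi. Qed.

Lemma zeta_neq0 : zeta != 0.
Proof. exact: ei_neq0. Qed.

Lemma grid_step_le : h <= pi / 4.
Proof. by have := alpha_le M0; rewrite mul1r -{1}[M]mul1n alphaM mul1r. Qed.

Lemma sin_grid_step_gt0 : 0 < sin h.
Proof.
have := grid_step_le; have := grid_step_gt0; have := pi_gt0 R => pi0 h0 h1.
by apply: sin_gt0_pi; apply/andP; split; lra.
Qed.

Lemma cos_grid_step_ge0 : 0 <= cos h.
Proof.
have := grid_step_le; have := grid_step_gt0; have := pi_gt0 R => pi0 h0 h1.
by apply: cos_ge0_pihalf; apply/andP; split; lra.
Qed.

(** The directions of the rays belong to the grid; their positions on it, and in
    [ray_weight] their lengths, where 2 cos (pi / 4) is the square root of 2. *)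
Definition ray_exp (l : 'I_3) : nat :=
  match val l with 0 => 5 * M | 1 => 0 | _ => 2 * M end%N.

Definition ray_weight (l : 'I_3) : R :=
  match val l with 0%N => 2 * c | _ => 1 end.

Lemma ei_pi2 : ei (pi / 2) = 'i%C :> C.
Proof. by rewrite /ei cos_pihalf sin_pihalf. Qed.

Lemma ei_5pi4 : [/\ cos (5 * (pi / 4)) = - c & sin (5 * (pi / 4)) = - c].
Proof.
have [sc _ _] := cos_pi4 R.
have -> : 5 * (pi / 4) = pi / 4 + pi :> R by lra.
by rewrite cosDpi sinDpi sc.
Qed.

Lemma rayC_polar l : rayC R l = (ray_weight l)%:C * zeta ^+ ray_exp l.
Proof.
have [sc c0 cc] := cos_pi4 R; have [r0 r1 r2] := rayCE R.
elim/forall_ord3: l; rewrite ?r0 ?r1 ?r2 /ray_weight /ray_exp /= ?inordK //=.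
- have [c5 s5] := ei_5pi4; rewrite zetaX alphaM /ei c5 s5.
  apply/eqP; rewrite eq_complex /=; apply/andP; split; apply/eqP; nra.
- by rewrite expr0 mulr1.
- by rewrite zetaX alphaM (_ : 2 * (pi / 4) = pi / 2) ?ei_pi2 ?mul1r //; lra.
Qed.

(** The second difference of [PsiC] sees only the three kinks of [PsiC], which
    lie on the grid. *)
Lemma PsiC_second_difference j : (j < N)%N ->
  PsiC (zeta ^+ j * zeta) + PsiC (zeta ^+ j * zeta^-1)
    - 2 * cos h * PsiC (zeta ^+ j) =
  sin h * \sum_l ray_weight l * (j == ray_exp l)%:R.
Proof.
move=> jN; have h0 := grid_step_gt0; have hp := grid_step_le; have pi0 := pi_gt0 R.
have [sc c0 cc] := cos_pi4 R; have [c5 s5] := ei_5pi4.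
have a2 := alphaM 2; have a5 := alphaM 5; have a8 := alphaN.
have sh := sin_grid_step_gt0; have ch := cos_grid_step_ge0.
rewrite sum3 /ray_weight /ray_exp /= !inordK //= !mul1r zetaX /zeta eiV -!eiD.
case: j jN => [_|j jN].
  rewrite mul0r !add0r; rewrite (@PsiC_sector1 R h); last by apply/andP; split; lra.
  rewrite (@PsiC_sector1 R 0); last by apply/andP; split; lra.
  rewrite PsiC_ei cosN sinN opprK max_r; last by rewrite le_max (ltW sh) orbT.
  rewrite max_r; last lra.
  have -> : (0 == 5 * M)%N = false by lia.
  have -> : (0 == 2 * M)%N = false by lia.
  rewrite eqxx /=; lra.
have eD : alpha j.+1 + h = alpha j.+2 by rewrite -alphaS.
have eB : alpha j.+1 - h = alpha j by rewrite alphaS addrK.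
have cD : cos (alpha j.+1 + h) + cos (alpha j.+1 - h) = 2 * cos h * cos (alpha j.+1).
  by rewrite cosD cosB; ring.
have sD : sin (alpha j.+1 + h) + sin (alpha j.+1 - h) = 2 * cos h * sin (alpha j.+1).
  by rewrite sinD sinB; ring.
have -> : (j.+1 == 0)%N = false by [].
have aj0 : 0 <= alpha j by rewrite mulr_ge0 // ltW.
have [j2|j2] := ltnP j.+1 (2 * M)%N.
  have l2 := alpha_le j2; have l1 := alpha_le (leqnSn j.+1); have l0 := alpha_le (leqnSn j).
  rewrite eD eB !PsiC_sector1; try (apply/andP; split; lra).
  have -> : (j.+1 == 5 * M)%N = false by clear -M0 jN j2; lia.
  have -> : (j.+1 == 2 * M)%N = false by clear -M0 jN j2; lia.
  rewrite /=; lra.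
move: j2; rewrite leq_eqVlt => /orP[/eqP j2|j2].
  have l0 := alpha_le (leqnSn j).
  have e2 : alpha j.+1 = pi / 2 by rewrite -j2 a2; lra.
  rewrite (@PsiC_sector2 R (alpha j.+1 + h)); last by apply/andP; split; lra.
  rewrite (@PsiC_sector1 R (alpha j.+1 - h)); last by apply/andP; split; lra.
  rewrite (@PsiC_sector1 R (alpha j.+1)); last by apply/andP; split; lra.
  rewrite e2 (addrC (pi / 2) h) cosDpihalf -j2 eqxx.
  have -> : (2 * M == 5 * M)%N = false by clear -M0; lia.
  rewrite /=; lra.
have [j5|j5] := ltnP j.+1 (5 * M)%N.
  have l2 := alpha_le j5; have l1 := alpha_le (leqnSn j.+1); have l0 := alpha_le (leqnSn j).
  have l3 : alpha (2 * M) <= alpha j by apply: alpha_le; rewrite -ltnS.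
  rewrite eD eB !PsiC_sector2 -?eD -?eB; try (apply/andP; split; lra).
  have -> : (j.+1 == 5 * M)%N = false by clear -M0 jN j2 j5; lia.
  have -> : (j.+1 == 2 * M)%N = false by clear -M0 jN j2 j5; lia.
  rewrite /=; lra.
have l4 : alpha j.+2 <= alpha N by apply: alpha_le.
have l1 := alpha_le (leqnSn j.+1); have l0 := alpha_le (leqnSn j).
move: j5; rewrite leq_eqVlt => /orP[/eqP j5|j5].
  have e5 : alpha j.+1 = 5 * (pi / 4) by rewrite -j5 a5.
  have l3 : alpha (2 * M) <= alpha j by apply: alpha_le; rewrite -ltnS.
  rewrite (@PsiC_sector3 R (alpha j.+1 + h)); last by rewrite -alphaN; apply/andP; split; lra.
  rewrite (@PsiC_sector2 R (alpha j.+1 - h)); last by apply/andP; split; lra.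
  rewrite (@PsiC_sector2 R (alpha j.+1)); last by apply/andP; split; lra.
  have -> : (j.+1 == 2 * M)%N = false by clear -M0 jN j2 j5; lia.
  rewrite e5 sinD cosB c5 s5 -j5 eqxx /=; lra.
have l3 : alpha (5 * M) <= alpha j by apply: alpha_le; rewrite -ltnS.
rewrite !PsiC_sector3; try (rewrite -alphaN; apply/andP; split; lra).
have -> : (j.+1 == 5 * M)%N = false by clear -M0 jN j2 j5; lia.
have -> : (j.+1 == 2 * M)%N = false by clear -M0 jN j2 j5; lia.
rewrite /=; lra.
Qed.

End Grid.

Section Fourier.
Variables (R : realType) (M : nat).
Hypothesis M0 : (0 < M)%N.
Local Notation C := (cplx R).
Local Notation N := (8 * M)%N.
Local Notation h := (grid_step R M).
Local Notation zeta := (zeta R M).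
Local Notation w := (ray_weight R).
Local Notation a := (ray_exp M).

Lemma zeta_mulV : zeta * zeta^-1 = 1.
Proof. by rewrite divff // zeta_neq0. Qed.

Lemma zetaVX n : (zeta^-1) ^+ n = ei (- (n%:R * h)).
Proof. by rewrite exprVn zetaX eiV. Qed.

Lemma grid_shift (G : C -> C) b :
  \sum_(j < N) G (zeta ^+ j * zeta ^+ b) = \sum_(j < N) G (zeta ^+ j).
Proof.
have := zetaN R M0; case: N => [|n] zN; first by rewrite !big_ord0.
elim: b => [|b IH]; first by apply: eq_bigr => j _; rewrite expr0 mulr1.
rewrite -IH big_ord_recr [RHS]big_ord_recl /= addrC; congr (_ + _).
  by rewrite -exprD addnS -addSn exprD zN.
by apply: eq_bigr => j _; rewrite /bump /= -!exprD addnS addSn.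
Qed.

(** The discrete Fourier transform of the restriction of [f] to the grid. *)
Definition hat (f : C -> R) (k : nat) : C :=
  \sum_(j < N) (f (zeta ^+ j))%:C * (zeta^-1) ^+ (j * k).

Lemma hat_shift (f : C -> R) b k :
  \sum_(j < N) (f (zeta ^+ j * zeta ^+ b))%:C * (zeta^-1) ^+ (j * k) =
  zeta ^+ (b * k) * hat f k.
Proof.
pose G (s : C) := (f s)%:C * (s^-1) ^+ k.
have Gj j : G (zeta ^+ j) = (f (zeta ^+ j))%:C * (zeta^-1) ^+ (j * k).
  by rewrite /G -exprVn -exprM.
rewrite [hat f k](_ : _ = \sum_(j < N) G (zeta ^+ j)); last first.
  by apply: eq_bigr => j _; rewrite Gj.
rewrite -(grid_shift G b) mulr_sumr; apply: eq_bigr => j _.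
rewrite /G invfM exprMn -!exprVn -!exprM mulrCA; congr (_ * _).
by rewrite mulrCA -exprMn zeta_mulV expr1n mulr1.
Qed.

Lemma hat_shiftV (f : C -> R) k :
  \sum_(j < N) (f (zeta ^+ j * zeta^-1))%:C * (zeta^-1) ^+ (j * k) =
  (zeta^-1) ^+ k * hat f k.
Proof.
have e : zeta^-1 = zeta ^+ N.-1.
  apply: (mulfI (zeta_neq0 R M)); rewrite zeta_mulV -exprS prednK ?grid_size_gt0 //.
  by rewrite zetaN.
rewrite [X in _ = X ^+ k * _]e -exprM -hat_shift.
by apply: eq_bigr => j _; rewrite {1}e.
Qed.

(** The Fourier transform of the measure carried by the rays. *)
Definition kink_sum k : C := \sum_l (w l)%:C * zeta ^+ (a l * k).

Lemma hat_toric_degree k : hat (@toric_degree R) k = kink_sum k * hat (@PsiC R) k.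
Proof.
rewrite {1}/hat /toric_degree.
under eq_bigr do rewrite rmorph_sum mulr_suml.
rewrite exchange_big /kink_sum mulr_suml; apply: eq_bigr => l _ /=.
rewrite -mulrA -hat_shift mulr_sumr; apply: eq_bigr => j _.
rewrite (rayC_polar R M0) mulrCA PsiC_homog ?rmorphM ?mulrA //.
have [_ c0 _] := cos_pi4 R; rewrite /ray_weight; case: (val l) => // .
by rewrite mulr_ge0 // ltW.
Qed.

Lemma ray_exp_lt l : (a l < N)%N.
Proof. by elim/forall_ord3: l; rewrite /ray_exp /= ?inordK //=; lia. Qed.

Lemma conj_kink_sum k : ((kink_sum k)^*)%C = \sum_l (w l)%:C * (zeta^-1) ^+ (a l * k).
Proof.
rewrite /kink_sum rmorph_sum; apply: eq_bigr => l _.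
rewrite rmorphM; congr (_ * _); first by apply/eqP; rewrite eq_complex /= oppr0 !eqxx.
by rewrite zetaX zetaVX -conj_ei.
Qed.

Lemma ei_add_conj t : ei t + ei (- t) = (2 * cos t)%:C :> C.
Proof.
rewrite /ei cosN sinN; apply/eqP; rewrite eq_complex /=; apply/andP; split; apply/eqP; lra.
Qed.

(** The transform of [PsiC_second_difference]. *)
Lemma hat_PsiC k : hat (@PsiC R) k * (2 * (cos (k%:R * h) - cos h))%:C =
  (sin h)%:C * ((kink_sum k)^*)%C.
Proof.
have -> : (2 * (cos (k%:R * h) - cos h))%:C =
    zeta ^+ k + (zeta^-1) ^+ k - (2 * cos h)%:C.
  by rewrite zetaX zetaVX ei_add_conj -rmorphB; congr _%:C; lra.
rewrite mulrBr mulrDr !(mulrC (hat _ k)).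
have := hat_shift (@PsiC R) 1 k; rewrite mul1n => <-.
rewrite -hat_shiftV {1}/hat mulr_sumr -big_split -sumrB /=.
rewrite conj_kink_sum mulr_sumr.
rewrite (eq_bigr (fun j : 'I_N => \sum_l (sin h)%:C * ((w l)%:C *
    (j == a l :> nat)%:R) * (zeta^-1) ^+ (j * k))); last first.
  move=> j _; rewrite expr1 -mulr_suml -mulr_sumr.
  have := PsiC_second_difference R M0 (ltn_ord j).
  move=> /(congr1 (fun x : R => (x%:C : C) * (zeta^-1) ^+ (j * k))).
  rewrite rmorphM rmorph_sum rmorphB rmorphD rmorphM /=.
  under [X in _ = _ * X * _ -> _]eq_bigr do rewrite rmorphM rmorph_nat.
  by move=> e; apply: etrans e; rewrite mulrBl [in RHS](mulrDl (PsiC _)%:C) -[in RHS]mulrA.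
rewrite exchange_big; apply: eq_bigr => l _ /=.
rewrite (bigD1 (Ordinal (ray_exp_lt l))) //= eqxx mulr1 big1 ?addr0 ?mulrA // => j jl.
by rewrite (_ : (j == a l :> nat) = false) ?mulr0 ?mul0r //; apply: negbTE; exact: jl.
Qed.

(** The degree function is the convolution of [PsiC] with the measure carried by
    the rays, and the second difference of [PsiC] is proportional to the
    reflection of this measure: the product of the two transforms is a squared
    modulus. *)
Lemma hat_toric_degree_spectral k : hat (@toric_degree R) k * (2 * (cos (k%:R * h) - cos h))%:C =
  (sin h * modulus (kink_sum k) ^+ 2)%:C.
Proof.
rewrite hat_toric_degree -mulrA hat_PsiC mulrCA rmorphM; congr (_ * _).
case: (kink_sum k) => x y; apply/eqP; rewrite modulus_sqr eq_complex /=.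
by apply/andP; split; apply/eqP; ring.
Qed.

(** The rays sum to zero. *)
Lemma kink_sum1 : kink_sum 1 = 0.
Proof.
have -> : kink_sum 1 = \sum_l rayC R l.
  by apply: eq_bigr => l _; rewrite muln1 -(rayC_polar R M0).
rewrite !big_ord_recr big_ord0 /= add0r; apply/eqP; rewrite eq_complex /rayC /=.
by apply/andP; split; apply/eqP; lra.
Qed.

Lemma kink_sumN1 : kink_sum N.-1 = 0.
Proof.
apply/eqP; rewrite -conjc_eq0 -kink_sum1 conj_kink_sum; apply/eqP.
apply: eq_bigr => l _; congr (_ * _); rewrite muln1 exprM exprVn.
apply: (mulfI (expf_neq0 N.-1 (expf_neq0 (a l) (zeta_neq0 R M)))).
by rewrite -exprMn divff ?expf_neq0 ?zeta_neq0 // expr1n -exprSr prednK ?grid_size_gt0 // -exprM mulnC exprM zetaN // expr1n.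
Qed.

Lemma cos_alpha_lt k : (1 < k < N.-1)%N -> cos (k%:R * h) < cos h.
Proof.
move=> /andP[k1 kN]; have h0 := grid_step_gt0 R M0; have hp := grid_step_le R M0.
have pi0 := pi_gt0 R; have aN := alphaN R M0.
have half x : h < x <= pi -> cos x < cos h.
  move=> /andP[hx xp]; rewrite ltr_cos ?in_itv //=; apply/andP; split; lra.
have hk : h < k%:R * h by rewrite ltr_pMl // ltr1n.
have [kp|kp] := leP (k%:R * h) pi; first by apply: half; rewrite hk.
rewrite -cosN -cosD2pi; apply: half; apply/andP; split; last by rewrite mulr2n; lra.
rewrite -aN addrC -mulrBl -natrB; last by rewrite (leq_trans (ltnW kN)) // leq_pred.
by rewrite ltr_pMl // ltr1n ltn_subRL addn1 -(ltn_predRL).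
Qed.

(** In [hat_toric_degree_spectral], the factor cos kh - cos h is negative except
    at the frequencies 1 and -1, where [kink_sum] vanishes. *)
Lemma hat_toric_degree_sign k : (0 < k < N)%N -> exists2 x, x <= 0 & hat (@toric_degree R) k = x%:C.
Proof.
move=> /andP[k0 kN]; have [k1|k1] := eqVneq k 1%N.
  by exists 0; rewrite ?lexx // hat_toric_degree k1 kink_sum1 mul0r.
have [kN1|kN1] := eqVneq k N.-1.
  by exists 0; rewrite ?lexx // hat_toric_degree kN1 kink_sumN1 mul0r.
have kk : (1 < k < N.-1)%N.
  rewrite ltn_neqAle eq_sym k1 k0 ltn_neqAle kN1 -ltnS prednK ?kN //.
  exact: leq_trans kN.
have lt := cos_alpha_lt kk; set q := 2 * (cos (k%:R * h) - cos h).
have q0 : q < 0 by rewrite /q; lra.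
exists (sin h * modulus (kink_sum k) ^+ 2 / q).
  rewrite mulr_ge0_le0 ?invr_le0 ?(ltW q0) // mulr_ge0 ?exprn_ge0 ?modulus_ge0 //.
  by rewrite ltW // sin_grid_step_gt0.
have qC : (q%:C : C) != 0 by rewrite -modulus_eq0 modulus_real normr_eq0 lt_eqF.
apply: (mulIf qC); rewrite -rmorphM divfK ?lt_eqF //; exact: hat_toric_degree_spectral.
Qed.

Lemma hat_toric_degree0 : exists x, hat (@toric_degree R) 0 = x%:C.
Proof.
exists (\sum_(j < N) toric_degree (zeta ^+ j)); rewrite rmorph_sum; apply: eq_bigr => j _.
by rewrite muln0 expr0 mulr1.
Qed.

Lemma zeta_neq1 n : (0 < n < N)%N -> zeta ^+ n != 1.
Proof.
move=> /andP[n0 nN]; rewrite zetaX; apply/eqP => /(congr1 (@complex.Re R)) /= e.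
have := @cos_lt1 R (n%:R * h); rewrite e ltxx -(alphaN R M0) => H.
suff : false by []. apply: H; rewrite mulr_gt0 ?ltr0n ?grid_step_gt0 //=.
by rewrite ltr_pM2r ?grid_step_gt0 // ltr_nat.
Qed.

Lemma sum_roots (x : C) : x ^+ N = 1 -> x != 1 -> \sum_(k < N) x ^+ k = 0.
Proof.
move=> xN x1; apply/eqP; have := subrX1 x N; rewrite xN subrr => /esym/eqP.
by rewrite mulf_eq0 subr_eq0 (negPf x1).
Qed.

Definition fourier (k : nat) : R := complex.Re (hat (@toric_degree R) k) / N%:R.

Lemma fourierE k : (k < N)%N -> (fourier k)%:C = hat (@toric_degree R) k / N%:R.
Proof.
move=> kN; have NC : (N%:R : C) = (N%:R)%:C by rewrite rmorph_nat.
rewrite NC /fourier rmorphM (fmorphV _ (N%:R : R)); congr (_ / _).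
have [->|k0] := posnP k; first by have [x ->] := hat_toric_degree0.
by have [|x _ ->] := @hat_toric_degree_sign k; rewrite ?k0.
Qed.

Lemma fourier_le0 k : (0 < k < N)%N -> fourier k <= 0.
Proof.
by move=> /hat_toric_degree_sign[x x0 e]; rewrite /fourier e /= mulr_le0_ge0 // invr_ge0.
Qed.

Lemma fourier_inversion i :
  (toric_degree (zeta ^+ i))%:C = \sum_(k < N) (fourier k)%:C * zeta ^+ (i * k).
Proof.
have NC : (N%:R : C) != 0 by rewrite pnatr_eq0 -lt0n grid_size_gt0.
have per n : zeta ^+ n = zeta ^+ (n %% N).
  by rewrite {1}(divn_eq n N) exprD mulnC exprM zetaN // expr1n mul1r.
rewrite (eq_bigr (fun k : 'I_N => \sum_(j < N) (toric_degree (zeta ^+ j))%:C / N%:R *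
    (zeta ^+ i * (zeta^-1) ^+ j) ^+ k)); last first.
  move=> k _; rewrite fourierE // /hat -mulrA mulr_suml; apply: eq_bigr => j _.
  by rewrite exprMn -!exprM -!mulrA; congr (_ * _); rewrite mulrC mulrA.
rewrite exchange_big /=; under eq_bigr do rewrite -mulr_sumr.
have iN : (i %% N < N)%N by rewrite ltn_mod grid_size_gt0.
rewrite (bigD1 (Ordinal iN)) //= [X in _ = _ + X]big1 ?addr0; last first.
  move=> j ji; rewrite sum_roots ?mulr0 //.
    by rewrite exprMn -!exprM mulnC exprM zetaN // expr1n mulnC exprM exprVn zetaN // invr1 expr1n mulr1.
  rewrite per -(inj_eq (mulIf (expf_neq0 j (zeta_neq0 R M)))) -mulrA -exprMn mulVf ?zeta_neq0 //.
  rewrite expr1n mulr1 mul1r; apply/eqP => e.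
  have jN := ltn_ord j; have ne : (i %% N)%N != j by apply: contraNneq ji => e'; apply/eqP/val_inj.
  have [lt|gt|eq] := ltngtP (i %% N) j; last by rewrite eq eqxx in ne.
    have := zeta_neq1 (n := j - i %% N); rewrite subn_gt0 lt (leq_ltn_trans (leq_subr _ _)) // => /(_ isT)/eqP; apply.
    by apply: (mulfI (expf_neq0 (i %% N) (zeta_neq0 R M))); rewrite -exprD subnKC ?(ltnW lt) // mulr1.
  have := zeta_neq1 (n := i %% N - j); rewrite subn_gt0 gt (leq_ltn_trans (leq_subr _ _)) // => /(_ isT)/eqP; apply.
  by apply: (mulfI (expf_neq0 j (zeta_neq0 R M))); rewrite -exprD subnKC ?(ltnW gt) // mulr1.
rewrite per -exprMn zeta_mulV expr1n.
under eq_bigr do rewrite expr1n.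
by rewrite sumr_const card_ord divfK.
Qed.

Lemma kink_sum8 m : (kink_sum (8 * m)) = (2 * cos (pi / 4) + 2)%:C.
Proof.
rewrite /kink_sum (eq_bigr (fun l => (w l)%:C)) => [|l _]; last first.
  suff [q ->] : exists q, (a l * (8 * m) = N * q)%N.
    by rewrite exprM zetaN // expr1n mulr1.
  by rewrite /ray_exp; case: (val l) => [|[|_]];
    [exists (5 * m)%N | exists 0%N | exists (2 * m)%N]; lia.
by rewrite -rmorph_sum sum3 /ray_weight /= !inordK //=; congr _%:C; lra.
Qed.

Lemma modulus_zetaX_sub1 n : modulus (zeta ^+ n - 1) <= n%:R * modulus (zeta - 1).
Proof.
elim: n => [|n IH]; first by rewrite expr0 subrr modulus0 mul0r.
have -> : zeta ^+ n.+1 - 1 = zeta * (zeta ^+ n - 1) + (zeta - 1).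
  by rewrite exprS; move: zeta => z; move: (z ^+ n) => x; ring.
apply: le_trans (ler_modulusD _ _) _.
rewrite modulusM modulus_ei mul1r -natr1 mulrDl mul1r; exact: lerD.
Qed.

(** At the frequencies divisible by 8, the three terms of [kink_sum] have the
    same phase, whatever the grid. *)
Lemma fourier_bound m : (0 < m < M)%N ->
  1 <= pi * (8 * m)%:R ^+ 2 * - fourier (8 * m).
Proof.
move=> /andP[m0 mM]; set k := (8 * m)%N.
have kN : (k < N)%N by rewrite /k; lia.
have k0 : (0 < k)%N by rewrite /k; lia.
have := hat_toric_degree_spectral k; rewrite kink_sum8 modulus_real.
have := fourierE kN; set g := fourier k => gE.
have NC : (N%:R : C) != 0 by rewrite pnatr_eq0 -lt0n grid_size_gt0.
have -> : hat (@toric_degree R) k = (g * N%:R)%:C.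
  have -> : (g * N%:R)%:C = g%:C * N%:R :> C by rewrite rmorphM rmorph_nat.
  by rewrite gE divfK.
rewrite -rmorphM => /(congr1 (@complex.Re R)) /= e.
have g0 : 0 <= - g by rewrite oppr_ge0 fourier_le0 // k0.
have [_ c0 _] := cos_pi4 R; rewrite ger0_norm in e; last lra.
have s0 := sin_grid_step_gt0 R M0; have ch := cos_grid_step_ge0 R M0.
have sh : sin h <= h by apply: sin_le; rewrite ltW // grid_step_gt0.
have aN : N%:R * h = 2 * pi by rewrite alphaN // mulr2n; lra.
have n0 : 0 < N%:R :> R by rewrite ltr0n grid_size_gt0.
have q : 2 * (1 - cos (k%:R * h)) <= 2 * k%:R ^+ 2 * sin h ^+ 2.
  rewrite -modulus_ei_sub1 -eiX; apply: (@le_trans _ _ ((k%:R * modulus (zeta - 1)) ^+ 2)).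
    by rewrite ler_pXn2r ?nnegrE ?mulr_ge0 ?modulus_ge0 ?modulus_zetaX_sub1.
  rewrite exprMn modulus_ei_sub1 mulrCA -mulrA ler_pM2l // ler_wpM2l ?sqr_ge0 //.
  by have := cos2Dsin2 h; have := cos_le1 h; move: ch; nra.
have k2 : 0 <= (k%:R : R) ^+ 2 by apply: sqr_ge0.
have c1 := cos_le1 h; have pi0 := pi_gt0 R.
move: s0 sh aN n0 q k2 e c0 g0 c1 ch; 
move: (cos (k%:R * h)) (sin h) (cos h) => x s y.
move: (k%:R ^+ 2) (N%:R) (cos (pi / 4)) (grid_step R M).
clear -pi0; move: (pi) pi0 => p pi0 K n c1 st s0 sh aN n0 q k2 e c0 g0 y1 y0.
have h1 : 2 * s <= - g * n * (K * s ^+ 2).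
  have gn : 0 <= - g * n by rewrite mulr_ge0 // ltW.
  have : - g * n * (2 * (y - x)) <= - g * n * (2 * K * s ^+ 2).
    by rewrite ler_wpM2l //; lra.
  have := ler_wpM2r (ltW s0) (_ : 4 <= (2 * c1 + 2) ^+ 2).
  have : 4 <= (2 * c1 + 2) ^+ 2 by nra.
  move=> c4 /(_ c4); move: e.
  have -> : g * n * (2 * (x - y)) = - g * n * (2 * (y - x)) by ring.
  move=> ->; rewrite (mulrC s); lra.
have h2 : 2 <= - g * n * (K * s).
  rewrite -(ler_pM2r s0); apply: le_trans h1 _; rewrite le_eqVlt; apply/orP; left; apply/eqP; ring.
have h3 : - g * n * (K * s) <= - g * n * (K * st).
  by rewrite ler_wpM2l ?ler_wpM2l // mulr_ge0 // ltW.
have : - g * K * (n * st) = - g * n * (K * st) by ring.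
rewrite aN; lra.
Qed.

End Fourier.

(** * Uniqueness of the solution of D = 2 in the disk *)

Lemma cauchy_kernel (F : fieldType) (p q : F) : 1 - p != 0 -> 1 - q != 0 ->
  1 - p * q != 0 ->
  (1 - p)^-1 * (1 - q)^-1 = (1 - p * q)^-1 * ((1 - p)^-1 + (1 - q)^-1 - 1).
Proof. by move=> p1 q1 pq; field; rewrite pq p1 q1. Qed.

Section PickMatrix.
Variable R : realType.
Local Notation C := (cplx R).
Implicit Types z w : C.
Local Notation cj z := ((z)^*)%C.

Lemma real_complexM (a b : R) : (a * b)%:C = a%:C * b%:C :> C.
Proof. exact: rmorphM. Qed.

Lemma real_complexV (a : R) : (a^-1)%:C = (a%:C)^-1 :> C.
Proof. exact: fmorphV. Qed.

Lemma real_complexB (a b : R) : (a - b)%:C = a%:C - b%:C :> C.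
Proof. exact: rmorphB. Qed.

Lemma mul_conj z : z * cj z = (modulus z ^+ 2)%:C.
Proof.
by case: z => x y; apply/eqP; rewrite modulus_sqr eq_complex /=; apply/andP; split; apply/eqP; ring.
Qed.

Lemma modulus_conj z : modulus (cj z) = modulus z.
Proof. by case: z => x y; rewrite /modulus /= sqrrN. Qed.

Lemma sub1_neq0 z : modulus z < 1 -> 1 - z != 0.
Proof.
move=> z1; rewrite subr_eq0; apply: contraTneq z1 => <-.
by rewrite modulus1 ltxx.
Qed.

(** On the unit circle the kernel [1 / (1 - x y)] is a Cauchy kernel, which
    turns a weighted sum of squares into a quadratic form in the weighted sums
    of the kernels. *)
Lemma pick_sum n m (f : 'I_n -> R) (y : 'I_n -> C) (x xi : 'I_m -> C)
    (B := fun i => \sum_k (f k)%:C / (1 - x i * y k)) :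
  (forall k, modulus (y k) = 1) -> (forall i, modulus (x i) < 1) ->
  (\sum_k f k * modulus (\sum_i xi i / (1 - x i * y k)) ^+ 2)%:C =
  \sum_i \sum_j xi i * cj (xi j) / (1 - x i * cj (x j)) *
    (B i + cj (B j) - (\sum_k f k)%:C).
Proof.
move=> y1 x1.
have xy i k : modulus (x i * y k) < 1 by rewrite modulusM y1 mulr1.
pose e i k := (1 - x i * y k)^-1.
have ker i j k : e i k * cj (e j k) =
    (1 - x i * cj (x j))^-1 * (e i k + cj (e j k) - 1).
  have -> : cj (e j k) = (1 - cj (x j * y k))^-1.
    by rewrite /e fmorphV rmorphB rmorph1.
  have pq : x i * cj (x j) = (x i * y k) * cj (x j * y k).
    by rewrite rmorphM mulrACA mul_conj y1 expr1n mulr1.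
  rewrite pq; apply: cauchy_kernel; apply: sub1_neq0; first exact: xy.
    by rewrite modulus_conj.
  by rewrite modulusM modulus_conj mulr_ilt1 ?modulus_ge0.
rewrite rmorph_sum /=.
transitivity (\sum_k \sum_i \sum_j
    ((f k)%:C * (xi i * e i k * (cj (xi j) * cj (e j k))) : C)).
  apply: eq_bigr => k _.
  have cjS : cj (\sum_i xi i / (1 - x i * y k)) = \sum_j cj (xi j) * cj (e j k) :> C.
    by rewrite rmorph_sum; apply: eq_bigr => i _; rewrite rmorphM.
  transitivity ((f k)%:C * (modulus (\sum_i xi i / (1 - x i * y k)) ^+ 2)%:C : C).
    exact: real_complexM.
  by rewrite -mul_conj cjS mulr_suml mulr_sumr;
    apply: eq_bigr => i _; rewrite !mulr_sumr.
rewrite exchange_big; apply: eq_bigr => i _; rewrite exchange_big; apply: eq_bigr => j _ /=.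
have cjB : cj (B j) = \sum_k (f k)%:C * cj (e j k).
  rewrite rmorph_sum; apply: eq_bigr => k _; rewrite rmorphM; congr (_ * _).
  by apply/eqP; rewrite eq_complex /= oppr0 !eqxx.
rewrite cjB {1}/B rmorph_sum -big_split -sumrB mulr_sumr /=; apply: eq_bigr => k _.
rewrite -/(e i k).
transitivity ((f k)%:C * (xi i * cj (xi j)) * (e i k * cj (e j k))).
  move: ((f k)%:C) (xi i) (cj (xi j)) (e i k) (cj (e j k)) => *; ring.
rewrite ker; move: ((f k)%:C) (xi i) (cj (xi j)) (e i k) (cj (e j k)) (_^-1) => *; ring.
Qed.

(** The difference of the two sides is the square of the modulus of [z - w]. *)
Lemma pick_det z w : modulus z < 1 -> modulus w < 1 -> z != w ->
  (1 - modulus z ^+ 2) * (1 - modulus w ^+ 2) < modulus (1 - z * cj w) ^+ 2.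
Proof.
move=> z1 w1 zw; have : 0 < modulus (z - w) ^+ 2.
  by rewrite exprn_gt0 // modulus_gt0 subr_eq0.
rewrite !modulus_sqr; case: z w {z1 w1 zw} => a b [c d] /=; nra.
Qed.

(** The Pick matrix of two distinct points of the disk is positive definite: its
    determinant is controlled by [pick_det]. *)
Lemma pick_form_gt0 (x xi : 'I_2 -> C) : (forall i, modulus (x i) < 1) ->
  (forall i, xi i != 0) -> x 0 != x 1 ->
  0 < complex.Re (\sum_i \sum_j xi i * cj (xi j) / (1 - x i * cj (x j))).
Proof.
move=> x1 xi0 x01.
rewrite !big_ord_recl !big_ord0 !addr0 /=.
rewrite (_ : lift ord0 ord0 = 1); last exact: val_inj.
have det := pick_det (x1 0) (x1 1) x01.
set H01 := xi 0 * cj (xi 1) / _; set H10 := xi 1 * cj (xi 0) / _.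
have diag i : xi i * cj (xi i) / (1 - x i * cj (x i)) =
    (modulus (xi i) ^+ 2 / (1 - modulus (x i) ^+ 2))%:C.
  by rewrite !mul_conj real_complexM real_complexV real_complexB.
have Hc : H10 = cj H01.
  rewrite /H10 /H01 !(rmorphM, fmorphV, rmorphB, rmorph1) /= !conjcK.
  by rewrite mulrC (mulrC (xi 1)) (mulrC (x 1)) mulrC.
have ReD (z w : C) : complex.Re (z + w) = complex.Re z + complex.Re w by case: z w => ? ? [].
have Rec (z : C) : complex.Re (cj z) = complex.Re z by case: z.
rewrite !diag Hc !ReD Rec /=.
have mH : modulus H01 = modulus (xi 0) * modulus (xi 1) / modulus (1 - x 0 * cj (x 1)).
  by rewrite /H01 !modulusM modulusV modulus_conj.
have := Re_le_modulus H01; rewrite mH ler_norml => /andP[H _].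
have p0 : 0 < modulus (xi 0) by rewrite modulus_gt0.
have q0 : 0 < modulus (xi 1) by rewrite modulus_gt0.
have a0 i : 0 < 1 - modulus (x i) ^+ 2.
  by rewrite subr_gt0 expr_lt1 // modulus_ge0.
have c0 : 0 < modulus (1 - x 0 * cj (x 1)).
  by rewrite modulus_gt0 sub1_neq0 // modulusM modulus_conj mulr_ilt1 ?modulus_ge0.
move: det H p0 q0 c0 (a0 0) (a0 1).
move: (modulus (xi 0)) (modulus (xi 1)) (1 - modulus (x 0) ^+ 2) (1 - modulus (x 1) ^+ 2).
move: (modulus (1 - x 0 * cj (x 1))) (complex.Re H01).
clear=> g s p q a b det H p0 q0 g0 a0 b0.
have sq : (2 * (p * q / g)) ^+ 2 < (p ^+ 2 / a + q ^+ 2 / b) ^+ 2.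
  apply: (@lt_le_trans _ _ (4 * ((p * q) ^+ 2 / (a * b)))).
    have -> : (2 * (p * q / g)) ^+ 2 = 4 * ((p * q) ^+ 2 / g ^+ 2).
      by field; rewrite gt_eqF.
    rewrite ltr_pM2l // ltr_pM2l; last by rewrite exprn_gt0 // mulr_gt0.
    by rewrite ltf_pV2 ?posrE ?exprn_gt0 ?mulr_gt0.
  rewrite -subr_ge0 (_ : _ - _ = (p ^+ 2 / a - q ^+ 2 / b) ^+ 2) ?sqr_ge0 //.
  by field; rewrite !gt_eqF.
have X0 : 0 <= p ^+ 2 / a + q ^+ 2 / b by rewrite addr_ge0 // divr_ge0 ?sqr_ge0 // ltW.
have Y0 : 0 <= 2 * (p * q / g) by rewrite !mulr_ge0 // ?invr_ge0 ltW.
rewrite ltr_pXn2r ?nnegrE // in sq; lra.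
Qed.

End PickMatrix.

Section Uniqueness.
Variable R : realType.
Local Notation C := (cplx R).
Local Notation cj z := ((z)^*)%C.
Local Notation h := (grid_step R).

Lemma grid_step_small (e : R) : 0 < e -> exists2 M, (0 < M)%N & h M < e.
Proof.
move=> e0; have pi0 := pi_gt0 R; exists (Num.truncn (pi / e)).+1 => //.
have := truncnS_gt (pi / e); set m := _.+1 => hm.
have m0 : 0 < m%:R :> R by rewrite ltr0n.
rewrite ltr_pdivrMr // in hm.
rewrite /grid_step ltr_pdivrMr ?mulr_gt0 //; nra.
Qed.

Lemma grid_approx (u : C) M : (0 < M)%N -> modulus u = 1 ->
  exists b, modulus (u - zeta R M ^+ b) <= h M.
Proof.
move=> M0 /unit_ei[t /andP[t0 _] ->]; have h0 := grid_step_gt0 R M0.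
exists (Num.truncn (t / h M)); rewrite zetaX.
apply: le_trans (ei_Lipschitz _ _) _.
have t1 : 0 <= t / h M by rewrite divr_ge0 // ltW.
have := truncn_le (t / h M); rewrite t1 ler_pdivlMr // => h1.
have := truncnS_gt (t / h M); rewrite ltr_pdivrMr // -natr1 mulrDl mul1r => h2.
rewrite ger0_norm; lra.
Qed.

Lemma modulusX_sub (u v : C) n : modulus u = 1 -> modulus v = 1 ->
  modulus (u ^+ n - v ^+ n) <= n%:R * modulus (u - v).
Proof.
move=> u1 v1; elim: n => [|n IH]; first by rewrite !expr0 subrr modulus0 mul0r.
have -> : u ^+ n.+1 - v ^+ n.+1 = u * (u ^+ n - v ^+ n) + (u - v) * v ^+ n.
  by rewrite !exprS; move: (u ^+ n) (v ^+ n) => x y; ring.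
apply: le_trans (ler_modulusD _ _) _.
rewrite !modulusM modulusX u1 v1 expr1n mulr1 mul1r -natr1 mulrDl mul1r.
exact: lerD.
Qed.

Lemma ps_geometric (y x : C) : modulus y = 1 -> modulus x < 1 ->
  geo_bound (fun n => y ^+ n) 1 1 /\ ps (fun n => y ^+ n) x = (1 - x * y)^-1.
Proof.
move=> y1 x1.
have gb : geo_bound (fun n => y ^+ n) 1 1.
  by split=> // n; rewrite modulusX y1 !expr1n mul1r.
split=> //; have xy : 1 - x * y != 0 by rewrite sub1_neq0 // modulusM y1 mulr1.
have bx : 1 * modulus x < 1 by rewrite mul1r.
apply: (mulfI xy); rewrite divff //.
have := ps_recl gb bx; rewrite expr0.
have -> : ps (fun n => y ^+ n.+1) x = y * ps (fun n => y ^+ n) x.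
  apply: ps_unique.
  have := cvgM (cvg_cst y) (ps_cvg gb bx) => /(_ _ _); apply: cvg_trans.
  apply: near_eq_cvg; near=> n; rewrite /series /= mulr_sumr.
  by apply: eq_bigr => i _; rewrite exprS mulrA.
move: (ps _ x) => p e; rewrite mulrBl mul1r {1}e; ring.
Unshelve. all: by end_near. Qed.

Lemma cvg_finite_sum (I : Type) (r : seq I) (F : I -> nat -> C) (l : I -> C) :
  (forall k, F k @ \oo --> l k) ->
  (fun m => \sum_(k <- r) F k m) @ \oo --> \sum_(k <- r) l k.
Proof.
move=> Fl; elim: r => [|k r IH].
  by rewrite big_nil (_ : (fun _ => _) = cst 0); [exact: cvg_cst|apply/funext => m; rewrite big_nil].
rewrite big_cons (_ : (fun m => _) = (fun m => F k m + \sum_(k <- r) F k m)).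
  by apply: cvgD; [exact: Fl | exact: IH].
by apply/funext => m; rewrite big_cons.
Qed.

Lemma ps_geometric_sum n (f : 'I_n -> R) (y : 'I_n -> C) (x : C) :
  (forall k, modulus (y k) = 1) -> modulus x < 1 ->
  exists2 K, geo_bound (fun j => \sum_k (f k)%:C * y k ^+ j) K 1 &
    ps (fun j => \sum_k (f k)%:C * y k ^+ j) x = \sum_k (f k)%:C / (1 - x * y k).
Proof.
move=> y1 x1; have bx : 1 * modulus x < 1 by rewrite mul1r.
exists (\sum_k `|f k|).
  split=> // j; rewrite expr1n mulr1; apply: le_trans (modulus_sum _ _) _.
  apply: ler_sum => k _.
  by rewrite modulusM modulusX y1 expr1n mulr1 modulus_real.
apply: ps_unique.
have -> : series (fun j => (\sum_k (f k)%:C * y k ^+ j) * x ^+ j) =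
    fun m => \sum_k (f k)%:C * series (fun j => y k ^+ j * x ^+ j) m.
  apply/funext => m; rewrite /series /=.
  under eq_bigr do rewrite mulr_suml.
  rewrite exchange_big; apply: eq_bigr => k _; rewrite mulr_sumr.
  by apply: eq_bigr => j _; rewrite mulrA.
apply: cvg_finite_sum => k.
have [gb <-] := ps_geometric (y1 k) x1.
by apply: cvgM; [exact: cvg_cst | exact: ps_cvg gb bx].
Qed.

Lemma bernoulli_le (t : R) n : 0 <= t -> n%:R * t <= (1 + t) ^+ n.
Proof.
move=> t0; suff : 1 + n%:R * t <= (1 + t) ^+ n by lra.
elim: n => [|n IH]; first by rewrite expr0 mul0r addr0.
have n0 : 0 <= n%:R :> R by [].
rewrite exprS -natr1; apply: le_trans (ler_wpM2l _ IH); last lra.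
by move: (n%:R) n0 t0 => x x0 t0; nra.
Qed.

Variable u : C.
Hypothesis u1 : modulus u = 1.

Definition orbit_degrees n : C := (toric_degree (u ^+ n))%:C.

Lemma geo_orbit_degrees : geo_bound orbit_degrees 6 1.
Proof.
split=> // n; rewrite expr1n mulr1 modulus_real ger0_norm ?toric_degree_ge0 //.
by apply: le_trans (toric_degree_le _) _; rewrite modulusX u1 expr1n mulr1.
Qed.

(** The errors on the coefficients grow linearly with the exponent, which
    is harmless inside the disk. *)
Lemma ps_grid_close x : modulus x < 1 -> exists2 K, 0 <= K &
  forall M b, (0 < M)%N -> modulus (u - zeta R M ^+ b) <= h M ->
  modulus (ps orbit_degrees x -
    \sum_(k < 8 * M) (fourier R M k)%:C / (1 - x * zeta R M ^+ (b * k))) <= K * h M.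
Proof.
move=> x1; have bx : 1 * modulus x < 1 by rewrite mul1r.
have m0 := modulus_ge0 x; pose t := (1 - modulus x) / 2.
have t0 : 0 < t by rewrite /t; lra.
have tx : (1 + t) * modulus x < 1 by rewrite /t; nra.
exists (6 / t / (1 - (1 + t) * modulus x)).
  by rewrite !divr_ge0 // ltW // subr_gt0.
move=> M b M0 ub; have h0 := grid_step_gt0 R M0; set v := zeta R M ^+ b in ub.
have v1 : modulus v = 1 by rewrite /v modulusX modulus_ei expr1n.
have y1 (k : 'I_(8 * M)) : modulus (zeta R M ^+ (b * k)) = 1.
  by rewrite modulusX modulus_ei expr1n.
have [K gK <-] := ps_geometric_sum (fun k : 'I_(8 * M) => fourier R M k) y1 x1.
have e n : \sum_(k < 8 * M) (fourier R M k)%:C * (zeta R M ^+ (b * k)) ^+ n = (toric_degree (v ^+ n))%:C.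
  rewrite /v -exprM (fourier_inversion R M0); apply: eq_bigr => k _.
  by rewrite -exprM mulnAC.
rewrite -(psN gK bx) -(psD geo_orbit_degrees (geo_boundN gK) bx).
rewrite mulrAC; apply: modulus_ps_le => //; split; first lra.
move=> n; rewrite e /orbit_degrees -real_complexB modulus_real.
apply: le_trans (norm_toric_degree_sub _ _) _.
have := modulusX_sub n u1 v1; have := bernoulli_le n (ltW t0).
have n0 : 0 <= n%:R :> R by [].
move: ub h0 n0 t0; move: (modulus (u ^+ n - v ^+ n)) (modulus (u - v)) (n%:R) ((1 + t) ^+ n) (h M) (t).
clear => A B m p s r Bs s0 n0 t0 np AB.
set q := (1 + r) ^+ n in np *; move: (q : R) np => {}q np.
have -> : 6 / r * s * q = 6 * (s * (q / r)) by ring.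
rewrite ler_pM2l //; apply: (le_trans AB).
apply: (@le_trans _ _ (m * s)); first by rewrite ler_wpM2l.
by rewrite mulrC ler_pM2l // ler_pdivlMr.
Qed.

(** Positivity of the Pick matrix at two solutions of [ps orbit_degrees x = 2]
    contradicts the sign of the Fourier coefficients.  The vector of weights is
    chosen so as to cancel the only positive coefficient, that of index 0. *)
Lemma orbit_degrees_inj2 (x1 x2 : C) : modulus x1 < 1 -> modulus x2 < 1 ->
  ps orbit_degrees x1 = 2 -> ps orbit_degrees x2 = 2 -> x1 = x2.
Proof.
move=> m1 m2 A1 A2; apply/eqP/negPn/negP => x12.
pose x (i : 'I_2) : C := if i == 0 then x1 else x2.
pose xi (i : 'I_2) : C := if i == 0 then 1 - x1 else - (1 - x2).
have xm i : modulus (x i) < 1 by rewrite /x; case: ifP.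
have xA i : ps orbit_degrees (x i) = 2 by rewrite /x; case: ifP.
have xi0 i : xi i != 0 by rewrite /xi; case: ifP => _; rewrite ?oppr_eq0 sub1_neq0.
have x01 : x 0 != x 1 by [].
have := pick_form_gt0 xm xi0 x01; set H := \sum_i _ => H0.
have /choice[K hK] : forall i, exists K, 0 <= K /\
    forall M b, (0 < M)%N -> modulus (u - zeta R M ^+ b) <= h M ->
    modulus (2 - \sum_(k < 8 * M) (fourier R M k)%:C / (1 - x i * zeta R M ^+ (b * k))) <= K * h M.
  by move=> i; have [K K0 hK] := ps_grid_close (xm i); exists K; rewrite -(xA i).
pose Hm i j := modulus (xi i * cj (xi j) / (1 - x i * cj (x j))).
pose S := \sum_i \sum_j Hm i j * (K i + K j).
have S0 : 0 <= S.
  apply: sumr_ge0 => i _; apply: sumr_ge0 => j _.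
  by rewrite mulr_ge0 ?modulus_ge0 // addr_ge0 //; case: (hK i); case: (hK j).
have e0 : 0 < 3 * complex.Re H / (S + 1) by rewrite !divr_gt0 ?mulr_gt0 //; lra.
have [M M0 hM] := grid_step_small e0; have [b ub] := grid_approx M0 u1.
have y1 (k : 'I_(8 * M)) : modulus (zeta R M ^+ (b * k)) = 1.
  by rewrite modulusX modulus_ei expr1n.
pose B (i : 'I_2) : C := \sum_(k < 8 * M) (fourier R M k)%:C / (1 - x i * zeta R M ^+ (b * k)).
have : (\sum_(k < 8 * M) fourier R M k *
      modulus (\sum_i xi i / (1 - x i * zeta R M ^+ (b * k))) ^+ 2)%:C =
    \sum_i \sum_j xi i * cj (xi j) / (1 - x i * cj (x j)) *
      (B i + cj (B j) - (\sum_(k < 8 * M) fourier R M k)%:C).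
  exact: (pick_sum (fun k : 'I_(8 * M) => fourier R M k) xi y1 xm).
have -> : (\sum_(k < 8 * M) fourier R M k)%:C = 1 :> C.
  have := fourier_inversion R M0 0; rewrite expr0 toric_degree1 => /esym; apply: etrans.
  by rewrite rmorph_sum; apply: eq_bigr => k _; rewrite mulr1.
have BE i : modulus (2 - B i) <= K i * h M by have [_] := hK i; exact.
move=> /(congr1 (@complex.Re R)); rewrite [LHS]/=.
have L0 : \sum_(k < 8 * M) fourier R M k *
    modulus (\sum_i xi i / (1 - x i * zeta R M ^+ (b * k))) ^+ 2 <= 0.
  apply: sumr_le0 => k _; have [k0|k0] := posnP (val k).
    rewrite k0 muln0 expr0 !big_ord_recl big_ord0 addr0 /= !mulr1 /xi /x /=.
    by rewrite mulNr !divff ?sub1_neq0 // subrr modulus0 expr0n mulr0.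
  by rewrite mulr_le0_ge0 ?sqr_ge0 // fourier_le0 // k0 /=.
move=> E; rewrite E in L0; move: L0; apply/negP; rewrite -ltNge {E}.
have -> : \sum_i \sum_j xi i * cj (xi j) / (1 - x i * cj (x j)) * (B i + cj (B j) - 1) =
    3%:R * H - \sum_i \sum_j xi i * cj (xi j) / (1 - x i * cj (x j)) * ((2 - B i) + cj (2 - B j)).
  rewrite /H mulr_sumr -sumrB; apply: eq_bigr => i _; rewrite mulr_sumr -sumrB.
  apply: eq_bigr => j _.
  have -> : cj (2 - B j) = 2 - cj (B j) :> C by rewrite rmorphB rmorph_nat.
  have alg (a b' c : C) : a * (b' + c - 1) = 3%:R * a - a * ((2 - b') + (2 - c)) by ring.
  exact: alg.
set E := \sum_i _; have Eb : modulus E <= S * h M.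
  apply: le_trans (modulus_sum _ _) _; rewrite mulr_suml; apply: ler_sum => i _.
  apply: le_trans (modulus_sum _ _) _; rewrite mulr_suml; apply: ler_sum => j _.
  rewrite [leLHS]modulusM -[leRHS]mulrA; apply: ler_wpM2l; first exact: modulus_ge0.
  rewrite mulrDl.
  apply: le_trans (ler_modulusD _ _) _; rewrite modulus_conj.
  by apply: lerD; exact: BE.
have := Re_le_modulus E; rewrite ReB ler_norml => /andP[_ ER].
have -> : complex.Re (3%:R * H) = 3 * complex.Re H.
  have -> : 3%:R = (3%:R)%:C :> C by rewrite rmorph_nat.
  by case: (H) => ? ? /=; ring.
have h0 := grid_step_gt0 R M0.
rewrite ltr_pdivlMr in hM; last lra.
rewrite subr_gt0; apply: le_lt_trans ER _; apply: le_lt_trans Eb _.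
by apply: le_lt_trans hM; rewrite mulrDr mulr1 (mulrC S); lra.
Qed.

End Uniqueness.

(** * Unboundedness of the power series of a dense orbit *)

Section Density.
Variables (R : realType) (u : cplx R).
Local Notation C := (cplx R).
Hypothesis u1 : modulus u = 1.
Hypothesis u_irr : forall n, (0 < n)%N -> u ^+ n != 1.

(** Pigeonhole principle for the angles of the powers of [u]. *)
Lemma small_rotation (e : R) : 0 < e -> exists d s,
  [/\ (0 < d)%N, u ^+ d = ei s, s != 0 & `|s| < e].
Proof.
move=> e0; have [M M0 hM] := grid_step_small e0; have h0 := grid_step_gt0 R M0.
have /choice[t ht] : forall n, exists t, [/\ 0 <= t, t < pi *+ 2 & u ^+ n = ei t].
  by move=> n; have [|t /andP[]] := @unit_ei R (u ^+ n); [rewrite modulusX u1 expr1n | exists t].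
pose b (n : 'I_(8 * M).+1) : nat := Num.truncn (t n / grid_step R M).
have tb n : 0 <= t n / grid_step R M by have [t0 _ _] := ht n; rewrite divr_ge0 // ltW.
have bN n : (b n < 8 * M)%N.
  have [t0 t2 _] := ht n; rewrite -(ltr_nat R).
  apply: (@le_lt_trans _ _ (t n / grid_step R M)); first by rewrite truncn_le.
  by rewrite ltr_pdivrMr // alphaN.
pose B n := Ordinal (bN n).
have : ~~ injectiveb B.
  apply/negP => /injectiveP/leq_card; rewrite !card_ord; apply/negP; rewrite -ltnNge; exact: ltnSn.
case/injectivePn => m [n mn] /(congr1 val) /= bmn.
have close : `|t m - t n| < grid_step R M.
  have := truncn_le (t m / grid_step R M); have := truncnS_gt (t m / grid_step R M).
  have := truncn_le (t n / grid_step R M); have := truncnS_gt (t n / grid_step R M).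
  rewrite !tb -/(b m) -/(b n) bmn !ler_pdivlMr // !ltr_pdivrMr // -natr1 mulrDl mul1r.
  by move=> *; rewrite ltr_norml; apply/andP; split; lra.
wlog lt : m n mn close {bmn} / (m < n)%N => [H|].
  have [lt|gt|eq] := ltngtP m n; first exact: H close lt.
    by apply: (H n m _ _ gt); rewrite 1?eq_sym // distrC.
  by case/eqP: mn; apply: val_inj.
have [_ _ em] := ht m; have [_ _ en] := ht n.
have ud : u ^+ (n - m) = ei (t n - t m).
  apply: (mulfI (ei_neq0 (t m))); rewrite -eiD addrC subrK -em -en -exprD.
  by rewrite subnKC // ltnW.
exists (n - m)%N, (t n - t m); split=> //; first by rewrite subn_gt0.
  apply: contraNneq (u_irr (n := n - m) _) => [s0|]; last by rewrite subn_gt0.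
  by rewrite ud s0 ei0.
by rewrite distrC (lt_trans close).
Qed.

(** Consecutive powers of a small rotation are close to each other, and they run
    around the circle. *)
Lemma orbit_dense (z : C) (e : R) : modulus z = 1 -> 0 < e ->
  exists n, modulus (u ^+ n - z) < e.
Proof.
move=> /unit_ei[t /andP[t0 t2] ->] e0; have [d [s [d0 us s0 se]]] := small_rotation e0.
have [t' tE t's] : exists2 t', ei t' = ei t & 0 <= t' / s.
  have [sp|sn] := ltP 0 s; first by exists t => //; rewrite divr_ge0 // ltW.
  exists (t - pi *+ 2); last by rewrite mulr_le0 ?invr_le0 // subr_le0 ltW.
  by rewrite -(ei_periodic (t - pi *+ 2) 1) mul1r subrK.
exists (d * Num.truncn (t' / s))%N; rewrite exprM us eiX -tE.
apply: le_lt_trans (ei_Lipschitz _ _) _; apply: le_lt_trans se.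
have := truncn_le (t' / s); have := truncnS_gt (t' / s); rewrite t's -natr1.
move: (_%:R) => q h1 h2; have -> : q * s - t' = (q - t' / s) * s.
  by rewrite mulrBl divfK.
by rewrite normrM ler_piMl // ler_norml; apply/andP; split; lra.
Qed.

End Density.

Section Unbounded.
Variable R : realType.
Local Notation C := (cplx R).
Local Notation h := (grid_step R).
Local Notation zeta := (zeta R).

(** Its mean over the grid is the Fourier coefficient of index [k]. *)
Definition harmonic (k : nat) (s : C) : C := (toric_degree s)%:C * (s^-1) ^+ k.

Lemma harmonic_Lipschitz k x y : modulus x = 1 -> modulus y = 1 ->
  modulus (harmonic k x - harmonic k y) <= (6 + 6 * k%:R) * modulus (x - y).
Proof.
move=> x1 y1; have -> : harmonic k x - harmonic k y =
    (toric_degree x - toric_degree y)%:C * (x^-1) ^+ k + (toric_degree y)%:C * ((x^-1) ^+ k - (y^-1) ^+ k).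
  rewrite real_complexB /harmonic.
  by move: ((toric_degree x)%:C) ((toric_degree y)%:C) (_ ^+ _) (_ ^+ k) => a b c d; ring.
apply: le_trans (ler_modulusD _ _) _; rewrite mulrDl; apply: lerD.
  by rewrite modulusM modulusX modulusV x1 invr1 expr1n mulr1 modulus_real norm_toric_degree_sub.
rewrite modulusM modulus_real ger0_norm ?toric_degree_ge0 // -mulrA.
apply: ler_pM; rewrite ?toric_degree_ge0 ?modulus_ge0 //; first by have := toric_degree_le y; rewrite y1 mulr1.
have V : modulus (x^-1 - y^-1) = modulus (x - y).
  have x0 : x != 0 by rewrite -modulus_gt0 x1.
  have y0 : y != 0 by rewrite -modulus_gt0 y1.
  have -> : x^-1 - y^-1 = - (x - y) * (x^-1 * y^-1) by field; rewrite x0 y0.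
  by rewrite modulusM modulusN modulusM !modulusV x1 y1 invr1 !mulr1.
by rewrite -V modulusX_sub // modulusV ?x1 ?y1 invr1.
Qed.

Lemma harmonic_grid_sum M b k : (0 < M)%N -> (k < 8 * M)%N ->
  \sum_(a < 8 * M) harmonic k (zeta M ^+ a * zeta M ^+ b) =
  (8 * M)%:R * (fourier R M k)%:C.
Proof.
move=> M0 kN; rewrite (grid_shift M0 (harmonic k)) fourierE //.
rewrite mulrC divfK ?pnatr_eq0 -?lt0n ?grid_size_gt0 //.
by apply: eq_bigr => j _; rewrite /harmonic -exprVn -exprM.
Qed.

Variable u : C.
Hypothesis u1 : modulus u = 1.

(** The powers [u ^+ j_ a] imitate the grid, and by [grid_shift] the sum over a grid
    rotated by [u ^+ j] is nearly the same for all [j]. *)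
Lemma harmonic_average M k (j_ : nat -> nat) j : (0 < M)%N -> (k < 8 * M)%N ->
  (forall a, modulus (u ^+ j_ a - zeta M ^+ a) <= h M) ->
  modulus (\sum_(a < 8 * M) harmonic k (u ^+ (j + j_ a)) -
    (8 * M)%:R * (fourier R M k)%:C) <=
  (8 * M)%:R * ((6 + 6 * k%:R) * (2 * h M)).
Proof.
move=> M0 kN ja; have uj1 : modulus (u ^+ j) = 1 by rewrite modulusX u1 expr1n.
have z1 n : modulus (zeta M ^+ n) = 1 by rewrite modulusX modulus_ei expr1n.
have [b ub] := grid_approx M0 uj1.
rewrite -(harmonic_grid_sum b M0 kN) -sumrB; apply: le_trans (modulus_sum _ _) _.
have -> : (8 * M)%:R * ((6 + 6 * k%:R) * (2 * h M)) =
    \sum_(a < 8 * M) ((6 + 6 * k%:R) * (2 * h M)).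
  by rewrite sumr_const card_ord mulr_natl.
apply: ler_sum => a _; apply: le_trans (harmonic_Lipschitz _ _ _) _.
- by rewrite modulusX u1 expr1n.
- by rewrite modulusM !z1 mulr1.
rewrite ler_wpM2l // ?addr_ge0 // ?mulr_ge0 //.
have -> : u ^+ (j + j_ a) - zeta M ^+ a * zeta M ^+ b =
    u ^+ j * (u ^+ j_ a - zeta M ^+ a) + zeta M ^+ a * (u ^+ j - zeta M ^+ b).
  rewrite exprD; move: (u ^+ j) (u ^+ j_ a) (zeta M ^+ a) (zeta M ^+ b) => x y z w; ring.
apply: le_trans (ler_modulusD _ _) _.
rewrite !modulusM uj1 z1 !mul1r; have := ja a; lra.
Qed.

Hypothesis u_irr : forall n, (0 < n)%N -> u ^+ n != 1.

Lemma geo_harmonic k i : geo_bound (fun n => harmonic k (u ^+ (n + i))) 6 1.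
Proof.
split=> // n; have n1 : modulus (u ^+ (n + i)) = 1 by rewrite modulusX u1 expr1n.
rewrite expr1n mulr1 modulusM modulusX modulusV n1 invr1 expr1n mulr1.
by rewrite modulus_real ger0_norm ?toric_degree_ge0 //; have := toric_degree_le (u ^+ (n + i)); rewrite n1 mulr1.
Qed.

Lemma ps_harmonic k (rho : R) :
  ps (orbit_degrees u) (rho%:C * (u^-1) ^+ k) = ps (fun n => harmonic k (u ^+ n)) rho%:C.
Proof.
rewrite /ps; congr (limn (series _)); apply/funext => n.
rewrite exprMn /orbit_degrees /harmonic -exprVn -!exprM (mulnC n k).
by rewrite mulrA mulrAC.
Qed.

(** At the points [u^-k] of the circle with [8 | k], the coefficients, once
    averaged over a finite set of shifts approximating a grid, stay close to a
    nonzero Fourier coefficient; so the power series cannot remain bounded along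
    the radius. *)
Lemma ps_unbounded m (B t : R) : (0 < m)%N -> 0 < t -> exists rho : R,
  [/\ 1 - t < rho, 0 < rho, rho < 1 &
    B < modulus (ps (orbit_degrees u) (rho%:C * (u^-1) ^+ (8 * m)))].
Proof.
move=> m0 t0; set k := (8 * m)%N; have pi0 := pi_gt0 R.
have k0 : 0 < k%:R :> R by rewrite ltr0n muln_gt0.
pose eta : R := (2 * (pi * k%:R ^+ 2))^-1; pose L : R := 6 + 6 * k%:R.
have eta0 : 0 < eta by rewrite invr_gt0 mulr_gt0 // mulr_gt0 // exprn_gt0.
have L0 : 0 < L by rewrite /L; lra.
have e0 : 0 < Num.min (eta / (2 * L)) (pi / (4 * m%:R)).
  by rewrite lt_min !divr_gt0 // mulr_gt0 // ltr0n.
have [M M0] := grid_step_small e0; rewrite lt_min => /andP[h1 h2].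
have mM : (m < M)%N.
  rewrite -(ltr_nat R) -(ltr_pM2l (_ : 0 < 4)) // -ltf_pV2 ?posrE ?mulr_gt0 ?ltr0n //.
  by rewrite -(ltr_pM2l pi0).
have kN : (k < 8 * M)%N by rewrite ltn_pmul2l.
have fb : 2 * eta <= modulus ((fourier R M k)%:C : C).
  have := @fourier_bound R M M0 m; rewrite m0 mM => /(_ isT) fb.
  rewrite modulus_real -normrN; apply: le_trans (ler_norm _).
  have p0 : 0 < pi * k%:R ^+ 2 :> R by rewrite mulr_gt0 // exprn_gt0.
  rewrite -(ler_pM2l p0); apply: le_trans fb; rewrite le_eqVlt; apply/orP; left.
  by apply/eqP; rewrite /eta; move: (pi * k%:R ^+ 2) p0 => p p0; field; rewrite gt_eqF.
have h0 := grid_step_gt0 R M0; set f := (fourier R M k)%:C : C in fb.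
have /choice[j_ hj] : forall a, exists n, modulus (u ^+ n - zeta M ^+ a) <= h M.
  move=> a; have [||n] := @orbit_dense R u u1 u_irr (zeta M ^+ a) (h M) => //.
    by rewrite modulusX modulus_ei expr1n.
  by move=> /ltW; exists n.
pose N := (8 * M)%N; have N_gt0 : 0 < N%:R :> R by rewrite ltr0n muln_gt0.
pose g n := \sum_(a < N) harmonic k (u ^+ (n + j_ a)).
pose r n : C := g n - N%:R * f.
have gr : geo_bound r (N%:R * eta) 1.
  split=> // n; rewrite expr1n mulr1; have H := harmonic_average n M0 kN hj; apply: (le_trans H).
  rewrite -/N ler_pM2l // mulrC; rewrite ltr_pdivlMr in h1; last by rewrite mulr_gt0.
  by move: h1; rewrite -/L; lra.
pose J := \max_(a < N) j_ a.
have jJ (a : 'I_N) : (j_ a <= J)%N by rewrite /J (leq_bigmax a).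
pose B' := 2 ^+ J * (`|B| + 6 * J%:R) : R.
have B'0 : 0 <= B' by rewrite mulr_ge0 ?exprn_ge0 // addr_ge0 // mulr_ge0.
pose d := Num.min (t / 2) (Num.min (1 / 2) (eta / (2 * (B' + 1)))).
have d0 : 0 < d by rewrite !lt_min !divr_gt0 // mulr_gt0 //; lra.
have [dt d2 dB] : [/\ d <= t / 2, d <= 1 / 2 & d <= eta / (2 * (B' + 1))].
  by rewrite !ge_min !lexx !orbT.
exists (1 - d); split; [lra | lra | lra |].
rewrite ltNge; apply/negP; rewrite ps_harmonic; set x := (1 - d)%:C; move=> WB.
have xm : modulus x = 1 - d by rewrite modulus_real ger0_norm; lra.
have bx : 1 * modulus x < 1 by rewrite mul1r xm; lra.
have x1 : modulus x < 1 by rewrite xm; lra.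
pose W a := ps (fun n => harmonic k (u ^+ (n + j_ a))) x.
have Wb (a : 'I_N) : modulus (W a) <= B'.
  have gh : geo_bound (fun n => harmonic k (u ^+ n)) 6 1.
    have := geo_harmonic k 0; congr (geo_bound _ 6 1).
    by apply/funext => n; rewrite addn0.
  have := ps_tail (j_ a) gh bx; rewrite -/(W a) => WE.
  have hW : modulus (x ^+ j_ a * W a) <= `|B| + 6 * J%:R.
    have -> : x ^+ j_ a * W a = ps (fun n => harmonic k (u ^+ n)) x -
        \sum_(i < j_ a) harmonic k (u ^+ i) * x ^+ i by rewrite WE [X in X - _]addrC addrK.
    apply: le_trans (ler_modulusB _ _) _; apply: lerD; first exact: le_trans (ler_norm _).
    apply: le_trans (modulus_sum _ _) _; apply: (@le_trans _ _ (\sum_(i < j_ a) 6)).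
      apply: ler_sum => i _; case: gh => _ /(_ i); rewrite expr1n mulr1 modulusM => hi.
      apply: le_trans hi; rewrite ler_piMr ?modulus_ge0 // modulusX xm exprn_ile1 //; lra.
    rewrite sumr_const card_ord (_ : 6 *+ j_ a = 6 * (j_ a)%:R); last by rewrite mulr_natr.
    by rewrite ler_pM2l // ler_nat.
  have hx : 1 <= 2 ^+ J * modulus (x ^+ j_ a).
    rewrite modulusX xm; apply: (@le_trans _ _ (2 ^+ j_ a * (1 - d) ^+ j_ a)).
      by rewrite -exprMn exprn_ege1 //; lra.
    by rewrite ler_wpM2r ?exprn_ge0 ?ler_weXn2l //; lra.
  rewrite modulusM in hW; have := modulus_ge0 (W a) => w0.
  rewrite /B'; apply: le_trans (ler_wpM2l (exprn_ge0 _ _) hW) => //.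
  by rewrite mulrA ler_peMl.
have gW : ps g x = \sum_(a < N) W a.
  apply: ps_unique.
  have -> : series (fun n => g n * x ^+ n) =
      fun q => \sum_(a < N) series (fun n => harmonic k (u ^+ (n + j_ a)) * x ^+ n) q.
    apply/funext => q; rewrite /series /= exchange_big; apply: eq_bigr => n _.
    by rewrite /g mulr_suml.
  by apply: cvg_finite_sum => a; exact: ps_cvg (geo_harmonic k (j_ a)) bx.
have gWb : modulus (ps g x) <= N%:R * B'.
  rewrite gW; apply: le_trans (modulus_sum _ _) _.
  apply: (@le_trans _ _ (\sum_(a < N) B')); first exact: ler_sum.
  by rewrite sumr_const card_ord mulr_natl.
have one1 : modulus (1 : C) = 1 by rewrite modulus1.
have [K gK psK] := @ps_geometric_sum R 1 (fun _ => N%:R * fourier R M k) (fun _ => 1) x (fun _ => one1) x1.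
have gE : g = fun n => r n + \sum_(i < 1) (N%:R * fourier R M k)%:C * 1 ^+ n.
  apply/funext => n; rewrite big_ord_recl big_ord0 addr0 expr1n mulr1 /r.
  by rewrite real_complexM rmorph_nat subrK.
move: gWb; rewrite {1}gE (psD gr gK bx) psK big_ord_recl big_ord0 addr0 mulr1 => up.
have lo := modulus_ps_le gr bx; rewrite mul1r xm opprB addrCA subrr addr0 in lo.
have low : N%:R * (2 * eta) / d <= modulus ((N%:R * fourier R M k)%:C / (1 - x)).
  have -> : 1 - x = d%:C by rewrite /x -[1]/(1%:C) -real_complexB; congr _%:C; lra.
  rewrite modulusM modulusV real_complexM modulusM -/f (modulus_real d) (modulus_real N%:R).
  rewrite (gtr0_norm d0) (gtr0_norm N_gt0) ler_pM2r ?invr_gt0 // ler_pM2l //; exact: fb.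
have tri : modulus ((N%:R * fourier R M k)%:C / (1 - x)) <= N%:R * B' + N%:R * eta / d.
  set a := _ / _ in up *; have -> : a = (ps r x + a) - ps r x by rewrite addrAC subrr add0r.
  by apply: le_trans (ler_modulusB _ _) _; apply: lerD.
have := le_trans low tri; rewrite ler_pdivrMr // [leRHS]mulrDl divfK ?gt_eqF //.
have -> : N%:R * B' * d = N%:R * (B' * d) by rewrite mulrA.
rewrite -mulrDr ler_pM2l //.
move: dB; rewrite ler_pdivlMr; last by rewrite mulr_gt0 //; lra.
by move: (B') (eta) (d) B'0 eta0 d0; clear => p q s p0 q0 s0; nra.
Qed.

End Unbounded.

(** * The rotation attached to a Gaussian integer *)

Section Rotation.
Variables (R : realType) (mu : int[i]).
Hypothesis mu_neq0 : mu != 0.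
Local Notation C := (cplx R).
Local Notation cj z := ((z)^*)%C.
Local Notation m := (gauss_cplx R mu : C).

Definition dilation : R := modulus m.
(** The conjugate of [mu] occurs because the monomial map acts on the lattice by
    the transpose of the matrix of [mu]. *)
Definition rotation : C := cj m / dilation%:C.

Lemma dilation_sqr : dilation ^+ 2 = (gauss_norm mu)%:R.
Proof.
rewrite modulus_sqr /= pmulrn gauss_normE intrD !rmorphXn //=.
Qed.

Lemma dilation_gt0 : 0 < dilation.
Proof.
have : 0 < dilation ^+ 2 by rewrite dilation_sqr ltr0n gauss_norm_gt0.
have b0 : 0 <= dilation := modulus_ge0 m.
by apply: contraTT; rewrite -leNgt => b1; rewrite (le_anti (introT andP (conj b1 b0))) expr0n ltxx.
Qed.

Lemma dilationC_neq0 : (dilation%:C : C) != 0.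
Proof. by rewrite -modulus_gt0 modulus_real gtr0_norm dilation_gt0. Qed.

Lemma conj_rotation : cj m = dilation%:C * rotation.
Proof. by rewrite mulrC divfK // dilationC_neq0. Qed.

Lemma modulus_rotation : modulus rotation = 1.
Proof.
rewrite modulusM modulusV modulus_conj modulus_real gtr0_norm ?dilation_gt0 //.
by rewrite divff // gt_eqF // dilation_gt0.
Qed.

(** A power of [rotation] equal to 1 would make the argument of [mu] a rational
    multiple of 2 pi. *)
Lemma rotation_irrational : arg_incommensurable m ->
  forall n, (0 < n)%N -> rotation ^+ n != 1.
Proof.
move=> irr n n0; have m1 : modulus (m / dilation%:C) = 1.
  rewrite modulusM modulusV modulus_real gtr0_norm ?dilation_gt0 //.
  by rewrite divff // gt_eqF // dilation_gt0.
have [t /andP[t0 t2] tE] := unit_ei m1.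
have pi0 := pi_gt0 R; have n0R : 0 < n%:R :> R by rewrite ltr0n.
have mE : m = dilation%:C * ei t by rewrite -tE mulrC divfK // dilationC_neq0.
have arg_t : is_arg m t by rewrite /is_arg normCE.
have rE : rotation = ei (- t).
  have cjE : cj m = dilation%:C * ei (- t).
    rewrite mE -conj_ei /ei; apply/eqP; rewrite eq_complex /=.
    by apply/andP; split; apply/eqP; ring.
  by rewrite /rotation cjE mulrC mulrA mulVf ?mul1r // dilationC_neq0.
apply/eqP; rewrite rE eiX mulrN => /(congr1 (@complex.Re R)) /=; rewrite cosN => cos1.
pose j := Num.truncn (n%:R * t / (pi *+ 2)).
have pp : 0 < pi *+ 2 :> R by rewrite mulr2n; lra.
have ge0 : 0 <= n%:R * t / (pi *+ 2) by rewrite divr_ge0 ?mulr_ge0 // ltW.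
have := truncn_le (n%:R * t / (pi *+ 2)); rewrite ge0 -/j ler_pdivlMr // => h1.
have := truncnS_gt (n%:R * t / (pi *+ 2)); rewrite -/j ltr_pdivrMr // -natr1 mulrDl mul1r => h2.
pose s := n%:R * t - j%:R * (pi *+ 2).
have cs : cos s = 1.
  have := ei_periodic s j; rewrite /s subrK => /(congr1 (@complex.Re R)) /= <-; exact: cos1.
have s0 : s = 0.
  apply/eqP/negPn/negP => sn; have := @cos_lt1 R s; rewrite cs ltxx => H.
  suff : false by []. apply: H; apply/andP; split; last by rewrite /s; lra.
  by rewrite lt_neqAle eq_sym sn /s; lra.
apply: (irr t arg_t (j%:Q / n%:Q)).
rewrite (_ : ratr _ = ratr j%:Q / ratr n%:Q); last exact: fmorph_div.
rewrite !ratr_int -!pmulrn.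
apply: (mulfI (lt0r_neq0 n0R)).
have alg (x y p : R) : 0 < x -> x * (y / x * (2 * p)) = y * (p *+ 2).
  by move=> x0; field; rewrite gt_eqF.
by rewrite alg //; apply/eqP; rewrite -subr_eq0 -/s s0.
Qed.

Lemma orbit_toric_degree n : \sum_l (psi (orbit_ray (gauss_mx mu) n l))%:R =
  dilation ^+ n * toric_degree (rotation ^+ n) :> R.
Proof.
rewrite -toric_degree_homog ?exprn_ge0 ?(ltW dilation_gt0) //; apply: eq_bigr => l _.
rewrite psi_toC toC_orbit conj_rotation exprMn; congr (PsiC (_ * _ * _)).
by rewrite rmorphXn.
Qed.

(** The directions of the rays are multiples of pi / 4. *)
Lemma rayC8 l : exists2 x : R, 0 < x & rayC R l ^+ 8 = x%:C.
Proof.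
have [r0 r1 r2] := rayCE R.
elim/forall_ord3: l; rewrite ?r0 ?r1 ?r2; [exists 16 | exists 1 | exists 1] => //;
  rewrite ?expr1n //; apply/eqP; rewrite !exprS expr0 eq_complex /=; apply/andP; split; apply/eqP; ring.
Qed.

Lemma not_in_open_cone v : ~ in_open_cone v ->
  exists l (x : R), 0 <= x /\ toC R v = x%:C * rayC R l.
Proof.
case: v => x y nc.
have [r0 r1 r2] := rayCE R.
have [[e x0]|[[x0 y0]|[x0 y0]]] : (x = y /\ x <= 0) \/ (x = 0 /\ 0 <= y) \/ (y = 0 /\ 0 <= x).
  have coincide i i' : i' != i -> toric_coord (x, y) i = vmin (x, y) ->
      toric_coord (x, y) i' = vmin (x, y) ->
      (x = y /\ x <= 0) \/ (x = 0 /\ 0 <= y) \/ (y = 0 /\ 0 <= x).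
    elim/forall_ord3: i; elim/forall_ord3: i';
      rewrite /toric_coord /vmin /= -?val_eqE /= ?inordK //= => _; clear; lia.
  have zero i : reduced (x, y) i = 0%N -> toric_coord (x, y) i = vmin (x, y).
    by move=> i0; apply/eqP; rewrite -subr_eq0 -reducedE i0.
  apply: contrapT => H; case: nc; have [i i0] := reduced_zero (x, y).
  exists i; split=> // i' ii; rewrite lt0n; apply/negP => /eqP i'0; apply: H.
  by apply: (coincide i i') => //; apply: zero.
- exists ord0, (- x)%:~R; rewrite ler0z oppr_ge0; split=> //; rewrite r0 /toC e.
  by apply/eqP; rewrite eq_complex /= !mulrNz; apply/andP; split; apply/eqP; ring.
- exists (inord 2), y%:~R; rewrite ler0z; split=> //; rewrite r2 /toC x0.
  by apply/eqP; rewrite eq_complex /=; apply/andP; split; apply/eqP; ring.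
- exists (inord 1), x%:~R; rewrite ler0z; split=> //; rewrite r1 /toC x0.
  by apply/eqP; rewrite eq_complex /=; apply/andP; split; apply/eqP; ring.
Qed.

(** If a moved ray were again a ray, comparing eighth powers would show that
    [rotation] has finite order. *)
Lemma orbit_rays_open : (forall n, (0 < n)%N -> rotation ^+ n != 1) ->
  forall j l, in_open_cone (orbit_ray (gauss_mx mu) j.+1 l).
Proof.
move=> irr j l; have := conj_rotation; move: (rotation) modulus_rotation irr => rot rot1 irr rotE.
apply: contrapT => /not_in_open_cone[l' [x [x0]]].
rewrite toC_orbit rotE => /(congr1 (fun z : C => z ^+ 8)).
have [a a0 aE] := rayC8 l; have [b b0 bE] := rayC8 l'.
rewrite !exprMn aE bE -!exprM mulnC => E.
have := irr (8 * j.+1)%N isT; apply/negP/negPn/eqP.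
set g := rot ^+ _ in E *; pose q := dilation ^+ (8 * j.+1).
have q0 : 0 < q by rewrite exprn_gt0 // dilation_gt0.
have {}E : (q * a)%:C * g = (x ^+ 8 * b)%:C.
  have rX (y : R) n : (y ^+ n)%:C = y%:C ^+ n :> C by exact: rmorphXn.
  by rewrite /q !real_complexM !rX -E mulrAC.
have g1 : modulus g = 1 by rewrite /g modulusX rot1 expr1n.
have qa0 : 0 < q * a by rewrite mulr_gt0.
have : q * a = x ^+ 8 * b.
  have := congr1 (@modulus R) E; rewrite modulusM g1 mulr1 !modulus_real.
  by rewrite (ger0_norm (ltW qa0)) (ger0_norm (mulr_ge0 (exprn_ge0 8 x0) (ltW b0))) => ->.
move=> e; rewrite -e in E; apply: (mulfI (_ : ((q * a)%:C : C) != 0)).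
  by rewrite -modulus_gt0 modulus_real gtr0_norm.
by rewrite mulr1.
Qed.

End Rotation.

(** * The degrees of the iterates of the map *)

Section Degrees.
Variables (k : fieldType) (mu : int[i]).
Hypothesis mu_neq0 : mu != 0.
Local Notation M := (gauss_mx mu).
Local Notation f := (f_mu k mu).
Local Notation iter_map := RationalMaps.iter_map.

Lemma alg_degree_iter n : 2%N \notin [pchar k] ->
  (forall j l, in_open_cone (orbit_ray M j.+1 l)) ->
  alg_degree (iter_map n f) = IteratedMaps.orbit_degree M n n.
Proof.
move=> k2 op; have two : (2%:R : k) != 0 by move: k2; rewrite inE.
have H d := IteratedMaps.has_alg_degree_iter two op n d.
rewrite /alg_degree; case: xgetP => [d _ /H //|no].
by case: (no (IteratedMaps.orbit_degree M n n)); apply/H.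
Qed.

Lemma top_degree_iter n : top_degree (iter_map n f) = (gauss_norm mu ^ n)%N.
Proof.
have [rep reps] := char_reps_gauss mu_neq0.
have H d := IteratedDegree.has_top_degree_iter k reps n d.
rewrite /top_degree; case: xgetP => [d _ /H //|no].
by case: (no (gauss_norm mu ^ n)%N); apply/H.
Qed.

End Degrees.

Section GeneratingSeries.
Variables (R : realType) (mu : int[i]).
Hypothesis mu_neq0 : mu != 0.
Local Notation C := (cplx R).
Local Notation M := (gauss_mx mu).
Local Notation u := (rotation R mu).
Local Notation beta := (dilation R mu).

Definition orbit_psi n : nat := (\sum_l psi (orbit_ray M n l))%N.
(** The degree of the iterate of order [n] of the monomial map. *)
Definition ray_degree n : R := (orbit_psi n)%:R.
(** The common degree of the forms [curve n l]. *)
Definition chain_degree n : R := (new_degree M n)%:R.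

Lemma ray_degreeE n : ray_degree n = beta ^+ n * toric_degree (u ^+ n).
Proof. by rewrite /ray_degree natr_sum orbit_toric_degree. Qed.

Lemma orbit_psi0 : orbit_psi 0 = 1%N.
Proof.
rewrite /orbit_psi (bigD1 ord0) //= big1 => [|l l0]; first by rewrite /psi reduced_ray.
by rewrite /psi reduced_ray eq_sym (negPf l0).
Qed.

Lemma chain_degree0 : chain_degree 0 = 1.
Proof. by []. Qed.

Lemma chain_degreeS n :
  chain_degree n.+1 = \sum_(j < n.+1) chain_degree j * ray_degree (n.+1 - j).
Proof.
rewrite /chain_degree new_degreeS natr_sum; apply: eq_bigr => j _.
by rewrite -big_distrr natrM.
Qed.

Lemma orbit_degree_conv n : (IteratedMaps.orbit_degree M n n)%:R =
  \sum_(j < n.+1) chain_degree j * ray_degree (n - j) :> R.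
Proof.
rewrite natr_sum; apply: eq_bigr => j _.
by rewrite -big_distrr natrM.
Qed.

Lemma ray_degree0 : ray_degree 0 = 1.
Proof. by rewrite /ray_degree orbit_psi0. Qed.

(** For positive [n], the last generation of curves contributes as much to the
    degree as all the previous ones together. *)
Lemma orbit_degreeE n : (IteratedMaps.orbit_degree M n n)%:R =
  2 * chain_degree n - (n == 0%N)%:R :> R.
Proof.
rewrite orbit_degree_conv; case: n => [|n].
  by rewrite big_ord_recr big_ord0 /= subnn ray_degree0 chain_degree0; lra.
rewrite big_ord_recr /= subnn ray_degree0 -chain_degreeS; lra.
Qed.

Lemma ray_degree_ge n : 2^-1 * beta ^+ n <= ray_degree n.
Proof.
have b0 : 0 < beta ^+ n by rewrite exprn_gt0 // dilation_gt0.
have := toric_degree_ge (u ^+ n); rewrite modulusX modulus_rotation // expr1n => h.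
by rewrite ray_degreeE mulrC ler_pM2l //; lra.
Qed.

Lemma ray_degree_le n : ray_degree n <= 6 * beta ^+ n.
Proof.
have b0 : 0 < beta ^+ n by rewrite exprn_gt0 // dilation_gt0.
have := toric_degree_le (u ^+ n); rewrite modulusX modulus_rotation // expr1n mulr1 => h.
by rewrite ray_degreeE mulrC ler_pM2r.
Qed.

Lemma D_orbit_degrees z : D ray_degree z = ps (orbit_degrees u) (beta%:C * z).
Proof.
rewrite /D /ps; congr (limn (series _)); apply/funext => n.
rewrite /dC /orbit_degrees ray_degreeE real_complexM [(beta%:C * z) ^+ n]exprMn.
have -> : (beta ^+ n)%:C = beta%:C ^+ n :> C by exact: rmorphXn.
by rewrite -mulrA mulrCA.
Qed.

(** This is the identity [(1 + F) (2 - D) = 2], for the series F of the degrees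
    of the iterates. *)
Lemma degree_series n :
  cauchy_prod (fun n => (IteratedMaps.orbit_degree M n n)%:R)
    (fun n => coef_const (2 : C) n - dC ray_degree n) n = dC ray_degree n.
Proof.
pose e n : R := (IteratedMaps.orbit_degree M n n)%:R.
pose b n : R := (if n == 0%N then 2 else 0) - ray_degree n.
transitivity ((\sum_(i < n.+1) e i * b (n - i)%N)%:C : C).
  rewrite rmorph_sum; apply: eq_bigr => i _.
  transitivity ((e i)%:C * (b (n - i)%N)%:C : C); last exact/esym/real_complexM.
  rewrite /b real_complexB /dC; congr (_ * _).
    by rewrite /e rmorph_nat.
  by congr (_ - _); rewrite /coef_const; case: ifP => _; rewrite ?rmorph_nat // rmorph0.
rewrite /dC; congr _%:C.
have -> : \sum_(i < n.+1) e i * b (n - i)%N =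
    2 * e n - \sum_(i < n.+1) e i * ray_degree (n - i).
  rewrite /b; under eq_bigr do rewrite mulrBr; rewrite sumrB; congr (_ - _).
  rewrite big_ord_recr /= subnn eqxx big1 ?add0r 1?mulrC // => i _.
  by rewrite subn_eq0 leqNgt ltn_ord mulr0.
have -> : \sum_(i < n.+1) e i * ray_degree (n - i) = 2 * e n - ray_degree n.
  under eq_bigr => i _ do rewrite /e orbit_degreeE mulrBl -mulrA.
  rewrite sumrB -mulr_sumr -orbit_degree_conv -/(e n); congr (_ - _).
  rewrite big_ord_recl /= subn0 mul1r big1 ?addr0 // => i _.
  by rewrite mul0r.
lra.
Qed.

Hypothesis irr : forall n, (0 < n)%N -> u ^+ n != 1.

(** Scaling by [dilation] reduces this to [orbit_degrees_inj2]. *)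
Lemma D_inj2 (z w : C) : beta * modulus z < 1 -> beta * modulus w < 1 ->
  D ray_degree z = 2 -> D ray_degree w = 2 -> z = w.
Proof.
have b0 := dilation_gt0 R mu_neq0.
have mb x : modulus (beta%:C * x) = beta * modulus x.
  by rewrite modulusM modulus_real gtr0_norm.
rewrite -!mb !D_orbit_degrees => z1 w1 Dz Dw.
apply: (mulfI (dilationC_neq0 R mu_neq0)).
have H := orbit_degrees_inj2 (modulus_rotation R mu_neq0) z1 w1.
by apply: H.
Qed.

(** The points [w'] are the powers of [u^-8], rescaled; at most one of the powers
    used can be [w], since [u] is not a root of unity. *)
Lemma D_unbounded (w : C) : beta * modulus w = 1 -> forall e : R, 0 < e ->
  exists w' : C, [/\ w' != w, beta * modulus w' = 1, modulus (w' - w) < e &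
    forall B t : R, 0 < t -> exists rho : R,
      [/\ 1 - t < rho, 0 < rho, rho < 1 & B < modulus (D ray_degree (rho%:C * w'))]].
Proof.
have b0 := dilation_gt0 R mu_neq0; have bC := dilationC_neq0 R mu_neq0.
have u1 := modulus_rotation R mu_neq0.
have mb x : modulus (beta%:C * x) = beta * modulus x.
  by rewrite modulusM modulus_real gtr0_norm.
rewrite -mb; set z := beta%:C * w => z1 e e0.
pose v := (u^-1) ^+ 8.
have v1 : modulus v = 1 by rewrite modulusX modulusV u1 invr1 expr1n.
have virr n : (0 < n)%N -> v ^+ n != 1.
  move=> n0; rewrite -exprM exprVn invr_eq1; apply: irr; by rewrite muln_gt0.
have v0 : v != 0 by rewrite -modulus_gt0 v1.
have near n : exists j, (n < j)%N /\ modulus (v ^+ j - z) < beta * e.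
  have [||j hj] := orbit_dense v1 virr (z := z / v ^+ n.+1) (e := beta * e).
  - by rewrite modulusM modulusV modulusX v1 expr1n invr1 mulr1.
  - exact: mulr_gt0.
  exists (n.+1 + j)%N; split; first by rewrite addSn ltnS leq_addr.
  have -> : v ^+ (n.+1 + j) - z = v ^+ n.+1 * (v ^+ j - z / v ^+ n.+1).
    by rewrite mulrBr -exprD mulrCA divff ?mulr1 // expf_neq0.
  by rewrite modulusM modulusX v1 expr1n mul1r.
have [n [n0 nz vn]] : exists n, [/\ (0 < n)%N, v ^+ n != z & modulus (v ^+ n - z) < beta * e].
  have [n [n0 hn]] := near 0%N; have [nz|nz] := eqVneq (v ^+ n) z; last by exists n.
  have [n' [nn' hn']] := near n; exists n'; split=> //; first exact: leq_ltn_trans nn'.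
  rewrite -(subnKC (ltnW nn')) exprD nz -[X in _ != X]mulr1 (inj_eq (mulfI _)) ?virr ?subn_gt0 //.
  by rewrite -modulus_gt0 z1.
have wE : w = beta%:C^-1 * z by rewrite mulrA mulVf ?mul1r.
exists (beta%:C^-1 * v ^+ n); split.
- by rewrite wE (inj_eq (mulfI _)) // invr_eq0.
- rewrite -mb mulrA divff // mul1r modulusX v1 expr1n //.
- rewrite wE -mulrBr modulusM modulusV modulus_real gtr0_norm //.
  by rewrite mulrC ltr_pdivrMr // mulrC.
move=> B t t0; have [rho [r1 r2 r3 r4]] := ps_unbounded u1 irr B n0 t0.
have cancel (a b c : C) : a != 0 -> a * (b * (a^-1 * c)) = b * c.
  by move=> a0; rewrite mulrCA (mulrA a) divff ?mul1r.
have E : D ray_degree (rho%:C * (beta%:C^-1 * v ^+ n)) =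
    ps (orbit_degrees u) (rho%:C * (u^-1) ^+ (8 * n)).
  by rewrite D_orbit_degrees (cancel _ rho%:C (v ^+ n) bC) (exprM u^-1 8 n).
by exists rho; rewrite E; split; [exact: r1 | exact: r2 | exact: r3 | exact: r4].
Qed.

End GeneratingSeries.

Theorem corollaryB (R : realType) (k : closedFieldType)
    (k_char : 2%N \notin [pchar k])
    (mu : int[i]) (mu_neq0 : mu != 0)
    (mu_arg : arg_incommensurable (gauss_cplx R mu)) :
  let f := f_mu k mu in
  let lambda1 : R := dynamical_degree R (@alg_degree k) f in
  let lambda2 : R := dynamical_degree R (@top_degree k) f in
  let r : R := lambda2 `^ (- 2^-1) in
  let p : cplx R := (lambda1^-1)%:C in
  [/\ cvgn (degree_roots R (@alg_degree k) f),
      cvgn (degree_roots R (@top_degree k) f) &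
      exists F : cplx R -> cplx R,
        [/\ has_power_series F 0
              (fun n => (alg_degree (RationalMaps.iter_map n f))%:R),
            meromorphic_on (disk r) F,
            disk r p /\ pole_at F 1 p,
            forall m z, disk r z -> pole_at F m z -> z = p &
            natural_boundary r F]].
Proof.
move=> f lambda1 lambda2 r p.
have b0 := dilation_gt0 R mu_neq0; set beta := dilation R mu in b0.
have irr := rotation_irrational mu_neq0 mu_arg.
have algE n := alg_degree_iter n k_char (orbit_rays_open mu_neq0 irr).
have half : (0 : R) < 2^-1 by lra.
have d0 := ray_degree0 R mu; have dge := ray_degree_ge R mu_neq0.
have dle := ray_degree_le R mu_neq0.
have [x [x0 x1 Dx]] := D_eq2 d0 b0 half dge dle.
have [s [sE scvg sle]] := D_real b0 half dge dle (ltW x0) x1.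
have s2 : s = 2.
  by move: sE; rewrite Dx => /(congr1 (@complex.Re R)) /= <-.
rewrite {}s2 {sE} in scvg sle.
have dpos n : 0 < ray_degree R mu n.
  by apply: lt_le_trans (dge n); rewrite mulr_gt0 // exprn_gt0.
have [q q0 qle] := renewal_lower d0 dpos dle b0 x0 x1 scvg sle
  (chain_degree0 R mu) (chain_degreeS R mu).
have upper := renewal_upper d0 dpos x0 sle (chain_degree0 R mu) (chain_degreeS R mu).
have algroots : degree_roots R (@alg_degree k) f @ \oo --> x^-1.
  apply: (@cvg_root_geometric R _ _ (2 * q) 2); rewrite ?invr_gt0 ?mulr_gt0 //.
  move=> n n0; rewrite algE orbit_degreeE (gtn_eqF n0) subr0 exprVn.
  have xn : 0 < x ^+ n by rewrite exprn_gt0.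
  rewrite ler_pdivrMr // ler_pdivlMr // -!mulrA !ler_pM2l //.
  by rewrite qle -[leRHS]mulr1 ler_pM2l // upper.
have l1 : lambda1 = x^-1 by exact: (cvg_lim (@Rhausdorff R) algroots).
have toproots : degree_roots R (@top_degree k) f @ \oo --> ((gauss_norm mu)%:R : R).
  apply: (@cvg_root_geometric R _ _ 1 1); rewrite ?ltr01 ?ltr0n ?gauss_norm_gt0 //.
  by move=> n _; rewrite top_degree_iter // natrX !mul1r lexx.
have l2 : lambda2 = (gauss_norm mu)%:R by exact: (cvg_lim (@Rhausdorff R) toproots).
have rE : r = beta^-1.
  rewrite /r l2 powRN powR12_sqrt // -(dilation_sqr R mu) sqrtr_sqr ger0_norm //.
  exact: ltW.
have pE : p = x%:C by rewrite /p l1 invrK.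
have uniq z : beta * modulus z < 1 -> D (ray_degree R mu) z = 2 -> z = x%:C.
  move=> z1 Dz; apply: (D_inj2 mu_neq0) Dz Dx => //.
  by rewrite modulus_real gtr0_norm.
split; [by apply/cvg_ex; exists x^-1 | by apply/cvg_ex; eexists; exact: toproots |].
exists (Fquot (ray_degree R mu)); rewrite rE pE; split.
- under [X in has_power_series _ _ X]eq_fun do rewrite algE.
  have H := F_power_series d0 b0 half dge dle (degree_series R mu).
  exact: H.
- exact: (F_meromorphic b0 half dge dle x0 x1 Dx uniq).
- split; last exact: (F_pole_p b0 half dge dle x0 x1 Dx).
  rewrite /disk /= normCE ltcR modulus_real gtr0_norm //.
  by rewrite -[beta^-1]mul1r ltr_pdivlMr // mulrC.
- by move=> m z; exact: (F_only_pole b0 half dge dle uniq).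
- exact: (F_natural_boundary b0 (D_unbounded mu_neq0 irr)).
Qed.
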